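(* For every $d>0$ and $\sigma\ge 0$ there exists $\chi>0$, depending only on $d$ and $\sigma$, such that the following holds. Let \[ F(z)=\sum_{n\ge 0}\omega_n\,\frac{z^n}{n!} \] ($\omega_n\in\mathbb C$) be an entire function of exponential type at most $\sigma$ such that the set $\Lambda_F=\{n\in\mathbb Z_+\colon |\omega_n|=1\}$ has positive lower density equal to $d$. Then either \[ \liminf_{R\to\infty}\frac{n_F(R)}{R}\ \ge\ \chi , \] or $F(z)=\Theta e^{\alpha z}$ for some $\Theta,\alpha\in\mathbb C$ with $|\alpha|=|\Theta|=1$.
   Context: $\mathbb Z_+$ denotes the non-negative integers. An entire function $F$ is of exponential type at most $\sigma$ if for each $\delta>0$ there is $A_\delta$ such that $|F(z)|\le A_\delta e^{(\sigma+\delta)|z|}$ for all $z\in\mathbb C$. The lower density of $X\subset\mathbb Z_+$ is $\liminf_{N\to\infty}|X\cap[1,N]|/N$. For an entire function $F$, $n_F(R)$ denotes the number of zeroes of $F$ in the closed disk $\{|z|\le R\}$, counted with multiplicities. *)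

(* Defs.v *)
From HB Require Import structures.
From mathcomp Require Import all_boot all_order all_algebra.
From mathcomp Require Import complex.
From mathcomp Require Import all_classical all_reals all_analysis.

Set Implicit Arguments.
Unset Strict Implicit.
Unset Printing Implicit Defensive.

Import Order.TTheory GRing.Theory Num.Theory.
Import numFieldNormedType.Exports.

Local Open Scope complex_scope.
Local Open Scope ring_scope.
Local Open Scope classical_set_scope.

(* The regular module [R[i]^o] is the alias of [R[i]] that carries the
   topology and normed-module structure of the complex plane.  Its norm is
   valued in [R[i]]; the real-valued modulus is [cabs]. *)
Notation Cplx R := ((R[i])^o) (only parsing).

Definition cabs (R : realType) (z : Cplx R) : R := Normc.normc z.

Definition cexp (R : realType) (z : Cplx R) : Cplx R :=
  (expR (complex.Re z))%:C * (cos (complex.Im z) +i* sin (complex.Im z)).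

(* [derivable] over the scalar field [R[i]] is complex differentiability. *)
Definition entire (R : realType) (F : Cplx R -> Cplx R) : Prop :=
  forall z, derivable F z 1.

Definition exponential_type_le (R : realType) (sigma : R)
    (F : Cplx R -> Cplx R) : Prop :=
  forall delta : R, 0 < delta ->
    exists A : R, forall z, cabs (F z) <= A * expR ((sigma + delta) * cabs z).

Definition lower_density (R : realType) (X : set nat) : \bar R :=
  limn_einf (fun N : nat =>
    ((\sum_(1 <= n < N.+1) (n \in X))%N%:R / N%:R : R)%:E).

(* Order of vanishing at [a]: the least [k] with a nonzero [k]-th complex
   derivative at [a], and [+oo] when all derivatives vanish there. *)
Definition zero_order (R : realType) (F : Cplx R -> Cplx R) (a : Cplx R) :
    \bar R :=
  ereal_inf [set (k%:R : R)%:E | k in [set k : nat | F^`(k) a != 0]].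

(* Extended-real valued: it is [+oo] when there are infinitely many zeros. *)
Definition num_zeros (R : realType) (F : Cplx R -> Cplx R) (r : R) : \bar R :=
  \esum_(z in [set z : Cplx R | cabs z <= r /\ F z = 0]) zero_order F z.

(* Main.v *)
Require Import Defs.
From HB Require Import structures.
From mathcomp Require Import all_boot all_order all_algebra.
From mathcomp Require Import cyclic separable cyclotomic.
From mathcomp Require Import ring lra zify.
From mathcomp Require Import complex.
From mathcomp Require Import all_classical all_reals all_analysis.

Set Implicit Arguments.
Unset Strict Implicit.
Unset Printing Implicit Defensive.

Import Order.TTheory GRing.Theory Num.Theory.
Import numFieldNormedType.Exports.

Local Open Scope complex_scope.
Local Open Scope ring_scope.
Local Open Scope classical_set_scope.

(* If [n_F R < chi * R] for arbitrarily large [R], factor truncations of the series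
   over their roots and control the roots by Jensen's formula: for arbitrarily large
   [r] there is [alpha] such that [F z * exp (- alpha z)] is at most [exp (eta r)] for
   [|z| = r].  Consequently the Newton polynomial [h] interpolating
   [omega_n * alpha ^- n] at [0, ..., N], with [N] proportional to [r], is at most
   [exp (eta' N)] on [|z| <= N].  By the Schwarz lemma, a polynomial of that size which
   vanishes at a proportion of the integers of [0, N] large compared with [eta'] is
   exponentially small near the origin.  This is applied as follows.
   - [p = h h^*] equals [|omega_n|^2 |alpha|^(-2n)] at [n <= N].  For some bounded [t]
     the set of the [n] with [|omega_n| = |omega_(n+t)| = 1] is dense, hence
     [p (z + t) - |alpha|^(-2t) p z] is small, and [|omega_(m+t)| = |omega_m|] for all [m].
   - Along a progression where [|omega_n| = 1], [p] is geometric; its iterated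
     differences are small, which forces [|alpha|] to be close to [1].  Then
     [p * sum_k binomial(z, k) (|alpha|^2 - 1)^k - 1] is small on [|z| <= N / 10]: all
     the [|omega_m|] are [1], and [h] has no zero in this disk.
   - Having at most [N] roots, all of them far away, [h] is almost geometric near the
     origin, so that [omega_(m+2) omega_m = omega_(m+1)^2]. *)

(** * The complex modulus and Cauchy estimates for polynomials *)

(** Since [chi] may depend only on [d] and [sigma], the constants are fixed backwards: [d] yields
    the shift bound [L] and the pair density [delta1], these yield the growth rate [eta1] allowed
    for [h], then come [eta] for the twisted series and [chi]. Everything else about [F] enters only
    through how large [r] or [N] must be. The obstacle is that [alpha] changes with the scale and is
    not known to converge. Only relations from which [alpha] cancels, or in which it occurs with a
    fixed power, can be tested as [N] grows: such a power is polynomial in [N], while the gains are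
    exponential. A lower bound on [|alpha|], without which the division by [alpha ^+ k] would spoil
    the interpolant, comes from the density: some [omega n] of modulus one with [n] proportional to
    [r] forces it. The analysis is done on polynomials, where Cauchy's estimate is an average over
    roots of unity and Jensen's formula a product of reflected factors. Truncations are tied to the
    zeros of [F] by a limit of their roots. *)

Definition cmod (R : realType) (z : R[i]) : R := Normc.normc z.

Arguments cmod : simpl never.

Lemma eq_ler (R : numDomainType) (x y : R) : x = y -> x <= y.
Proof. by move=> ->. Qed.

Section CabsTheory.
Variable R : realType.
Implicit Types z w : R[i].

Lemma cmod_norm z : (cmod z)%:C = `|z|.
Proof. by rewrite normc_def; case: z => a b; rewrite /cmod. Qed.

Lemma cmod_ge0 z : 0 <= cmod z.
Proof. by rewrite -ler0c cmod_norm. Qed.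

Lemma cmod0 : cmod (0 : R[i]) = 0.
Proof. exact: Normc.normc0. Qed.

Lemma cmod1 : cmod (1 : R[i]) = 1.
Proof. exact: Normc.normc1. Qed.

Lemma cmodM z w : cmod (z * w) = cmod z * cmod w.
Proof. exact: Normc.normcM. Qed.

Lemma cmodN z : cmod (- z) = cmod z.
Proof. by apply: (@complexI R); rewrite !cmod_norm normrN. Qed.

Lemma cmodV z : cmod z^-1 = (cmod z)^-1.
Proof. exact: Normc.normcV. Qed.

Lemma cmod_triangle z w : cmod (z + w) <= cmod z + cmod w.
Proof. exact: le_normcD. Qed.

Lemma cmod_triangleB z w : cmod (z - w) <= cmod z + cmod w.
Proof. by rewrite (le_trans (cmod_triangle _ _))// cmodN. Qed.

Lemma cmod_ler_sub z w : cmod z - cmod w <= cmod (z + w).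
Proof.
by rewrite lerBlDr -[X in cmod X <= _](addrK w) (le_trans (cmod_triangleB _ _)).
Qed.

Lemma cmodB z w : cmod (z - w) = cmod (w - z).
Proof. by rewrite -cmodN opprB. Qed.

Lemma cmod_eq0 z : (cmod z == 0) = (z == 0).
Proof. by rewrite -(inj_eq (@complexI R)) cmod_norm normr_eq0. Qed.

Lemma cmod_gt0 z : (0 < cmod z) = (z != 0).
Proof. by rewrite lt0r cmod_ge0 andbT cmod_eq0. Qed.

Lemma cmodX z n : cmod (z ^+ n) = cmod z ^+ n.
Proof. by elim: n => [|n IH]; rewrite ?expr0 ?cmod1// !exprS cmodM IH. Qed.

Lemma cmod_real (x : R) : cmod x%:C = `|x|.
Proof. by rewrite /cmod /= expr0n addr0 sqrtr_sqr. Qed.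

Lemma cmod_nat n : cmod (n%:R : R[i]) = n%:R.
Proof. by rewrite -(rmorph_nat (real_complex R)) cmod_real ger0_norm. Qed.

Lemma cmod_conj z : cmod z^* = cmod z.
Proof. by apply: (@complexI R); rewrite !cmod_norm normcJ. Qed.

Lemma cmod_sqr z : (cmod z ^+ 2)%:C = z * z^*.
Proof. by rewrite rmorphXn/= cmod_norm sqr_normc. Qed.

Lemma cmod_sum (I : Type) (r : seq I) (P : pred I) (F : I -> R[i]) :
  cmod (\sum_(i <- r | P i) F i) <= \sum_(i <- r | P i) cmod (F i).
Proof.
elim/big_ind2: _ => [|x a y b xa yb|//]; first by rewrite cmod0.
by rewrite (le_trans (cmod_triangle _ _))// lerD.
Qed.

Lemma cmod_prod (I : Type) (r : seq I) (P : pred I) (F : I -> R[i]) :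
  cmod (\prod_(i <- r | P i) F i) = \prod_(i <- r | P i) cmod (F i).
Proof.
by elim/big_ind2: _ => [|x a y b <- <-|//]; rewrite ?cmod1 ?cmodM.
Qed.

Lemma Re_le_cmod z : `|complex.Re z| <= cmod z.
Proof. by rewrite -lecR cmod_norm normc_ge_Re. Qed.

Lemma Im_le_cmod z : `|complex.Im z| <= cmod z.
Proof.
by case: z => a b; rewrite /cmod/= -sqrtr_sqr ler_wsqrtr// lerDr sqr_ge0.
Qed.

Lemma cmod_le_ReIm z : cmod z <= `|complex.Re z| + `|complex.Im z|.
Proof.
rewrite {1}[z]complexE (le_trans (cmod_triangle _ _))// cmodM !cmod_real.
suff -> : cmod ('i : R[i]) = 1 by rewrite mul1r.
by rewrite /cmod/= expr0n expr1n add0r sqrtr1.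
Qed.

Lemma cmod_le0 z : cmod z <= 0 -> z = 0.
Proof. by move=> z0; apply/eqP; rewrite -cmod_eq0 eq_le z0 cmod_ge0. Qed.

Lemma cmod_arbitrarily_small z : (forall e : R, 0 < e -> cmod z <= e) -> z = 0.
Proof.
move=> h; apply: cmod_le0; apply/ler_addgt0Pr => e e0.
by rewrite add0r h.
Qed.

Lemma cmod_horner_le (f : {poly R[i]}) z :
  cmod f.[z] <= \sum_(k < size f) cmod f`_k * cmod z ^+ k.
Proof.
rewrite horner_coef (le_trans (cmod_sum _ _ _))//.
by apply: ler_sum => k _; rewrite cmodM cmodX.
Qed.

End CabsTheory.

Section PolynomialBounds.
Variable R : realType.
Local Notation C := R[i].

Lemma prim_root_exists n : (0 < n)%N -> exists zeta : C, n.-primitive_root zeta.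
Proof.
pose p : {poly C} := 'X^n - 1; have [r Dp] := closed_field_poly_normal p.
move=> n_gt0; rewrite (monicP _) ?monicXnsubC// scale1r in Dp.
have rn1 : all n.-unity_root r by apply/allP=> z; rewrite -root_prod_XsubC -Dp.
have sz_r : (n < (size r).+1)%N.
  by rewrite -(size_prod_XsubC r id) -Dp size_XnsubC.
have [|z] := hasP (has_prim_root n_gt0 rn1 _ sz_r); last by exists z.
by rewrite -separable_prod_XsubC -Dp separable_Xn_sub_1 // pnatr_eq0 -lt0n.
Qed.

Lemma cmod_prim_root n (zeta : C) : n.-primitive_root zeta -> cmod zeta = 1.
Proof.
move=> pz; have n0 := prim_order_gt0 pz.
apply/eqP; rewrite -(@pexpr_eq1 _ _ n) ?cmod_ge0//.
by rewrite -cmodX (prim_expr_order pz) cmod1.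
Qed.

Lemma sum_prim_root_expr n (zeta : C) k : n.-primitive_root zeta ->
  \sum_(i < n) (zeta ^+ k) ^+ i = if (n %| k)%N then n%:R else 0.
Proof.
move=> pz; case: ifPn => [/dvdnP[q ->]|nk].
  rewrite mulnC exprM (prim_expr_order pz) expr1n.
  under eq_bigr do rewrite expr1n.
  by rewrite sumr_const card_ord.
have z1 : zeta ^+ k - 1 != 0 by rewrite subr_eq0 -(prim_order_dvd pz).
apply: (mulfI z1); rewrite mulr0 -subrX1 -exprM mulnC exprM.
by rewrite (prim_expr_order pz) expr1n subrr.
Qed.

(* Averaging over the [n]-th roots of unity, [n] larger than the degree, isolates
   the constant term exactly; multiplying by [z ^ (n - k)] isolates the [k]-th. *)
Lemma cauchy_poly (f : {poly C}) (rho B : R) : 0 < rho ->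
  (forall z, cmod z = rho -> cmod f.[z] <= B) ->
  forall k, cmod f`_k * rho ^+ k <= B.
Proof.
move=> rho0 fB k.
have B0 : 0 <= B.
  by apply: le_trans (fB rho%:C _); rewrite ?cmod_ge0// cmod_real gtr0_norm.
have [kf|] := ltnP k (size f); last first.
  by move=> kf; rewrite nth_default// cmod0 mul0r.
pose n := size f; have n0 : (0 < n)%N by exact: leq_ltn_trans kf.
have [zeta pz] := prim_root_exists n0.
have cz := cmod_prim_root pz.
have key : \sum_(i < n) f.[rho%:C * zeta ^+ i] * (zeta ^+ i) ^+ (n - k)
    = n%:R * (f`_k * rho%:C ^+ k).
  under eq_bigr => i _ do rewrite horner_coef mulr_suml.
  rewrite exchange_big/= (bigD1 (Ordinal kf))//= [X in _ + X]big1 ?addr0.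
    under eq_bigr => i _.
      rewrite exprMn -!mulrA -exprD -exprM mulnC subnKC; last exact: ltnW.
      rewrite exprM (prim_expr_order pz) expr1n mulr1; over.
    by rewrite sumr_const card_ord mulr_natl.
  move=> j jk; under eq_bigr => i _.
    rewrite exprMn -!mulrA -exprD -exprM mulnC exprM; over.
  rewrite -!mulr_sumr sum_prim_root_expr// ifF ?mulr0//.
  apply/negbTE/negP => /dvdnP[q].
  have jn : (j < n)%N := ltn_ord j; have : nat_of_ord j != k.
    by apply: contraNneq jk => jk; apply/eqP/val_inj.
  have : (k < n)%N := kf.
  case: q => [|[|q]]; rewrite ?mul0n ?mul1n ?mulSn; lia.
have : cmod (n%:R * (f`_k * rho%:C ^+ k)) <= n%:R * B.
  rewrite -key (le_trans (cmod_sum _ _ _))//.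
  rewrite [leRHS]mulr_natl -[X in _ *+ X]card_ord -sumr_const; apply: ler_sum.
  move=> i _; rewrite cmodM !cmodX cz !expr1n mulr1 fB//.
  by rewrite cmodM cmodX cz expr1n mulr1 cmod_real gtr0_norm.
rewrite cmodM cmod_nat ler_pM2l ?ltr0n// cmodM cmodX cmod_real gtr0_norm//.
Qed.

Lemma sum_halves_le2 n : \sum_(k < n) (2^-1 : R) ^+ k <= 2.
Proof.
suff -> : \sum_(k < n) (2^-1 : R) ^+ k = 2 - 2 * 2^-1 ^+ n.
  by rewrite gerBl mulr_ge0// exprn_ge0.
elim: n => [|n IH]; first by rewrite big_ord0 expr0 mulr1 subrr.
by rewrite big_ord_recr/= IH exprS; lra.
Qed.

Lemma poly_bound_inside (f : {poly C}) (rho B : R) : 0 < rho ->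
  (forall z, cmod z = rho -> cmod f.[z] <= B) ->
  forall w, cmod w <= rho / 2 -> cmod f.[w] <= 2 * B.
Proof.
move=> rho0 fB w wr; rewrite (le_trans (cmod_horner_le _ _))//.
have B0 : 0 <= B.
  by apply: le_trans (fB rho%:C _); rewrite ?cmod_ge0// cmod_real gtr0_norm.
apply: (@le_trans _ _ (\sum_(k < size f) B * 2^-1 ^+ k)).
  apply: ler_sum => k _.
  apply: (@le_trans _ _ (cmod f`_k * (rho / 2) ^+ k)).
    by rewrite ler_wpM2l ?cmod_ge0// lerXn2r ?nnegrE ?cmod_ge0 ?divr_ge0// ltW.
  rewrite exprMn mulrA ler_wpM2r ?exprn_ge0//.
  exact: cauchy_poly.
by rewrite -mulr_sumr mulrC ler_wpM2r// sum_halves_le2.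
Qed.

(** Schwarz lemma. Divide by the product of the ['X - x]: each factor is at least [4 * rho] on the
    circle of radius [5 * rho] and at most [2 * rho] on the small disk, so each zero gains a factor
    1/2. *)
Lemma poly_small_of_many_zeros (f : {poly C}) (xs : seq C) (rho B : R) :
  0 < rho -> uniq xs ->
  (forall x, x \in xs -> root f x /\ cmod x <= rho) ->
  (forall z, cmod z = 5 * rho -> cmod f.[z] <= B) ->
  forall w, cmod w <= rho -> cmod f.[w] <= 2 * B / 2 ^+ size xs.
Proof.
move=> rho0 uxs fxs fB w wr.
have [q fE] : exists q, f = q * \prod_(x <- xs) ('X - x%:P).
  apply: uniq_roots_prod_XsubC; last by rewrite uniq_rootsE.
  by apply/allP => x /fxs[].
have evalE z : f.[z] = q.[z] * \prod_(x <- xs) (z - x).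
  rewrite fE hornerM horner_prod; congr (_ * _).
  by apply: eq_bigr => x _; rewrite hornerXsubC.
have xsP : forall x, x \in xs -> cmod x <= rho by move=> x /fxs[].
have qB z : cmod z = 5 * rho -> cmod q.[z] <= B / (4 * rho) ^+ size xs.
  move=> zr; rewrite ler_pdivlMr ?exprn_gt0 ?mulr_gt0//.
  apply: le_trans (fB z zr); rewrite evalE cmodM ler_wpM2l ?cmod_ge0// cmod_prod.
  elim: xs xsP {uxs fxs fE evalE} => [|x xs IH] xsP; first by rewrite big_nil.
  have rho4 : 0 <= 4 * rho by rewrite mulr_ge0// ltW.
  rewrite big_cons/= exprS ler_pM ?exprn_ge0 ?IH//.
    have xr := xsP x (mem_head _ _).
    have := cmod_ler_sub z (- x); rewrite cmodN zr; lra.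
  by move=> y yxs; rewrite xsP// inE yxs orbT.
have rho5 : 0 < 5 * rho by rewrite mulr_gt0.
have wr2 : cmod w <= 5 * rho / 2 by lra.
have qw := poly_bound_inside rho5 qB wr2.
rewrite evalE cmodM.
have B0 : 0 <= B.
  apply: le_trans (fB (5 * rho)%:C _); rewrite ?cmod_ge0//.
  by rewrite cmod_real gtr0_norm.
have pw : cmod (\prod_(x <- xs) (w - x)) <= (2 * rho) ^+ size xs.
  rewrite cmod_prod; elim: xs xsP {uxs fxs fE evalE qB qw} => [|x xs IH] xsP.
    by rewrite big_nil.
  rewrite big_cons/= exprS ler_pM ?cmod_ge0 ?IH//.
  - by apply: prodr_ge0 => ? _; exact: cmod_ge0.
  - have xr := xsP x (mem_head _ _).
    have := cmod_triangleB w x; lra.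
  - by move=> y yxs; rewrite xsP// inE yxs orbT.
apply: (le_trans (ler_pM (cmod_ge0 _) (cmod_ge0 _) qw pw)).
rewrite [leLHS](_ : _ = 2 * B / 2 ^+ size xs)//.
have -> : 4 * rho = 2 * (2 * rho) by rewrite mulrA -natrM.
have y0 : (2 * rho) ^+ size xs != 0 by rewrite expf_neq0// mulf_neq0// gt_eqF.
have z0 : 2 ^+ size xs != 0 :> R by rewrite expf_neq0.
by rewrite (exprMn _ 2 (2 * rho)); field; rewrite z0.
Qed.

End PolynomialBounds.

(** * Jensen's formula and root counting *)

Section ProductEstimates.
Variable R : realType.
Local Notation C := R[i].
Implicit Types (s : seq C) (z w a : C).

Lemma cmod_sqr_ReIm z : cmod z ^+ 2 = complex.Re z ^+ 2 + complex.Im z ^+ 2.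
Proof. by case: z => a b; rewrite /cmod/= sqr_sqrtr// addr_ge0 ?sqr_ge0. Qed.

(** Weierstrass factor of genus one: after squaring, this is [1 + x <= expR x] at
    [x = |w|^2 - 2 Re w], because [|1 - w|^2 = 1 + x]. *)
Lemma cmod_1B_expR_le w :
  cmod (1 - w) * expR (complex.Re w) <= expR (cmod w ^+ 2 / 2).
Proof.
rewrite -(@ler_pXn2r _ 2)// ?nnegrE ?mulr_ge0 ?cmod_ge0 ?expR_ge0//.
rewrite exprMn -!expRM_natl cmod_sqr_ReIm.
set x := complex.Re w; set y := complex.Im w.
have -> : 2 * ((x ^+ 2 + y ^+ 2) / 2) = (x ^+ 2 + y ^+ 2 - 2 * x) + 2 * x by lra.
rewrite expRD ler_wpM2r ?expR_ge0// (le_trans _ (expR_ge1Dx _))//.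
by rewrite cmod_sqr_ReIm !raddfB/= -/x -/y; lra.
Qed.

Definition linprod s z : C := \prod_(a <- s) (1 - z / a).

(* Each factor with [cmod a <= rho] is replaced by its reflection, which has the
   same modulus on the circle but the larger value [rho / cmod a] at the centre. *)
Lemma jensen s (rho B : R) : 0 < rho -> (forall a, a \in s -> a != 0) ->
  (forall z, cmod z = rho -> cmod (linprod s z) <= B) ->
  \prod_(a <- s | cmod a <= rho) (rho / cmod a) <= B.
Proof.
move=> rho0 s0 sB.
pose q a : {poly C} := if cmod a <= rho
  then (rho / cmod a)%:C *: (1 - (a^* / (rho ^+ 2)%:C) *: 'X)
  else 1 - a^-1 *: 'X.
pose Q : {poly C} := \prod_(a <- s) q a.
have Q0 : cmod Q`_0 = \prod_(a <- s | cmod a <= rho) (rho / cmod a).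
  rewrite -horner_coef0 horner_prod cmod_prod [RHS]big_mkcond/=.
  apply: eq_bigr => a _; rewrite /q; case: ifP => ar.
    rewrite !hornerE ?(mulr0, subr0, mulr1) cmod_real ger0_norm//.
    by rewrite divr_ge0 ?cmod_ge0// ltW.
  by rewrite !hornerE ?(mulr0, subr0) cmod1.
rewrite -Q0 -[leLHS]mulr1 -[X in _ * X](expr0 rho).
apply: cauchy_poly => // z zr; apply: le_trans (sB z zr).
rewrite horner_prod /linprod !cmod_prod le_eqVlt; apply/orP; left; apply/eqP.
rewrite big_seq [RHS]big_seq; apply: eq_bigr => a /s0 a0; rewrite /q.
case: ifP => ar; last by rewrite !hornerE [z / a]mulrC.
rewrite !hornerE cmodM cmod_real ger0_norm; last first.
  by rewrite divr_ge0 ?cmod_ge0// ltW.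
have rho20 : (rho ^+ 2)%:C != 0 :> C.
  by rewrite (inj_eq (@complexI R) _ 0) expf_neq0// gt_eqF.
have -> : 1 - a^* / (rho ^+ 2)%:C * z = (z * (z - a)^*) / (rho ^+ 2)%:C.
  rewrite rmorphB/= mulrBr -cmod_sqr zr mulrBl divff//; congr (_ - _).
  by rewrite mulrAC [z * _]mulrC.
have -> : 1 - z / a = (a - z) / a by rewrite mulrBl divff.
rewrite !cmodM cmod_conj !cmodV cmod_real ger0_norm ?exprn_ge0 1?ltW//.
rewrite [cmod (a - z)]cmodB zr.
have a0' : cmod a != 0 by rewrite cmod_eq0.
have r0' : rho != 0 by rewrite gt_eqF.
by field; rewrite a0' r0'.
Qed.

Lemma expR_half_le2 : expR (2^-1 : R) <= 2.
Proof.
have := @expR_ge1Dx R (- 2^-1); rewrite expRN => h.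
have e0 := expR_gt0 (2^-1 : R).
have := ler_wpM2r (ltW e0) h; rewrite mulVf ?gt_eqF//; lra.
Qed.

(** Jensen's formula at radius [2 * t]: each root of modulus at most [t] contributes a factor at
    least 2, which is at least [expR (1 / 2)]. *)
Lemma count_le_of_growth s (k sigma : R) :
  (forall a, a \in s -> a != 0) ->
  (forall rho, 0 < rho -> forall z, cmod z = rho ->
     cmod (linprod s z) <= expR (k + sigma * rho)) ->
  forall t, 0 < t ->
  (count (fun a => cmod a <= t) s)%:R <= 2 * k + 4 * sigma * t.
Proof.
move=> s0 sB t t0; have t20 : 0 < 2 * t by rewrite mulr_gt0.
have := jensen t20 s0 (sB _ t20).
set n := count _ s; move=> h.
have h2 : 2 ^+ n <= expR (k + sigma * (2 * t)).
  apply: le_trans h; rewrite {}/n.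
  elim: s s0 {sB} => [|a s IH] s0; first by rewrite big_nil.
  rewrite big_cons/= exprD; have a0 : 0 < cmod a by rewrite cmod_gt0 s0 ?mem_head.
  have {}IH : 2 ^+ count (fun a => cmod a <= t) s <=
      \prod_(j <- s | cmod j <= 2 * t) (2 * t / cmod j).
    by apply: IH => b bs; rewrite s0// inE bs orbT.
  case: ifPn => a2t.
    apply: ler_pM => //; case: (leP (cmod a) t) => at_ /=.
      by rewrite expr1 ler_pdivlMr// ler_wpM2l.
    by rewrite expr0 ler_pdivlMr// mul1r.
  rewrite (_ : cmod a <= t = false) ?mul1r//.
  by apply: contraNF a2t => at_; lra.
have : expR (n%:R * 2^-1) <= expR (k + sigma * (2 * t)).
  apply: le_trans h2; rewrite expRM_natl lerXn2r ?nnegrE ?expR_ge0//.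
  exact: expR_half_le2.
rewrite ler_expR; lra.
Qed.

(** Dyadic form of partial summation: the term of the shell containing [x] suffices. The indicators
    are not cut off from below, so that summing them over the roots produces the counting
    function. *)
Lemma inv_sqr_le_dyadic (r x : R) J : 0 < r -> r < x -> x <= 2 ^+ J * r ->
  x ^- 2 <= \sum_(j < J) (x <= 2 ^+ j.+1 * r)%R%:R * (4 ^- j * r ^- 2).
Proof.
move=> r0 rx; have x0 := lt_trans r0 rx.
have p4 j : 0 <= 4 ^- j * r ^- 2 by rewrite mulr_ge0// invr_ge0 exprn_ge0// ltW.
elim: J => [|J IH] xJ; first by move: xJ; rewrite expr0 mul1r leNgt rx.
rewrite big_ord_recr/=; have [xJ'|Jx] := leP x (2 ^+ J * r).
  by rewrite (le_trans (IH xJ'))// lerDl mulr_ge0// ler0n.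
rewrite xJ mul1r (@le_trans _ _ (4 ^- J * r ^- 2))//; last first.
  by rewrite lerDr sumr_ge0// => j _; rewrite mulr_ge0// ler0n.
rewrite -invfM lef_pV2 ?posrE ?mulr_gt0 ?exprn_gt0//.
have -> : 4 ^+ J * r ^+ 2 = (2 ^+ J * r) ^+ 2.
  by rewrite exprMn -exprM mulnC exprM; congr (_ ^+ _ * _); ring.
by rewrite lerXn2r ?nnegrE ?ltW ?mulr_gt0 ?exprn_gt0.
Qed.

(** The bound does not involve the number [J] of shells, hence is uniform over the truncations. *)
Lemma sum_inv_sqr_le s (L K r : R) : 0 < r -> 0 <= L -> 0 <= K ->
  (forall t, 0 < t -> (count (fun a => cmod a <= t) s)%:R <= L + K * t) ->
  \sum_(a <- s | r < cmod a) cmod a ^- 2 <= 2 * L / r ^+ 2 + 4 * K / r.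
Proof.
move=> r0 L0 K0 sB.
have [J hJ] : exists J, forall a, a \in s -> cmod a <= 2 ^+ J * r.
  elim: s {sB} => [|a s [J IH]]; first by exists 0.
  exists (J + Num.truncn (cmod a / r)).+1 => b; rewrite inE => /orP[/eqP ->|/IH bJ].
    rewrite -ler_pdivrMr// (le_trans (ltW (truncnS_gt _)))//.
    rewrite -natrX ler_nat (leq_trans _ (ltnW (ltn_expl _ _)))//.
    by rewrite ltnS leq_addl.
  rewrite (le_trans bJ)// ler_wpM2r// ?(ltW r0)// ler_weXn2l ?ler1n//.
  by rewrite leqW// leq_addr.
apply: (@le_trans _ _ (\sum_(a <- s | r < cmod a) \sum_(j < J)
    (cmod a <= 2 ^+ j.+1 * r)%R%:R * (4 ^- j * r ^- 2))).
  rewrite big_seq_cond [leRHS]big_seq_cond; apply: ler_sum => a /andP[as_ ra].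
  by apply: inv_sqr_le_dyadic => //; exact: hJ.
apply: (@le_trans _ _ (\sum_(a <- s) \sum_(j < J)
    (cmod a <= 2 ^+ j.+1 * r)%R%:R * (4 ^- j * r ^- 2))).
  rewrite big_mkcond/=; apply: ler_sum => a _; case: ifP => // _.
  rewrite sumr_ge0// => j _; rewrite mulr_ge0 ?ler0n// divr_ge0 ?invr_ge0 ?exprn_ge0//.
  exact: ltW.
rewrite exchange_big/=.
apply: (@le_trans _ _ (\sum_(j < J) (L / r ^+ 2 * 2^-1 ^+ j + 2 * K / r * 2^-1 ^+ j))).
  apply: ler_sum => j _; rewrite -mulr_suml.
  have -> : \sum_(a <- s) (cmod a <= 2 ^+ j.+1 * r)%R%:R =
      (count (fun a => cmod a <= 2 ^+ j.+1 * r) s)%:R :> R.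
    by rewrite -natr_sum -sum1_count [in RHS]big_mkcond/=; congr _%:R;
      apply: eq_bigr => a _; case: ifP.
  have tj : 0 < 2 ^+ j.+1 * r by rewrite mulr_gt0// exprn_gt0.
  have p4 : 0 <= 4 ^- j * r ^- 2.
    by rewrite divr_ge0 ?invr_ge0 ?exprn_ge0// ltW.
  apply: (le_trans (ler_wpM2r p4 (sB _ tj))).
  rewrite [leLHS](_ : _ = L / r ^+ 2 * 4 ^- j + 2 * K / r * 2^-1 ^+ j).
    rewrite lerD2r ler_wpM2l ?divr_ge0 ?exprn_ge0// ?(ltW r0)//.
    by rewrite exprVn lef_pV2 ?posrE ?exprn_gt0// lerXn2r ?nnegrE// ler_nat.
  have -> : 4 ^- j = 2^-1 ^+ j * 2^-1 ^+ j :> R.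
    by rewrite -exprMn -exprVn -invfM -natrM.
  rewrite exprS exprVn; have y0 : 2 ^+ j != 0 :> R by rewrite expf_neq0.
  by field; rewrite y0 gt_eqF.
rewrite big_split/= -!mulr_sumr -mulrDl.
rewrite (le_trans (ler_wpM2l _ (sum_halves_le2 _ _)))//; last first.
  lra.
by rewrite addr_ge0// divr_ge0 ?exprn_ge0 ?mulr_ge0// ltW.
Qed.

Lemma cmod_linprod_expR_le s z :
  cmod (linprod s z) * expR (complex.Re (z * \sum_(a <- s) a^-1)) <=
  expR (cmod z ^+ 2 / 2 * \sum_(a <- s) cmod a ^- 2).
Proof.
elim: s => [|a s IH].
  by rewrite /linprod !big_nil !mulr0 !expR0 cmod1 mulr1.
rewrite /linprod !big_cons !mulrDr raddfD/= !expRD cmodM mulrACA.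
rewrite ler_pM ?mulr_ge0 ?cmod_ge0 ?expR_ge0//.
have := cmod_1B_expR_le (z / a); rewrite cmodM cmodV exprMn exprVn.
by rewrite [_ / 2 * _]mulrAC.
Qed.

(** To first order the product of the far factors [1 - z / a] is the exponential of this number
    times [z]; it is the [alpha] of the overview. *)
Definition tail_exponent s (r : R) : C := - \sum_(a <- s | r < cmod a) a^-1.

Lemma linprod_split (P : pred C) s z :
  linprod s z = linprod (seq.filter P s) z * linprod (seq.filter (predC P) s) z.
Proof. by rewrite /linprod (bigID P)/= !big_filter. Qed.

(** Far roots are handled by the genus-one estimate. Using the growth bound at radius [r] for the
    near ones would cost [sigma * r]; Jensen's formula at the smaller radius [kappa * r] costs only
    [sigma * kappa * r]. If [|a| <= kappa * r], then [|1 - z / a|] is at most [1 + kappa^-1] times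
    the Jensen factor [kappa * r / |a|]; the other near factors are at most [1 + kappa^-1]. *)
Lemma cmod_linprod_tail_le s (k sigma kappa rho r : R) :
  0 < r -> 0 < kappa -> kappa * r <= rho ->
  (forall a, a \in s -> a != 0) ->
  (forall t, 0 < t -> forall z, cmod z = t ->
     cmod (linprod s z) <= expR (k + sigma * t)) ->
  forall z, cmod z = r ->
  cmod (linprod s z) * expR (- complex.Re (tail_exponent s rho * z)) <=
  expR (k + sigma * (kappa * r)) *
  (1 + kappa^-1) ^+ count (fun a => cmod a <= rho) s *
  expR (r ^+ 2 / 2 * \sum_(a <- s | rho < cmod a) cmod a ^- 2).
Proof.
move=> r0 kappa0 krho s0 sB z zr.
pose P := fun a : C => cmod a <= rho.
have PC a : predC P a = (rho < cmod a) by rewrite /= /P ltNge.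
rewrite (linprod_split P) cmodM -mulrA ler_pM ?mulr_ge0 ?cmod_ge0 ?expR_ge0//; last first.
  have := cmod_linprod_expR_le (seq.filter (predC P) s) z.
  rewrite !big_filter !(eq_bigl _ _ PC) zr; congr (_ * expR _ <= _).
  by rewrite /tail_exponent mulNr raddfN opprK mulrC.
have rk0 : 0 < kappa * r by rewrite mulr_gt0.
have J := jensen rk0 s0 (sB _ rk0).
rewrite mulrC; apply: le_trans (ler_wpM2l _ J); last first.
  by rewrite exprn_ge0// addr_ge0// invr_ge0 ltW.
elim: s s0 {sB J} => [|a s IH] s0.
  by rewrite /linprod/= !big_nil cmod1 expr0 mulr1.
have a0 : 0 < cmod a by rewrite cmod_gt0 s0 ?mem_head.
have {}IH := IH (fun b bs => s0 b (@mem_behead _ (a :: s) b bs)).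
have [ar|ar] := boolP (cmod a <= kappa * r); rewrite big_cons/= /P.
  rewrite (le_trans ar krho) ar /linprod/= big_cons cmodM.
  rewrite add1n exprS mulrACA ler_pM ?cmod_ge0//.
  rewrite (le_trans (cmod_triangleB _ _))// cmod1 cmodM cmodV zr.
  have -> : (1 + kappa^-1) * (kappa * r / cmod a) = kappa * r / cmod a + r / cmod a.
    by field; rewrite !gt_eqF.
  by rewrite lerD2r ler_pdivlMr// mul1r.
rewrite (negbTE ar); case: ifP => arho /=; last by rewrite add0n.
rewrite /linprod/= big_cons cmodM add1n exprS -mulrA ler_pM ?cmod_ge0//.
rewrite (le_trans (cmod_triangleB _ _))// cmod1 cmodM cmodV zr lerD2l.
rewrite ler_pdivrMr// -ler_pdivrMl ?invr_gt0// invrK ltW//.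
by rewrite ltNge.
Qed.

(** Jensen's formula at radius 1 keeps every root away from the origin. This serves to bound [alpha]
    polynomially in [r]. *)
Lemma sum_inv_le s (k sigma rho : R) : (forall a, a \in s -> a != 0) ->
  (forall z, cmod z = 1 -> cmod (linprod s z) <= expR (k + sigma)) ->
  0 <= k + sigma ->
  \sum_(a <- s | cmod a <= rho) (cmod a)^-1 <=
  (count (fun a => cmod a <= rho) s)%:R * expR (k + sigma).
Proof.
move=> s0 sB ks0.
have J := jensen ltr01 s0 sB.
have hb a : a \in s -> (cmod a)^-1 <= expR (k + sigma).
  move=> as_; have a0 : 0 < cmod a by rewrite cmod_gt0 s0.
  have [a1|a1] := leP (cmod a) 1; last first.
    apply: (@le_trans _ _ 1); first by rewrite invf_le1// ltW.
    by rewrite -[leLHS]expR0 ler_expR.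
  apply: le_trans J; rewrite (big_rem a)//= a1 mul1r ler_peMr ?invr_ge0 ?(ltW a0)//.
  rewrite big_seq_cond; elim/big_rec: _ => [//|b x].
  move=> /andP[/mem_rem bs b1] x1; rewrite mul1r mulr_ege1// invf_ge1//.
  by rewrite cmod_gt0 s0.
rewrite -sum1_count natr_sum mulr_suml big_seq_cond [leRHS]big_seq_cond.
by apply: ler_sum => a /andP[/hb]; rewrite mul1r.
Qed.

End ProductEstimates.

(** * Complex limits and the exponential series *)

Section ComplexLimits.
Variable R : realType.
Local Notation C := R[i].

(* Convergence in the plain ring [R[i]], so that no term mixes its operations with
   those of the topological alias [R[i]^o]. *)
Definition ccvg (T : Type) (U : set_system T) (f : T -> C) (l : C) : Prop :=
  forall e : R, 0 < e -> U [set x | cmod (f x - l) < e].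

Lemma cvgr_near (T : Type) (U : set_system T) {FU : Filter U} (f : T -> R) (a e : R) :
  f @ U --> a -> 0 < e -> U [set x | `|a - f x| < e].
Proof. by move=> /cvgrPdist_lt/(_ e). Qed.

Lemma ccvgP (T : Type) (U : set_system T) {FU : Filter U} (f : T -> Cplx R) (l : Cplx R) :
  f @ U --> l <-> ccvg U f l.
Proof.
split=> [fl e e0|h].
  have e0' : 0 < e%:C :> R[i] by rewrite ltcR.
  move/cvgrPdist_lt : fl => /(_ _ e0'); apply: filterS => x /=.
  by rewrite -cmod_norm ltcR cmodB.
apply/cvgrPdist_lt => -[a b] e0.
have b0 : b = 0 by move: e0; rewrite ltcE/= => /andP[/eqP].
rewrite b0 in e0 *; have a0 : 0 < a by move: e0; rewrite ltcR.
apply: filterS (h a a0) => x /=.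
by rewrite -cmod_norm ltcR cmodB.
Qed.

Lemma ccvg_le (T : Type) (U : set_system T) {FU : ProperFilter U} (f : T -> C)
    (l : C) (B : R) :
  ccvg U f l -> U [set x | cmod (f x) <= B] -> cmod l <= B.
Proof.
move=> fl fB; apply/ler_addgt0Pr => e e0.
have [x [/= fx flx]] := filter_ex (filterI fB (fl e e0)).
rewrite -[l](subrK (f x)) addrC (le_trans (cmod_triangle _ _))// lerD//.
by rewrite cmodB ltW.
Qed.

Lemma ccvg_ReIm (T : Type) (U : set_system T) {FU : Filter U} (f : T -> C)
    (a b : R) :
  (fun x => complex.Re (f x)) @ U --> a -> (fun x => complex.Im (f x)) @ U --> b ->
  ccvg U f (a +i* b).
Proof.
move=> fa fb e e0.
have e20 : 0 < e / 2 by rewrite divr_gt0.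
apply: filterS2 (cvgr_near fa e20) (cvgr_near fb e20) => x /= ha hb.
rewrite (le_lt_trans (cmod_le_ReIm _))// !raddfB/=.
by rewrite distrC [X in _ + X]distrC; lra.
Qed.

Lemma ccvg_real (T : Type) (U : set_system T) {FU : Filter U} (f : T -> R)
    (a : R) :
  f @ U --> a -> ccvg U (fun x => (f x)%:C) a%:C.
Proof. by move=> fa; apply: ccvg_ReIm => //=; exact: cvg_cst. Qed.

Lemma ccvg_cst (T : Type) (U : set_system T) {FU : Filter U} (a : C) :
  ccvg U (fun=> a) a.
Proof. by move=> e e0; apply: filterE => x /=; rewrite subrr cmod0. Qed.

Lemma ccvgM (T : Type) (U : set_system T) {FU : Filter U} (f g : T -> C) (a b : C) :
  ccvg U f a -> ccvg U g b -> ccvg U (fun x => f x * g x) (a * b).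
Proof.
move=> fa gb e e0.
pose M := 1 + cmod a + cmod b.
have M0 : 0 < M by rewrite /M -addrA ltr_pwDl// addr_ge0 ?cmod_ge0.
pose d := Num.min 1 (e / M).
have d0 : 0 < d by rewrite lt_min ltr01 divr_gt0.
apply: filterS2 (fa d d0) (gb d d0) => x /= hf hg.
have -> : f x * g x - a * b =
    (f x - a) * (g x - b) + a * (g x - b) + (f x - a) * b by ring.
have d1 : d <= 1 by rewrite ge_min lexx.
have dM : d * M <= e by rewrite -ler_pdivlMr// ge_min lexx orbT.
have ME : d * M = d + d * cmod a + d * cmod b by rewrite /M; ring.
apply: lt_le_trans dM; rewrite ME.
have h1 : cmod ((f x - a) * (g x - b)) < d.
  rewrite cmodM -[ltRHS]mulr1 (le_lt_trans (ler_wpM2l (cmod_ge0 _) (ltW (lt_le_trans hg d1))))//.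
  by rewrite !mulr1.
have h2 : cmod (a * (g x - b)) <= d * cmod a.
  by rewrite cmodM mulrC ler_wpM2r ?cmod_ge0// ltW.
have h3 : cmod ((f x - a) * b) <= d * cmod b.
  by rewrite cmodM ler_wpM2r ?cmod_ge0// ltW.
rewrite (le_lt_trans (cmod_triangle _ _))// ltr_leD//.
by rewrite (le_lt_trans (cmod_triangle _ _))// ltr_leD.
Qed.

Lemma ccvgB (T : Type) (U : set_system T) {FU : Filter U} (f g : T -> C) (a b : C) :
  ccvg U f a -> ccvg U g b -> ccvg U (fun x => f x - g x) (a - b).
Proof.
move=> fa gb e e0.
have e20 : 0 < e / 2 by rewrite divr_gt0.
apply: filterS2 (fa _ e20) (gb _ e20) => x /= hf hg.
have -> : f x - g x - (a - b) = (f x - a) - (g x - b) by ring.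
by rewrite (le_lt_trans (cmod_triangleB _ _))//; lra.
Qed.

Lemma ccvgD (T : Type) (U : set_system T) {FU : Filter U} (f g : T -> C) (a b : C) :
  ccvg U f a -> ccvg U g b -> ccvg U (fun x => f x + g x) (a + b).
Proof.
move=> fa gb e e0.
have e20 : 0 < e / 2 by rewrite divr_gt0.
apply: filterS2 (fa _ e20) (gb _ e20) => x /= hf hg.
have -> : f x + g x - (a + b) = (f x - a) + (g x - b) by ring.
by rewrite (le_lt_trans (cmod_triangle _ _))//; lra.
Qed.

Lemma ccvg_eq (T : Type) (U : set_system T) {FU : Filter U} (f g : T -> C) (a : C) :
  f =1 g -> ccvg U f a -> ccvg U g a.
Proof. by move=> fg fa e e0; apply: filterS (fa e e0) => x /=; rewrite fg. Qed.

Lemma ccvg_sub (T : Type) (U V : set_system T) (f : T -> C) (a : C) :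
  U `<=` V -> ccvg U f a -> ccvg V f a.
Proof. by move=> UV fa e e0; exact: UV (fa e e0). Qed.

Lemma ccvg_unique (T : Type) (U : set_system T) {FU : ProperFilter U} (f : T -> C)
    (a b : C) : ccvg U f a -> ccvg U f b -> a = b.
Proof.
move=> fa fb; apply/eqP; rewrite -subr_eq0; apply/eqP.
apply: cmod_arbitrarily_small => e e0.
apply: (ccvg_le (ccvgB fa fb)); apply: filterE => x /=.
by rewrite subrr cmod0 ltW.
Qed.

Lemma ccvg_shift (f : nat -> C) (a : C) :
  ccvg \oo f a -> ccvg \oo (fun n => f n.+1) a.
Proof. by move=> fa e /fa [N _ hN]; exists N => // n /= Nn; apply: hN; exact: leqW. Qed.

Lemma ccvg_unshift (f : nat -> C) (a : C) :
  ccvg \oo (fun n => f n.+1) a -> ccvg \oo f a.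
Proof. by move=> fa e /fa [N _ hN]; exists N.+1 => // -[//|n] /= Nn; exact: (hN n). Qed.

End ComplexLimits.

(** * The complex exponential as the limit of its Taylor sums *)

Section ComplexExponential.
Variable R : realType.
Local Notation C := R[i].

Definition expsum (K : fieldType) (n : nat) (z : K) : K :=
  \sum_(i < n) z ^+ i / i`!%:R.

Lemma cmod_cexp (z : C) : cmod (cexp z) = expR (complex.Re z).
Proof.
rewrite /cexp cmodM cmod_real ger0_norm ?expR_ge0//.
suff -> : cmod (cos (complex.Im z) +i* sin (complex.Im z)) = 1 by rewrite mulr1.
by rewrite /cmod/= cos2Dsin2 sqrtr1.
Qed.

Lemma expsum_le m n (x : R) : 0 <= x -> (m <= n)%N -> expsum m x <= expsum n x.
Proof.
move=> x0 /subnKC <-; rewrite /expsum big_split_ord/= lerDl sumr_ge0// => i _.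
by rewrite divr_ge0 ?exprn_ge0.
Qed.

Lemma expsumB_le m n (z : C) : (m <= n)%N ->
  cmod (expsum n z - expsum m z) <= expsum n (cmod z) - expsum m (cmod z).
Proof.
move=> /subnKC <-; rewrite /expsum !big_split_ord/= [X in cmod X]addrC addKr.
rewrite [X in _ <= X]addrC addKr (le_trans (cmod_sum _ _ _))//.
by apply: ler_sum => i _; rewrite cmodM cmodV cmod_nat cmodX.
Qed.

Lemma cvg_expsum (x : R) : (fun n => expsum n x) @ \oo --> expR x.
Proof.
rewrite (_ : (fun n => expsum n x) = series (exp_coeff x)); first exact: is_cvg_series_exp_coeff.
by apply/funext => n; rewrite /series/= big_mkord.
Qed.

Lemma expsum_le_expR n (x : R) : 0 <= x -> expsum n x <= expR x.
Proof.
move=> x0; have h : nondecreasing_seq ((fun n => expsum n x)).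
  by move=> m k mk; exact: expsum_le.
have <- := cvg_lim (@Rhausdorff R) (@cvg_expsum x).
by apply: nondecreasing_cvgn_le => //; apply/cvg_ex; exists (expR x); exact: cvg_expsum.
Qed.

Definition exp_poly (K : fieldType) (n : nat) (x : K) : {poly K} :=
  \poly_(i < n) (x ^+ i / i`!%:R).

Lemma coef_exp_polyM (K : numFieldType) n (x y : K) i : (i < n)%N ->
  (exp_poly n x * exp_poly n y)`_i = (x + y) ^+ i / i`!%:R.
Proof.
move=> i_n; rewrite coefM addrC exprDn mulr_suml; apply: eq_bigr => j _.
have ji : (j <= i)%N by rewrite -ltnS.
rewrite !coef_poly (leq_ltn_trans ji i_n) (leq_ltn_trans (leq_subr _ _) i_n).
have f0 m : m`!%:R != 0 :> K by rewrite pnatr_eq0 -lt0n fact_gt0.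
have b0 : 'C(i, j)%:R != 0 :> K by rewrite pnatr_eq0 -lt0n bin_gt0.
rewrite -mulr_natr -(bin_fact ji) !natrM.
by field; rewrite !f0 b0.
Qed.

(** The defect of multiplicativity consists of the coefficients of degree at least [n] in a product
    of two truncated exponentials. These are dominated termwise by the ones at the moduli, so the
    real identity [expRD] controls the complex case. *)
Lemma expsumM_le n (z w : C) :
  cmod (expsum n z * expsum n w - expsum n (z + w)) <=
  expsum n (cmod z) * expsum n (cmod w) - expsum n (cmod z + cmod w).
Proof.
have pE (K : fieldType) (x : K) : expsum n x = (exp_poly n x).[1].
  by rewrite horner_poly; apply: eq_bigr => i _; rewrite expr1n mulr1.
have szp (K : numFieldType) (x y : K) :
    (size (exp_poly n x * exp_poly n y)%R <= n + n)%N.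
  rewrite (leq_trans (size_polyMleq _ _))// (leq_trans (leq_pred _))//.
  by rewrite leq_add// size_poly.
have key (K : numFieldType) (x y : K) :
    expsum n x * expsum n y - expsum n (x + y) =
    \sum_(i < n) (exp_poly n x * exp_poly n y)`_(n + i).
  rewrite (pE _ x) (pE _ y) -hornerM (horner_coef_wide _ (szp K x y)).
  rewrite big_split_ord/= /expsum.
  under eq_bigr do rewrite expr1n mulr1 coef_exp_polyM//.
  rewrite [X in X - _]addrC addrK.
  by apply: eq_bigr => i _; rewrite expr1n mulr1.
rewrite !key (le_trans (cmod_sum _ _ _))//; apply: ler_sum => i _.
rewrite !coefM (le_trans (cmod_sum _ _ _))//; apply: ler_sum => j _.
rewrite !coef_poly cmodM ler_pM ?cmod_ge0//; case: ifP => _;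
  by rewrite ?cmod0// cmodM cmodV cmod_nat cmodX.
Qed.

Lemma expsum_imaginary n (y : R) :
  expsum n (0 +i* y : R[i]) =
  series (cos_coeff y) n +i* series (sin_coeff y) n.
Proof.
rewrite /expsum /series/= !big_mkord; elim: n => [|n IH]; first by rewrite !big_ord0.
rewrite !big_ord_recr/= {}IH.
have -> : (0 +i* y : R[i]) ^+ n / n`!%:R = cos_coeff y n +i* sin_coeff y n.
  have -> : (0 +i* y : R[i]) = 'i * y%:C by simpc.
  have iX : 'i ^+ n = if odd n then 0 +i* ((-1) ^+ n./2) else ((-1) ^+ n./2)%:C :> R[i].
    rewrite -[n in LHS]odd_double_half exprD -mul2n exprM sqr_i.
    have -> : (-1) ^+ n./2 = ((-1) ^+ n./2)%:C :> R[i] by rewrite rmorphXn rmorphN rmorph1.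
    by case: odd; rewrite ?expr1 ?expr0 ?mul1r//; simpc.
  rewrite exprMn {}iX -(rmorph_nat (real_complex R)) -fmorphV -rmorphXn/=.
  rewrite /cos_coeff /sin_coeff/=.
  have [on|on] := boolP (odd n).
    have -> : n.-1./2 = n./2 by rewrite -[in LHS](odd_double_half n) on add1n /= doubleK.
    by simpc; rewrite ?mul0r ?mul1r.
  by simpc; rewrite ?mul0r ?mul1r.
by [].
Qed.

Lemma cvg_expsumB (a b : R) :
  (fun n => expsum n a * expsum n b - expsum n (a + b)) @ \oo --> (0 : R).
Proof.
rewrite -(subrr (expR (a + b))) {1}expRD.
by apply: cvgB; first apply: cvgM; exact: cvg_expsum.
Qed.

(** As [cexp] is built from [expR], [cos] and [sin], the limit is first taken on each axis;
    [expsumM_le] then merges the two partial sums. *)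
Lemma ccvg_expsum (z : C) : ccvg \oo (fun n => expsum n z) (cexp z).
Proof.
case: z => x y.
have -> : x +i* y = x%:C + (0 +i* y) by simpc.
have cr : ccvg \oo (fun n => expsum n x%:C) (expR x)%:C.
  apply: (@ccvg_eq _ _ _ _ (fun n => (expsum n x)%:C)).
    move=> n; rewrite /expsum (rmorph_sum (real_complex R)).
    by apply: eq_bigr => i _; rewrite rmorphM/= fmorphV rmorph_nat rmorphXn.
  exact: ccvg_real (@cvg_expsum x).
have ci : ccvg \oo (fun n => expsum n (0 +i* y)) (cos y +i* sin y).
  apply: (@ccvg_eq _ _ _ _ (fun n => series (cos_coeff y) n +i* series (sin_coeff y) n)).
    by move=> n; rewrite expsum_imaginary.
  by apply: ccvg_ReIm => /=; rewrite unlock; [exact: is_cvg_series_cos_coeff|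
    exact: is_cvg_series_sin_coeff].
pose proof (ccvgM cr ci) as prod.
have real := @cvg_expsumB (cmod x%:C) (cmod (0 +i* y)).
have diff : ccvg \oo (fun n => expsum n x%:C * expsum n (0 +i* y) -
    expsum n (x%:C + (0 +i* y))) 0.
  move=> e e0; apply: filterS (cvgr_near real e0) => n /=.
  rewrite sub0r normrN subr0 => h.
  exact: le_lt_trans (expsumM_le _ _ _) (le_lt_trans (ler_norm _) h).
pose proof (ccvgB prod diff) as lim; move: lim; rewrite subr0 /cexp.
have -> : complex.Re (x%:C + (0 +i* y)) = x by rewrite /= addr0.
have -> : complex.Im (x%:C + (0 +i* y)) = y by rewrite /= add0r.
by apply: ccvg_eq => n; rewrite subKr.
Qed.

Lemma cexp_tail_le n (z : C) :
  cmod (cexp z - expsum n z) <= expR (cmod z) - expsum n (cmod z).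
Proof.
apply: (ccvg_le (ccvgB (ccvg_expsum z) (ccvg_cst (expsum n z)))).
near=> k => /=; rewrite (le_trans (expsumB_le _ _))//; first by near: k; exact: nbhs_infty_ge.
by rewrite lerD2r expsum_le_expR ?cmod_ge0.
Unshelve. all: by end_near. Qed.

Lemma expsum_tail_small (x e : R) (k : nat) : 0 < e ->
  exists2 n, (k < n)%N & expR x - expsum n x < e.
Proof.
move=> e0; near \oo => n; exists n; first by near: n; exact: nbhs_infty_gt.
rewrite (le_lt_trans (ler_norm _))//; near: n.
exact: cvgr_near (@cvg_expsum x) e0.
Unshelve. all: by end_near. Qed.

(** Cauchy's estimate for [T z * exp (- alpha z)] by polynomials alone. The exponential is cut at an
    order [L > k], which leaves the [k]-th coefficient intact; the error [B / M] on the circle, with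
    [M] a majorant of [|T|], costs the factor 2. *)
Lemma coef_mul_expN_le (T : {poly R[i]}) (alpha : R[i]) (r B : R) :
  0 < r -> 0 < B ->
  (forall z, cmod z = r -> cmod T.[z] * expR (- complex.Re (alpha * z)) <= B) ->
  forall k, cmod (\sum_(j < k.+1) T`_j * ((- alpha) ^+ (k - j) / (k - j)`!%:R))
    * r ^+ k <= 2 * B.
Proof.
move=> r0 B0 TB k.
pose M := 1 + \sum_(j < size T) cmod T`_j * r ^+ j.
have M0 : 0 < M.
  rewrite ltr_pwDl// sumr_ge0// => j _; rewrite mulr_ge0 ?cmod_ge0// exprn_ge0//.
  exact: ltW.
have [L kL hL] := expsum_tail_small (cmod alpha * r) k (divr_gt0 B0 M0).
pose E := exp_poly L (- alpha).
have EE z : E.[z] = expsum L (- (alpha * z)).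
  rewrite horner_poly; apply: eq_bigr => i _.
  by rewrite -mulNr exprMn mulrAC.
have -> : \sum_(j < k.+1) T`_j * ((- alpha) ^+ (k - j) / (k - j)`!%:R) = (T * E)`_k.
  rewrite coefM; apply: eq_bigr => j _; rewrite coef_poly ifT//.
  exact: leq_ltn_trans (leq_subr _ _) kL.
apply: cauchy_poly => // z zr; rewrite hornerM cmodM EE.
have TM : cmod T.[z] <= M.
  rewrite (le_trans (cmod_horner_le _ _))// zr lerDr//.
have tail := cexp_tail_le L (- (alpha * z)).
rewrite cmodN cmodM zr in tail.
have h1 : cmod (expsum L (- (alpha * z))) <=
    expR (- complex.Re (alpha * z)) + B / M.
  rewrite -[X in cmod X](subrK (cexp (- (alpha * z)))) addrC.
  rewrite (le_trans (cmod_triangle _ _))// lerD//.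
    by rewrite cmod_cexp raddfN.
  by rewrite cmodB (le_trans tail)// ltW.
apply: (le_trans (ler_wpM2l (cmod_ge0 _) h1)); rewrite mulrDr mulr2n mulrDl mul1r.
rewrite lerD ?TB// mulrA ler_pdivrMr// mulrC ler_wpM2l// ltW//.
Qed.

End ComplexExponential.

(** * Power series of exponential type *)

Section PowerSeries.
Variable R : realType.
Local Notation C := R[i].
Implicit Types (c : nat -> R[i]) (F : C -> C) (z h : C).

(** Exponential type as a coefficientwise majorant by [A * exp (s z)], a form that survives
    coefficientwise limits. *)
Definition exp_bounded (A s : R) c :=
  forall n, cmod (c n) <= A * (s ^+ n / n`!%:R).

Definition power_sum c F :=
  forall z, ccvg \oo (fun n => \sum_(i < n) c i * z ^+ i) (F z).

Lemma exp_bounded_A_ge0 A s c : exp_bounded A s c -> 0 <= A.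
Proof.
by move=> /(_ 0%N); rewrite expr0 fact0 divr1 mulr1; apply: le_trans; exact: cmod_ge0.
Qed.

Lemma power_sum_unique c F G : power_sum c F -> power_sum c G -> F =1 G.
Proof. by move=> cF cG z; exact: ccvg_unique (cF z) (cG z). Qed.

Lemma power_sum_exists A s c : 0 <= s -> exp_bounded A s c -> exists F, power_sum c F.
Proof.
move=> s0 cA.
have dom (f : R[i] -> R) z : (forall w, `|f w| <= cmod w) ->
    cvgn (series (fun i => f (c i * z ^+ i))).
  move=> fle; apply: normed_cvg.
  apply: (@series_le_cvg _ _ (fun i => A * exp_coeff (s * cmod z) i)).
  - by move=> n; exact: normr_ge0.
  - move=> n; rewrite mulr_ge0 ?(exp_bounded_A_ge0 cA)// /exp_coeff/=.
    by rewrite divr_ge0// exprn_ge0// mulr_ge0// cmod_ge0.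
  - move=> n /=; rewrite (le_trans (fle _))// cmodM cmodX.
    apply: (le_trans (ler_wpM2r _ (cA _))); first by rewrite exprn_ge0// cmod_ge0.
    by rewrite /exp_coeff/= exprMn; apply: eq_ler; ring.
  - by apply: is_cvg_seriesZ; exact: is_cvg_series_exp_coeff.
exists (fun z => limn (series (fun i => complex.Re (c i * z ^+ i))) +i*
                 limn (series (fun i => complex.Im (c i * z ^+ i)))) => z.
apply: ccvg_ReIm.
  have := dom (@complex.Re R) z (@Re_le_cmod R).
  by apply: cvg_trans; apply: near_eq_cvg; near=> n; rewrite /series/= big_mkord raddf_sum.
have := dom (@complex.Im R) z (@Im_le_cmod R).
by apply: cvg_trans; apply: near_eq_cvg; near=> n; rewrite /series/= big_mkord raddf_sum.
Unshelve. all: by end_near. Qed.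

(** A class closed under differentiation, sums and multiplication by [z - b], all of which act on
    coefficients; the parameters [A] and [s] may grow. *)
Definition ent_class F := exists c A s, [/\ 0 <= s, exp_bounded A s c & power_sum c F].

(** A quadratic remainder bound, unlike a limit, passes directly from the partial sums to their
    limit. *)
Definition has_cderiv F z (l : C) := exists K : R, forall h, cmod h <= 1 ->
  cmod (F (z + h) - F z - h * l) <= K * cmod h ^+ 2.

Lemma has_cderiv_derive1 (F : Cplx R -> Cplx R) (z l : Cplx R) :
  has_cderiv F z l -> F^`() z = l.
Proof.
move=> [K FK]; rewrite /derive1; apply: cvg_lim; first exact: norm_hausdorff.
apply/ccvgP => e e0.
pose d := Num.min 1 (e / (`|K| + 1)).
have K0 : 0 < `|K| + 1 by rewrite ltr_wpDl.
have d0 : 0 < d%:C :> R[i] by rewrite ltcR lt_min ltr01 divr_gt0.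
near=> h => /=.
have hd : cmod h < d.
  by rewrite -ltcR cmod_norm; near: h; exact: dnbhs0_lt.
have h0 : h != 0 by near: h; exact: nbhs_dnbhs_neq.
have ch0 : 0 < cmod h by rewrite cmod_gt0.
have -> : h^-1 *: (F (h + z) - F z) - l = h^-1 * (F (z + h) - F z - h * l) :> C.
  rewrite [h + z]addrC [RHS]mulrBr; congr (_ - _).
  by rewrite mulKf.
rewrite cmodM cmodV -ltr_pdivlMl ?invr_gt0// invrK.
have h1 : cmod h <= 1 by apply: ltW; apply: lt_le_trans hd _; rewrite ge_min lexx.
apply: (le_lt_trans (FK h h1)).
rewrite expr2 mulrA mulrC ltr_pM2l//.
have he : cmod h < e / (`|K| + 1).
  by apply: lt_le_trans hd _; rewrite ge_min lexx orbT.
rewrite ltr_pdivlMr// in he.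
rewrite (le_lt_trans _ he)// mulrC ler_wpM2l ?cmod_ge0//.
by rewrite (le_trans (ler_norm _))// lerDl.
Unshelve. all: by end_near. Qed.

Lemma cmod_powB_le z h n : cmod h <= 1 ->
  cmod ((z + h) ^+ n - z ^+ n - n%:R * (h * z ^+ n.-1)) <=
  cmod h ^+ 2 * (n%:R ^+ 2 * (cmod z + 1) ^+ n).
Proof.
move=> h1; elim: n => [|n IH].
  by rewrite !expr0 subrr mul0r subrr cmod0 expr0n/= mul0r mulr0.
have -> : (z + h) ^+ n.+1 - z ^+ n.+1 - n.+1%:R * (h * z ^+ n.+1.-1) =
    (z + h) * ((z + h) ^+ n - z ^+ n - n%:R * (h * z ^+ n.-1)) +
    n%:R * (h ^+ 2 * z ^+ n.-1).
  case: n {IH} => [|n]; first by rewrite /= !expr0; ring.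
  by rewrite /= !exprS -[n.+2%:R]natr1 -[n.+1%:R]natr1; ring.
have z1 : 0 <= cmod z + 1 by rewrite addr_ge0// cmod_ge0.
have z1' : 1 <= cmod z + 1 by rewrite lerDr cmod_ge0.
rewrite (le_trans (cmod_triangle _ _))// cmodM.
have -> : cmod h ^+ 2 * (n.+1%:R ^+ 2 * (cmod z + 1) ^+ n.+1) =
    (cmod z + 1) * (cmod h ^+ 2 * (n%:R ^+ 2 * (cmod z + 1) ^+ n)) +
    (2 * n%:R + 1) * (cmod h ^+ 2 * (cmod z + 1) ^+ n.+1).
  by move: (cmod z + 1) => r; rewrite [r ^+ n.+1]exprS -[n.+1%:R]natr1; ring.
apply: lerD.
  rewrite ler_pM ?cmod_ge0//.
  by rewrite (le_trans (cmod_triangle _ _))// lerD2l.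
rewrite !cmodM cmod_nat -expr2 cmodX ler_pM ?ler0n ?mulr_ge0 ?exprn_ge0 ?cmod_ge0//.
  by have := ler0n R n; lra.
rewrite ler_wpM2l ?exprn_ge0 ?cmod_ge0//.
rewrite (@le_trans _ _ ((cmod z + 1) ^+ n.-1))//.
  by rewrite lerXn2r ?nnegrE ?cmod_ge0// lerDl.
by rewrite ler_weXn2l//; lia.
Qed.

Lemma ent_class_deriv F : ent_class F ->
  exists2 G, ent_class G & forall z, has_cderiv F z (G z).
Proof.
move=> [c [A [s [s0 cA cF]]]].
pose c' n := n.+1%:R * c n.+1.
have cA' : exp_bounded (A * s) s c'.
  move=> n; rewrite /c' cmodM cmod_nat.
  apply: (le_trans (ler_wpM2l (ler0n _ _) (cA _))).
  rewrite exprS factS natrM; apply: eq_ler.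
  have f0 : n`!%:R != 0 :> R by rewrite pnatr_eq0 -lt0n fact_gt0.
  by field; rewrite f0 addrC natr1 pnatr_eq0.
have [G cG] := power_sum_exists s0 cA'.
exists G; first by exists c', (A * s), s.
move=> z; exists (A * expR (4 * s * (cmod z + 1))) => h h1.
apply: (ccvg_le (ccvgB (ccvgB (ccvg_shift (cF (z + h))) (ccvg_shift (cF z)))
  (ccvgM (ccvg_cst h) (cG z)))).
near=> n => /=.
have -> : \sum_(i < n.+1) c i * (z + h) ^+ i - \sum_(i < n.+1) c i * z ^+ i -
    h * (\sum_(i < n) c' i * z ^+ i) =
    \sum_(i < n.+1) c i * ((z + h) ^+ i - z ^+ i - i%:R * (h * z ^+ i.-1)).
  under [RHS]eq_bigr do rewrite !mulrBr.
  rewrite !sumrB; congr (_ - _).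
  rewrite [RHS]big_ord_recl/= mul0r mulr0 add0r mulr_sumr.
  by apply: eq_bigr => i _; rewrite /c'/bump/= add1n; ring.
rewrite (le_trans (cmod_sum _ _ _))//.
have z10 : 0 <= cmod z + 1 by rewrite addr_ge0// cmod_ge0.
apply: (@le_trans _ _ (\sum_(i < n.+1) A * cmod h ^+ 2 *
    ((4 * s * (cmod z + 1)) ^+ i / i`!%:R))).
  apply: ler_sum => i _; rewrite cmodM.
  apply: (le_trans (ler_pM (cmod_ge0 _) (cmod_ge0 _) (cA i) (cmod_powB_le z i h1))).
  (* The polynomial factor of the remainder is traded for a type four times larger. *)
  have i4 : (i%:R : R) ^+ 2 <= 4 ^+ i.
    rewrite -natrX -[4]/(4%:R) -natrX ler_nat -[4%N]/(2 ^ 2)%N -expnM mulnC expnM.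
    by rewrite leq_sqr ltnW// ltn_expl.
  have -> : A * cmod h ^+ 2 * ((4 * s * (cmod z + 1)) ^+ i / i`!%:R) =
    A * (s ^+ i / i`!%:R) * (cmod h ^+ 2 * (4 ^+ i * (cmod z + 1) ^+ i)).
    by rewrite !exprMn; ring.
  rewrite ler_wpM2l ?mulr_ge0 ?divr_ge0 ?exprn_ge0 ?(exp_bounded_A_ge0 cA)//.
  rewrite ler_wpM2l ?exprn_ge0 ?cmod_ge0//.
  by rewrite ler_wpM2r// exprn_ge0.
rewrite -mulr_sumr mulrAC ler_wpM2r ?exprn_ge0 ?cmod_ge0//.
rewrite ler_wpM2l ?(exp_bounded_A_ge0 cA)//.
by apply: expsum_le_expR; rewrite !mulr_ge0.
Unshelve. all: by end_near. Qed.

Lemma ent_classD F G : ent_class F -> ent_class G -> ent_class (fun z => F z + G z).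
Proof.
move=> [c [A [s [s0 cA cF]]]] [c' [A' [s' [s0' cA' cG]]]].
exists (fun n => c n + c' n), (A + A'), (s + s'); split.
- by rewrite addr_ge0.
- move=> n; rewrite (le_trans (cmod_triangle _ _))// mulrDl lerD//.
    rewrite (le_trans (cA n))// ler_wpM2l ?(exp_bounded_A_ge0 cA)//.
    by rewrite ler_wpM2r ?invr_ge0// lerXn2r ?nnegrE ?addr_ge0// lerDl.
  rewrite (le_trans (cA' n))// ler_wpM2l ?(exp_bounded_A_ge0 cA')//.
  by rewrite ler_wpM2r ?invr_ge0// lerXn2r ?nnegrE ?addr_ge0// lerDr.
- move=> z; apply: ccvg_eq (ccvgD (cF z) (cG z)) => n.
  by rewrite -big_split/=; apply: eq_bigr => i _; rewrite mulrDl.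
Qed.

Lemma power_sum_mulXsubC A s c c' F' b : 0 <= s -> exp_bounded A s c' ->
  power_sum c' F' -> c 0%N = - b * c' 0%N ->
  (forall k, c k.+1 = c' k - b * c' k.+1) ->
  power_sum c (fun z => (z - b) * F' z).
Proof.
move=> s0 cA cF c0 cS z; apply: ccvg_unshift.
have sh := ccvg_shift (cF z).
(* A partial sum of the product is [z - b] times that of [c'], minus an overflow term
   [c' n * z ^+ n * z]; the latter tends to 0 as a difference of consecutive partial sums. *)
pose proof (ccvgB (ccvgM (ccvg_cst (z - b)) sh) (ccvgM (ccvgB sh (cF z)) (ccvg_cst z))) as lim.
move: lim.
rewrite subrr mul0r subr0; apply: ccvg_eq => n.
rewrite [X in _ - (X - _) * _]big_ord_recr/= [X in _ - X * _]addrC addKr.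
elim: n => [|n IH]; first by rewrite !big_ord_recr !big_ord0/= c0 !expr0; ring.
rewrite [in RHS]big_ord_recr/= -{}IH [in LHS]big_ord_recr/= cS !exprS; ring.
Qed.

Lemma ent_class_mulXsubC b F : ent_class F -> ent_class (fun z => (z - b) * F z).
Proof.
move=> [c [A [s [s0 cA cF]]]].
have A0 := exp_bounded_A_ge0 cA.
pose c' n := (if n is k.+1 then c k else 0) - b * c n.
(* Shifting the coefficients loses a factor [n + 1], which is at most [2 ^+ n.+1]. *)
exists c', (A + cmod b * A), (2 * (s + 1)); split.
- by rewrite mulr_ge0// addr_ge0.
- have s1 : 0 <= s + 1 by rewrite addr_ge0.
  have hs n : s ^+ n / n`!%:R <= (2 * (s + 1)) ^+ n / n`!%:R.
    rewrite ler_wpM2r ?invr_ge0// lerXn2r ?nnegrE ?mulr_ge0//.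
    by lra.
  move=> n; rewrite (le_trans (cmod_triangleB _ _))// mulrDl lerD//; last first.
    by rewrite cmodM -mulrA ler_wpM2l ?cmod_ge0// (le_trans (cA n))// ler_wpM2l.
  case: n => [|n]; first by rewrite cmod0 mulr_ge0// divr_ge0// exprn_ge0// mulr_ge0.
  rewrite (le_trans (cA n))// ler_wpM2l//.
  rewrite ler_pdivrMr ?ltr0n ?fact_gt0// mulrAC factS natrM ler_pdivlMr; last first.
    by rewrite mulr_gt0 ?ltr0n ?fact_gt0.
  rewrite mulrA ler_wpM2r// exprMn mulrC.
  rewrite ler_pM ?ler0n ?exprn_ge0//.
    by rewrite -natrX ler_nat ltnW// ltn_expl.
  rewrite exprS -[leLHS]mul1r ler_pM// ?exprn_ge0// ?lerDr//.
  by rewrite lerXn2r ?nnegrE// lerDl.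
- by apply: (power_sum_mulXsubC s0 cA cF) => //; rewrite /c' sub0r mulNr.
Qed.

Lemma has_cderiv_mulXsubC F b z l : has_cderiv F z l ->
  has_cderiv (fun w => (w - b) * F w) z (F z + (z - b) * l).
Proof.
move=> [K hK]; exists (cmod (z - b) * K + cmod l + `|K|) => h h1.
have -> : (z + h - b) * F (z + h) - (z - b) * F z - h * (F z + (z - b) * l) =
    (z - b) * (F (z + h) - F z - h * l) + h * h * l +
    h * (F (z + h) - F z - h * l) by ring.
have h20 : 0 <= cmod h ^+ 2 by rewrite exprn_ge0// cmod_ge0.
rewrite (le_trans (cmod_triangle _ _))// [leRHS]mulrDl lerD//.
  rewrite (le_trans (cmod_triangle _ _))// [leRHS]mulrDl lerD//.
    by rewrite cmodM -mulrA ler_wpM2l ?cmod_ge0// hK.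
  by rewrite !cmodM -expr2 mulrC.
rewrite cmodM; apply: (@le_trans _ _ (1 * (`|K| * cmod h ^+ 2))); last by rewrite mul1r.
rewrite ler_pM ?cmod_ge0// (le_trans (hK _ h1))// ler_wpM2r//.
exact: ler_norm.
Qed.

(** The cofactor stays in [ent_class], so the step can be iterated; a factor [(z - b) ^+ m] thus
    makes the first [m] derivatives vanish at [b], as [zero_order] requires. *)
Lemma ent_class_derive_factor F G b m : ent_class G ->
  (forall z, F z = (z - b) ^+ m.+1 * G z) ->
  exists2 G', ent_class G' & forall z, has_cderiv F z ((z - b) ^+ m * G' z).
Proof.
elim: m F G => [|m IH] F G eG FE.
  have [G1 eG1 dG] := ent_class_deriv eG.
  exists (fun z => G z + (z - b) * G1 z).
    by apply: ent_classD => //; exact: ent_class_mulXsubC.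
  move=> z; rewrite expr0 mul1r (_ : F = fun w => (w - b) * G w).
    exact: has_cderiv_mulXsubC.
  by apply/funext => w; rewrite FE expr1.
have [G1 eG1 dG] := IH (fun z => (z - b) ^+ m.+1 * G z) G eG (fun=> erefl).
exists (fun z => G z + G1 z); first exact: ent_classD.
move=> z; rewrite (_ : F = fun w => (w - b) * ((w - b) ^+ m.+1 * G w)); last first.
  by apply/funext => w; rewrite FE exprS mulrA.
have -> : (z - b) ^+ m.+1 * (G z + G1 z) =
    (z - b) ^+ m.+1 * G z + (z - b) * ((z - b) ^+ m * G1 z).
  by rewrite exprS; ring.
exact: has_cderiv_mulXsubC.
Qed.

Lemma derive1n_zero (F : Cplx R -> Cplx R) G (b : Cplx R) m k : ent_class G ->
  (forall z, F z = (z - b) ^+ m * G z) -> (k < m)%N -> F^`(k) b = 0.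
Proof.
move=> eG FE km.
have [H eH FH] : exists2 H, ent_class H &
    forall z, F^`(k) z = (z - b) ^+ (m - k) * H z.
  elim: k km => [|k IH] km; first by exists G => // z; rewrite subn0 -FE.
  have [H eH FH] := IH (ltnW km).
  have E : (m - k = (m - k.+1).+1)%N by lia.
  rewrite E in FH.
  have [G' eG' dG'] := ent_class_derive_factor eH FH.
  exists G' => // z; rewrite derive1nS.
  by rewrite (has_cderiv_derive1 (dG' z)).
by rewrite FH subrr expr0n subn_eq0 leqNgt km mul0r.
Qed.

Lemma zero_order_ge (F : Cplx R -> Cplx R) G (b : Cplx R) m : ent_class G ->
  (forall z, F z = (z - b) ^+ m * G z) -> ((m%:R : R)%:E <= zero_order F b)%E.
Proof.
move=> eG FE; apply: le_ereal_inf_tmp => _ [k /= Fk <-].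
rewrite lee_fin ler_nat leqNgt; apply: contra_neqN Fk => km.
exact: derive1n_zero eG FE km.
Qed.

End PowerSeries.

(** * Zeros of the truncations and of the limit *)

Section Hurwitz.
Variable R : realType.
Local Notation C := R[i].

(** One ultrafilter makes all bounded sequences of roots and coefficients converge simultaneously,
    with no diagonal extraction. *)
Lemma ultra_cvg (U : set_system nat) (FU : UltraFilter U) (f : nat -> R) (B : R) :
  (forall n, `|f n| <= B) -> exists l : R, f @ U --> l.
Proof.
move=> fB.
have fI n : `[- B, B] (f n) by rewrite /= in_itv/= -ler_norml.
have [|l [_ cl]] := @segment_compact R (- B) B (f @ U) _.
  exact: (@filterE _ U _ (fun n => `[- B, B] (f n)) fI).
exists l; apply/cvgrPdist_lt => e e0.
have [//|UA] := in_ultra_setVsetC [set n | `|l - f n| < e] FU.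
have [x [[n /= nA <-] xe]] : (f @` (~` [set n | `|l - f n| < e])) `&` ball l e !=set0.
  apply: cl; last exact: nbhsx_ballx.
  by apply: (@filterS _ U _ _ (f @^-1` (f @` _)) _ UA) => n nA; exists n.
by case: nA; exact: xe.
Qed.

Lemma ultra_ccvg (U : set_system nat) (FU : UltraFilter U) (f : nat -> C) (B : R) :
  (forall n, cmod (f n) <= B) -> exists l, ccvg U f l.
Proof.
move=> fB.
have [a fa] := ultra_cvg FU (fun n => le_trans (Re_le_cmod (f n)) (fB n)).
have [b fb] := ultra_cvg FU (fun n => le_trans (Im_le_cmod (f n)) (fB n)).
by exists (a +i* b); apply: ccvg_ReIm.
Qed.

Lemma coef_mulXsubC (b : C) (q : {poly C}) k :
  (('X - b%:P) * q)`_k = (if k is k'.+1 then q`_k' else 0) - b * q`_k.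
Proof. by rewrite mulrBl coefB mul_polyC coefZ -commr_polyX coefMX; case: k. Qed.

(** Unrolling [q_k = p_(k+1) + b q_(k+1)] expresses [q_k] as the sum of the [b ^ n p_(k+1+n)], and
    [k! n! <= (k+n+1)!] bounds it by an exponential series. The constant ignores the degree, so it
    is uniform along truncations. *)
Lemma quotient_exp_bounded (p q : {poly C}) (b : C) (A s r : R) :
  0 <= s -> cmod b <= r -> p = ('X - b%:P) * q ->
  exp_bounded A s (fun n => p`_n) ->
  exp_bounded (A * (s * expR (s * r))) s (fun n => q`_n).
Proof.
move=> s0 br pE pA k; have A0 := exp_bounded_A_ge0 pA.
have r0 : 0 <= r by apply: le_trans br; exact: cmod_ge0.
have qS n : q`_n = p`_n.+1 + b * q`_n.+1.
  by rewrite pE coef_mulXsubC subrK.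
have step n : cmod q`_k <= A * (s ^+ k.+1 / k`!%:R) * expsum n (s * r) +
    r ^+ n * cmod q`_(k + n).
  elim: n => [|n IH].
    by rewrite /expsum big_ord0 mulr0 add0r expr0 mul1r addn0.
  apply: (le_trans IH); rewrite /expsum big_ord_recr/= mulrDr -addrA lerD2l.
  rewrite {1}qS -addnS; apply: (le_trans (ler_wpM2l _ (cmod_triangle _ _))).
    by rewrite exprn_ge0.
  rewrite mulrDr lerD//; last first.
    rewrite cmodM mulrA exprSr ler_wpM2r ?cmod_ge0// ler_wpM2l ?exprn_ge0//.
  apply: (le_trans (ler_wpM2l _ (pA _))); first by rewrite exprn_ge0.
  have -> : A * (s ^+ k.+1 / k`!%:R) * ((s * r) ^+ n / n`!%:R) =
      r ^+ n * (A * (s ^+ (k + n.+1) / (k`! * n`!)%:R)).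
    rewrite exprMn addnS -addSn exprD natrM.
    have f0 m : m`!%:R != 0 :> R by rewrite pnatr_eq0 -lt0n fact_gt0.
    by field; rewrite !f0.
  rewrite ler_wpM2l ?exprn_ge0// ler_wpM2l// ler_wpM2l ?exprn_ge0//.
  rewrite lef_pV2 ?posrE ?ltr0n ?muln_gt0 ?fact_gt0// ler_nat.
  rewrite addnS factS (@leq_trans (k + n)`!)//; last by rewrite leq_pmull.
  by rewrite -(bin_fact (leq_addr n k)) addKn leq_pmull// bin_gt0 leq_addr.
have := step (size q); rewrite [q`_(k + _)]nth_default ?leq_addl// cmod0 mulr0 addr0.
move=> /le_trans; apply; rewrite exprS.
have -> : A * (s * expR (s * r)) * (s ^+ k / k`!%:R) =
  A * (s * s ^+ k / k`!%:R) * expR (s * r) by ring.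
rewrite ler_wpM2l ?expsum_le_expR ?mulr_ge0//.
by rewrite exprn_ge0.
Qed.

(** Hurwitz's theorem without contour integrals. One root is divided out at a time; the quotients
    keep a uniform coefficient bound, hence converge along [U], and the recurrence for
    multiplication by ['X - b] passes to the limit. *)
Lemma limit_factor (U : set_system nat) (FU : UltraFilter U) (r : R) m :
  forall (p : nat -> {poly C}) (bs : nat -> seq C) (c : nat -> C) (A s : R),
  0 <= s -> (forall j, size (bs j) = m) ->
  (forall j, all (fun b => cmod b <= r) (bs j)) ->
  (forall j, exists q, p j = (\prod_(b <- bs j) ('X - b%:P)) * q) ->
  (forall j, exp_bounded A s (fun n => (p j)`_n)) ->
  (forall n, ccvg U (fun j => (p j)`_n) (c n)) ->
  exists (bl : seq C) (G : C -> C), [/\ size bl = m, all (fun b => cmod b <= r) bl,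
    ent_class G & power_sum c (fun z => (\prod_(b <- bl) (z - b)) * G z)].
Proof.
have PU : ProperFilter U by exact: ultra_proper.
elim: m => [|m IH] p bs c A s s0 sz rb pq pA pc.
  have cA : exp_bounded A s c.
    by move=> n; apply: (ccvg_le (pc n)); apply: filterE => j /=; exact: pA.
  have [G cG] := power_sum_exists s0 cA.
  exists [::], G; split => //; first by exists c, A, s.
  by move=> z; rewrite big_nil mul1r; exact: cG.
have bsE j : bs j = head 0 (bs j) :: behead (bs j).
  by have := sz j; case: (bs j).
have hb j : cmod (head 0 (bs j)) <= r.
  by have := rb j; rewrite bsE /= => /andP[].
pose q j := projT1 (cid (pq j)).
have qE j : p j = (\prod_(b <- bs j) ('X - b%:P)) * q j := projT2 (cid (pq j)).
pose p' j := (\prod_(b <- behead (bs j)) ('X - b%:P)) * q j.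
have pE j : p j = ('X - (head 0 (bs j))%:P) * p' j.
  by rewrite qE {1}bsE big_cons -mulrA.
have pA' j := quotient_exp_bounded s0 (hb j) (pE j) (pA j).
have [b hbl] := ultra_ccvg FU hb.
have br : cmod b <= r by apply: (ccvg_le hbl); apply: filterE => j /=; exact: hb.
pose c' n := projT1 (cid (ultra_ccvg FU (fun j => pA' j n))).
have pc' n : ccvg U (fun j => (p' j)`_n) (c' n) :=
  projT2 (cid (ultra_ccvg FU (fun j => pA' j n))).
have [|||bl [G [szl rl eG cG]]] := IH p' (fun j => behead (bs j)) c' _ s s0 _ _ _ pA' pc'.
- by move=> j; rewrite size_behead sz.
- by move=> j; have := rb j; rewrite bsE /= => /andP[].
- by move=> j; exists (q j).
exists (b :: bl), G; split => //=; first by rewrite szl.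
  by rewrite br.
have cA' : exp_bounded (A * (s * expR (s * r))) s c'.
  by move=> n; apply: (ccvg_le (pc' n)); apply: filterE => j /=; exact: pA'.
have -> : (fun z => \prod_(b0 <- b :: bl) (z - b0) * G z) =
    fun z => (z - b) * (\prod_(b0 <- bl) (z - b0) * G z).
  by apply/funext => z; rewrite big_cons mulrA.
apply: (power_sum_mulXsubC s0 cA' cG).
  apply: ccvg_unique (pc 0%N) _.
  pose proof (ccvgM (ccvgB (ccvg_cst 0) hbl) (pc' 0%N)) as h; move: h.
  rewrite sub0r; apply: ccvg_eq => j.
  by rewrite pE coef_mulXsubC; ring.
move=> k; apply: ccvg_unique (pc k.+1) _.
pose proof (ccvgB (pc' k) (ccvgM hbl (pc' k.+1))) as h; move: h.
apply: ccvg_eq => j.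
by rewrite pE coef_mulXsubC.
Qed.

(** Equal entries of [bl] are grouped: the factors other than [z - b] go into the cofactor, so the
    order at [b] is at least its multiplicity in [bl]. *)
Lemma num_zeros_ge (F : Cplx R -> Cplx R) (G : C -> C) (bl : seq C) (r : R) :
  ent_class G -> all (fun b => cmod b <= r) bl ->
  (forall z, F z = (\prod_(b <- bl) (z - b)) * G z) ->
  (((size bl)%:R : R)%:E <= num_zeros F r)%E.
Proof.
move=> eG rl FE.
have ub := undup_uniq bl.
apply: esum_ge; exists [set` undup bl].
  split; first exact: finite_seq.
  move=> b /=; rewrite mem_undup => bbl; split; first exact: (allP rl).
  by rewrite FE (big_rem b)//= subrr !mul0r.
rewrite -(fsbig_seq _ _ ub).
have -> : (size bl)%:R%:E = \sum_(b <- undup bl) ((count_mem b bl)%:R : R)%:E.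
  rewrite sumEFin -natr_sum; congr (_%:R%:E).
  under eq_bigr do rewrite -sum1_count big_mkcond/=.
  rewrite exchange_big/= -sum1_size; apply/eq_big_seq => x xbl.
  rewrite -big_mkcond/= sum1_count (eq_count (a2 := pred1 x)); last first.
    by move=> y; rewrite /= eq_sym.
  by rewrite count_uniq_mem// mem_undup xbl.
rewrite big_seq [leRHS]big_seq; apply: lee_sum => b; rewrite mem_undup => bbl.
apply: (@zero_order_ge _ _ (fun z => (\prod_(b' <- bl | b' != b) (z - b')) * G z)).
  elim: (bl) => [|x l IH].
    by under eq_fun do rewrite big_nil mul1r.
  case: (eqVneq x b) => [->|xb].
    by under eq_fun do rewrite big_cons eqxx.
  by under eq_fun do rewrite big_cons xb -mulrA; exact: ent_class_mulXsubC.
move=> z; rewrite FE (bigID (pred1 b))/= -mulrA; congr (_ * _).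
rewrite (eq_bigr (fun=> z - b)) => [|i /eqP->//].
by rewrite big_const_seq iter_mulr_1.
Qed.

(* Along an ultrafilter the [m] roots of the truncations converge, and so do the
   coefficients of their quotients by the corresponding linear factors. *)
Lemma num_zeros_ge_truncation (F : Cplx R -> Cplx R) (c : nat -> C) (A s r : R) m :
  0 <= s -> exp_bounded A s c -> power_sum c F ->
  (forall M, exists M' bs q, [/\ (M <= M')%N, size bs = m,
     all (fun b => cmod b <= r) bs &
     \poly_(i < M') c i = (\prod_(b <- bs) ('X - b%:P)) * q]) ->
  ((m%:R : R)%:E <= num_zeros F r)%E.
Proof.
move=> s0 cA cF hM.
pose M j := projT1 (cid (hM j)).
pose bs j := projT1 (cid (projT2 (cid (hM j)))).
have hj j : exists q, [/\ (j <= M j)%N, size (bs j) = m,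
     all (fun b => cmod b <= r) (bs j) &
     \poly_(i < M j) c i = (\prod_(b <- bs j) ('X - b%:P)) * q] :=
  projT2 (cid (projT2 (cid (hM j)))).
have [U [FU oU]] := ultraFilterLemma (eventually_filter).
have PU : ProperFilter U by exact: ultra_proper.
have [|||||bl [G [szl rl eG cG]]] := @limit_factor U FU r m (fun j => \poly_(i < M j) c i)
  bs c A s s0.
- by move=> j; have [q []] := hj j.
- by move=> j; have [q []] := hj j.
- by move=> j; have [q []] := hj j; exists q.
- move=> j n; rewrite coef_poly; case: ifP => _; first exact: cA.
  by rewrite cmod0 mulr_ge0 ?(exp_bounded_A_ge0 cA)// divr_ge0// exprn_ge0.
- move=> n; apply: (@ccvg_sub _ _ \oo) => //.
  move=> e e0; exists n.+1 => // j /= nj; have [q [jM _ _ _]] := hj j.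
  by rewrite coef_poly (leq_trans nj jM) subrr cmod0.
rewrite -szl; apply: num_zeros_ge eG rl _ => z.
exact: power_sum_unique cF cG z.
Qed.

End Hurwitz.

(** * Functions with few zeros *)

Section FewZeros.
Variable R : realType.
Local Notation C := R[i].

Definition lpoly (s : seq C) : {poly C} := \prod_(a <- s) (1 - a^-1 *: 'X).

Lemma horner_lpoly s z : (lpoly s).[z] = linprod s z.
Proof.
rewrite /lpoly /linprod horner_prod; apply: eq_bigr => a _.
by rewrite !hornerE mulrC.
Qed.

Lemma coef0_lpoly s : (lpoly s)`_0 = 1.
Proof.
rewrite -horner_coef0 horner_lpoly /linprod big1// => a _.
by rewrite mul0r subr0.
Qed.

Lemma coef1_lpoly s : (lpoly s)`_1 = - \sum_(a <- s) a^-1.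
Proof.
elim: s => [|a s IH]; first by rewrite /lpoly !big_nil coef1 oppr0.
rewrite /lpoly !big_cons -/(lpoly s) mulrBl mul1r coefB IH -scalerAl coefZ.
by rewrite coefXM/= coef0_lpoly mulr1 opprD addrC.
Qed.

(** One list of roots for two factorisations: the monic one for divisibility and degree, the one
    normalised at 0 for Jensen's formula. *)
Lemma poly_lpoly (U : {poly C}) : U`_0 != 0 ->
  exists s, [/\ (forall a, a \in s -> a != 0),
    U = lead_coef U *: \prod_(a <- s) ('X - a%:P) & U = U`_0 *: lpoly s].
Proof.
move=> U0; have [s Us] := closed_field_poly_normal U.
have s0 a : a \in s -> a != 0.
  move=> as_; apply: contraNneq U0 => a0.
  rewrite Us coefZ -horner_coef0 horner_prod (big_rem a)//= a0 hornerXsubC subrr.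
  by rewrite mul0r mulr0.
exists s; split => //.
have E : U = (lead_coef U * \prod_(a <- s) (- a)) *: lpoly s.
  rewrite [LHS]Us -scalerA; congr (_ *: _).
  rewrite /lpoly; elim: s s0 {Us} => [|a s IH] s0; first by rewrite !big_nil scale1r.
  have a0 : a != 0 by rewrite s0// mem_head.
  have -> : \prod_(z <- a :: s) ('X - z%:P) =
      (- a *: (1 - a^-1 *: 'X)) * \prod_(z <- s) ('X - z%:P).
    rewrite big_cons scalerBr scalerA mulNr mulfV// scaleN1r opprK scaleNr.
    by rewrite alg_polyC addrC.
  rewrite !big_cons IH => [|b bs]; last by rewrite s0// inE bs orbT.
  by rewrite -scalerAl -scalerAr scalerA.
rewrite {1}E; congr (_ *: _); rewrite {2}E coefZ coef0_lpoly mulr1//.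
Qed.

(** The bound does not depend on [M]. The multiplicative constant moves into the exponent by
    [x <= expR x]. *)
Lemma linprod_growth (c : nat -> C) (A s : R) (n0 M : nat) (as_ : seq C) :
  0 <= s -> exp_bounded A s c -> c n0 != 0 ->
  \poly_(i < M) c (i + n0)%N = c n0 *: lpoly as_ ->
  forall t, 0 < t -> forall z, cmod z = t ->
  cmod (linprod as_ z) <= expR (A * s ^+ n0 / cmod (c n0) + s * t).
Proof.
move=> s0 cA c0 UE t t0 z zt; have A0 := exp_bounded_A_ge0 cA.
have c0' : 0 < cmod (c n0) by rewrite cmod_gt0.
have hU : cmod (\poly_(i < M) c (i + n0)%N).[z] <= A * s ^+ n0 * expR (s * t).
  rewrite horner_poly (le_trans (cmod_sum _ _ _))//.
  apply: (@le_trans _ _ (A * s ^+ n0 * expsum M (s * t))); last first.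
    rewrite ler_wpM2l ?expsum_le_expR ?mulr_ge0 ?exprn_ge0//; exact: ltW.
  rewrite /expsum mulr_sumr; apply: ler_sum => i _.
  rewrite cmodM cmodX zt; apply: (le_trans (ler_wpM2r _ (cA _))).
    by rewrite exprn_ge0// ltW.
  rewrite -!mulrA ler_wpM2l// exprD [_ ^+ i * _]mulrC -!mulrA ler_wpM2l ?exprn_ge0//.
  rewrite exprMn -mulrA ler_wpM2l ?exprn_ge0// mulrC.
  rewrite ler_wpM2l ?exprn_ge0 ?(ltW t0)//.
  rewrite lef_pV2 ?posrE ?ltr0n ?fact_gt0// ler_nat.
  by rewrite -(bin_fact (leq_addr n0 i)) mulnCA leq_pmulr// muln_gt0 fact_gt0 bin_gt0 leq_addr.
rewrite UE hornerZ horner_lpoly cmodM in hU.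
rewrite -(ler_pM2l c0') (le_trans hU)// expRD mulrA ler_wpM2r ?expR_ge0//.
rewrite [leRHS]mulrC -ler_pdivrMr//.
by rewrite (le_trans _ (expR_ge1Dx _))// lerDr.
Qed.

Lemma expR_eventually_ge (n : nat) (K a : R) : 0 < a ->
  exists r0, 0 < r0 /\ forall r, r0 <= r -> K * r ^+ n <= expR (a * r).
Proof.
move=> a0.
have f0 : 0 < a ^+ n.+1 / n.+1`!%:R by rewrite divr_gt0 ?exprn_gt0// ltr0n fact_gt0.
exists (`|K| / (a ^+ n.+1 / n.+1`!%:R) + 1); split.
  by rewrite ltr_wpDl// divr_ge0// ltW.
move=> r rr; have r0 : 0 < r.
  by apply: lt_le_trans rr; rewrite ltr_wpDl// divr_ge0// ltW.
have h : `|K| <= a ^+ n.+1 / n.+1`!%:R * r.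
  by rewrite mulrC -ler_pdivrMr// (le_trans _ rr)// lerDl.
apply: (@le_trans _ _ ((a * r) ^+ n.+1 / n.+1`!%:R)).
  apply: (@le_trans _ _ (a ^+ n.+1 / n.+1`!%:R * r * r ^+ n)).
    by rewrite ler_wpM2r ?exprn_ge0 ?(ltW r0)// (le_trans _ h)// ler_norm.
  by rewrite exprMn [r ^+ n.+1]exprS; apply: eq_ler; ring.
have ar0 : 0 <= a * r by rewrite mulr_ge0// ltW.
apply: le_trans (expsum_le_expR n.+2 ar0).
rewrite /expsum big_ord_recr/= lerDr sumr_ge0// => i _.
by rewrite divr_ge0// exprn_ge0.
Qed.

(* With few zeros in the disk of radius [rho], the truncations of the series are
   [z ^ n0 * exp (alpha z)] up to a factor [exp (eta r)] on the circle of radius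
   [r = epsilon * rho]. *)
Lemma truncation_bound (s eta eps chi : R) (c : nat -> C) (A : R) (n0 : nat) :
  0 <= s -> 0 < eta -> 0 < eps -> eps <= 1 -> 36 * (s + 1) * eps <= eta ->
  chi = eta * eps ^+ 2 / 4 -> exp_bounded A s c -> c n0 != 0 ->
  exists r0, forall r, r0 <= r -> forall M as_, 
  (1 < M)%N -> (forall a, a \in as_ -> a != 0) ->
  \poly_(i < M) c (i + n0)%N = c n0 *: lpoly as_ ->
  (count (fun a => (cmod a <= r / eps)%R) as_)%:R <= chi * (r / eps) ->
  exists alpha : C, [/\ 0 < r, cmod alpha <= r ^+ 2 &
    forall z, cmod z = r ->
    cmod (z ^+ n0 * (\poly_(i < M) c (i + n0)%N).[z]) *
      expR (- complex.Re (alpha * z)) <= expR (eta * r) / 2].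
Proof.
move=> s0 eta0 eps0 eps1 epseta chiE cA c0; have A0 := exp_bounded_A_ge0 cA.
have c0' : 0 < cmod (c n0) by rewrite cmod_gt0.
pose k := A * s ^+ n0 / cmod (c n0).
have k0 : 0 <= k by rewrite divr_ge0 ?mulr_ge0 ?exprn_ge0// ltW.
have [r1 [r10 hr1]] := expR_eventually_ge n0 (2 * cmod (c n0) * expR (3 * k))
  (divr_gt0 eta0 (ltr0n R 2)).
pose D := cmod (c n0.+1 / c n0) + chi / eps * expR (k + s) + 1.
have chi0 : 0 < chi by rewrite chiE !(mulr_gt0, divr_gt0, exprn_gt0).
have D1 : 1 <= D.
  rewrite /D lerDr addr_ge0 ?cmod_ge0// mulr_ge0 ?expR_ge0// divr_ge0// ltW//.
exists (Num.max r1 D) => r; rewrite ge_max => /andP[r1r Dr] M as_ M1 as0 UE cnt.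
have r0 : 0 < r by exact: lt_le_trans r1r.
have r1' : 1 <= r by exact: le_trans Dr.
have gr := linprod_growth s0 cA c0 UE; rewrite -/k in gr.
clearbody k.
have rho0 : 0 < r / eps by rewrite divr_gt0.
exists (tail_exponent as_ (r / eps)); split => //.
(* The linear coefficient determines the sum over all roots, so [alpha] is [c n0.+1 / c n0] plus the
   sum over the near roots only, which are few and not close to 0. *)
- have S1 : \sum_(a <- as_) a^-1 = - (c n0.+1 / c n0).
    have : (\poly_(i < M) c (i + n0)%N)`_1 = (c n0 *: lpoly as_)`_1 by rewrite UE.
    rewrite coef_poly M1 add1n coefZ coef1_lpoly => ->.
    by rewrite mulrN mulNr opprK mulrC mulKf.
  have S2 := sum_inv_le (r / eps) as0 (gr 1 ltr01).
  rewrite mulr1 in S2; have ks : 0 <= k + s by rewrite addr_ge0.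
  have {}S2 := S2 ks.
  have E : tail_exponent as_ (r / eps) =
      c n0.+1 / c n0 + \sum_(a <- as_ | cmod a <= r / eps) a^-1.
    rewrite /tail_exponent -[c n0.+1 / _]opprK -S1.
    have -> : \sum_(a <- as_) a^-1 = \sum_(a <- as_ | cmod a <= r / eps) a^-1 +
        \sum_(a <- as_ | r / eps < cmod a) a^-1.
      rewrite (bigID (fun a : C => cmod a <= r / eps))/=; congr (_ + _).
      by apply: eq_bigl => a; rewrite ltNge.
    by rewrite opprD addrAC addNr add0r.
  rewrite E (le_trans (cmod_triangle _ _))//.
  have h3 : cmod (\sum_(a <- as_ | cmod a <= r / eps) a^-1) <=
      chi / eps * expR (k + s) * r.
    rewrite (le_trans (cmod_sum _ _ _))//.
    under eq_bigr do rewrite cmodV.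
    rewrite (le_trans S2)//.
    rewrite (le_trans (ler_wpM2r (expR_ge0 _) cnt))//.
    by apply: eq_ler; ring.
  apply: (@le_trans _ _ (D * r)); last by rewrite expr2 ler_pM2r.
  rewrite /D !mulrDl; have := cmod_ge0 (c n0.+1 / c n0); set x := cmod _ => x0.
  have : x <= x * r by rewrite ler_peMr.
  by move: h3; set y := cmod _; lra.
move=> z zr; rewrite UE hornerZ horner_lpoly !cmodM cmodX zr.
have epsr : eps * r <= r / eps.
  rewrite ler_pdivlMr// mulrC mulrA -expr2 ler_piMl ?(ltW r0)//.
  by rewrite exprn_ile1// ltW.
have main := cmod_linprod_tail_le r0 eps0 epsr as0 gr zr.
set m := count _ _ in main cnt; set al := tail_exponent _ _ in main *.
have S2 : \sum_(a <- as_ | r / eps < cmod a) cmod a ^- 2 <=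
    2 * (2 * k) / (r / eps) ^+ 2 + 4 * (4 * s) / (r / eps).
  apply: sum_inv_sqr_le => //; rewrite ?mulr_ge0//.
  by move=> t t0; apply: count_le_of_growth as0 gr _ t0.
have E1 : expR (k + s * (eps * r)) <= expR (k + s * eps * r) by rewrite mulrA.
(* Origin of [chi]: at most [chi * r / eps] factors, each at most [expR eps^-1]. The choice of [eps]
   allots another [eta * r / 4] to the terms in [s * eps * r]; the remaining [eta * r / 2] absorbs
   [r ^+ n0] and the constants. *)
have E2 : (1 + eps^-1) ^+ m <= expR (eta * r / 4).
  apply: (@le_trans _ _ (expR eps^-1 ^+ m)).
    rewrite lerXn2r ?nnegrE ?expR_ge0 ?addr_ge0 ?invr_ge0 ?(ltW eps0)//.
    exact: expR_ge1Dx.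
  rewrite -expRM_natl ler_expR -ler_pdivlMr ?invr_gt0// (le_trans cnt)//.
  by rewrite chiE; apply: eq_ler; field; rewrite gt_eqF.
have E3 : expR (r ^+ 2 / 2 * \sum_(a <- as_ | r / eps < cmod a) cmod a ^- 2) <=
    expR (2 * k + 8 * s * eps * r).
  rewrite ler_expR (le_trans (ler_wpM2l _ S2))//.
    by rewrite divr_ge0// exprn_ge0// ltW.
  have -> : r ^+ 2 / 2 * (2 * (2 * k) / (r / eps) ^+ 2 + 4 * (4 * s) / (r / eps)) =
    2 * (k * eps ^+ 2) + 8 * s * eps * r.
    by field; rewrite !gt_eqF.
  by rewrite lerD2r ler_wpM2l// ler_piMr// exprn_ile1// ltW.
have E : cmod (linprod as_ z) * expR (- complex.Re (al * z)) <=
    expR (3 * k + eta * r / 2).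
  apply: (le_trans main).
  apply: (@le_trans _ _ (expR (k + s * eps * r) * expR (eta * r / 4) *
      expR (2 * k + 8 * s * eps * r))).
    rewrite !ler_pM ?mulr_ge0 ?expR_ge0 ?exprn_ge0 ?addr_ge0 ?invr_ge0 ?(ltW eps0)//.
  rewrite -!expRD ler_expR.
  have : 9 * s * eps * r <= eta / 4 * r.
    rewrite ler_wpM2r ?(ltW r0)//.
    have : 0 <= eps by exact: ltW.
    by move: epseta; rewrite mulrDr mulrDl => *; lra.
  lra.
have := hr1 r r1r.
have -> : expR (eta * r) = expR (eta * r / 2) * expR (eta / 2 * r).
  by rewrite -expRD; congr expR; field.
rewrite expRD in E; move=> h.
rewrite -[leLHS]mulrA -[X in _ * X <= _]mulrA.
apply: (@le_trans _ _ (r ^+ n0 * (cmod (c n0) * (expR (3 * k) * expR (eta * r / 2))))).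
  rewrite ler_wpM2l ?exprn_ge0 ?(ltW r0)// ler_wpM2l ?(ltW c0')//.
have -> : r ^+ n0 * (cmod (c n0) * (expR (3 * k) * expR (eta * r / 2))) =
  expR (eta * r / 2) * (2 * cmod (c n0) * expR (3 * k) * r ^+ n0 / 2) by field.
by rewrite -[leRHS]mulrA ler_wpM2l ?expR_ge0// ler_wpM2r.
Qed.

(** The order of quantifiers matters: [c], [A] and [F] influence only the threshold on [r], not
    [chi]. *)
Lemma few_zeros_exponential (s eta : R) : 0 <= s -> 0 < eta ->
  exists chi, 0 < chi /\ forall (c : nat -> C) (A : R) (F : Cplx R -> Cplx R),
  exp_bounded A s c -> power_sum c F -> (exists n, c n != 0) ->
  (forall r0, exists r, r0 <= r /\ (num_zeros F r < (chi * r)%:E)%E) ->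
  forall r0, exists r (alpha : C), [/\ r0 <= r, 0 < r, cmod alpha <= r ^+ 2 &
   forall k, k%:R <= r ->
   cmod (\sum_(j < k.+1) c j * ((- alpha) ^+ (k - j) / (k - j)`!%:R)) * r ^+ k <=
   expR (eta * r)].
Proof.
move=> s0 eta0.
pose eps := Num.min 1 (eta / (36 * (s + 1))).
have s1 : 0 < 36 * (s + 1) by rewrite mulr_gt0// ltr_wpDl.
have eps0 : 0 < eps by rewrite lt_min ltr01 divr_gt0.
have eps1 : eps <= 1 by rewrite ge_min lexx.
have epseta : 36 * (s + 1) * eps <= eta.
  by rewrite mulrC -ler_pdivlMr// ge_min lexx orbT.
exists (eta * eps ^+ 2 / 4); split; first by rewrite !(mulr_gt0, divr_gt0, exprn_gt0).
set chi := _ / _ => c A F cA cF [n cn] hz r0.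
have [n0 c0 cmin] : exists2 n0, c n0 != 0 & forall i, (i < n0)%N -> c i = 0.
  have ex : exists n, c n != 0 by exists n.
  exists (ex_minn ex); first by case: ex_minnP.
  case: ex_minnP => m _ hm i im; apply/eqP; apply: contraLR im => ci.
  by rewrite -leqNgt hm.
have [r1 hr1] := truncation_bound s0 eta0 eps0 eps1 epseta (erefl chi) cA c0.
have [rho [rhoge hrho]] := hz (Num.max 0 (Num.max r0 r1) / eps).
pose r := rho * eps.
have : Num.max 0 (Num.max r0 r1) <= r by rewrite -ler_pdivrMr//.
rewrite !ge_max => /and3P[rge0 r0r r1r].
have rhoE : rho = r / eps by rewrite mulfK// gt_eqF.
pose m := (Num.truncn (chi * rho)).+1.
(* Otherwise arbitrarily long truncations would have [m] roots in the disk, hence [F] at least [m]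
   zeros there, although [m] exceeds [chi * rho]. *)
have [M0 hM0] : exists M0, forall M bs q, (M0 <= M)%N -> size bs = m ->
    all (fun b => cmod b <= rho) bs ->
    \poly_(i < M) c i = (\prod_(b <- bs) ('X - b%:P)) * q -> False.
  apply: contrapT => h.
  suff : ((m%:R : R)%:E <= num_zeros F rho)%E.
    move=> /le_lt_trans/(_ hrho); rewrite lte_fin => hm.
    by have := lt_trans hm (truncnS_gt (chi * rho)); rewrite ltxx.
  apply: num_zeros_ge_truncation s0 cA cF _ => M; apply: contrapT => hM.
  apply: h; exists M => M' bs q MM' sz rb E; apply: hM.
  by exists M', bs, q.
(* Long enough for [hM0], for a linear coefficient, and for all coefficients of index at most [r] to
   be those of [c]. *)
pose M := (maxn M0 (Num.truncn r).+2)%N.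
pose U := \poly_(i < M) c (i + n0)%N.
have M1 : (1 < M)%N by rewrite leq_max orbC.
have U0 : U`_0 = c n0 by rewrite coef_poly add0n (ltn_trans _ M1).
have [as_ [as0 UP UE]] : exists s, [/\ (forall a, a \in s -> a != 0),
    U = lead_coef U *: \prod_(a <- s) ('X - a%:P) & U = U`_0 *: lpoly s].
  by apply: poly_lpoly; rewrite U0.
rewrite U0 in UE.
have TU : \poly_(i < M + n0) c i = 'X^n0 * U.
  apply/polyP => i; rewrite coefXnM coef_poly.
  case: (ltnP i n0) => [in0|n0i]; first by rewrite cmin// if_same.
  by rewrite coef_poly subnK// ltn_subLR// addnC.
have cnt : (count (fun a => (cmod a <= r / eps)%R) as_)%:R <= chi * (r / eps).
  rewrite -rhoE; set k := count _ _.
  have [km|mk] := leqP m k; last first.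
    apply: (@le_trans _ _ (Num.truncn (chi * rho))%:R).
      by rewrite ler_nat -ltnS.
    rewrite truncn_le mulr_ge0//.
      by rewrite divr_ge0// mulr_ge0 ?exprn_ge0// ltW.
    by rewrite rhoE divr_ge0// ltW.
  exfalso; apply: (hM0 (M + n0)%N (take m [seq a <- as_ | cmod a <= rho])
    ('X^n0 * (lead_coef U *: (\prod_(a <- drop m [seq a <- as_ | cmod a <= rho]) ('X - a%:P)
      * \prod_(a <- as_ | ~~ (cmod a <= rho)) ('X - a%:P))))).
  - by rewrite (leq_trans (leq_maxl M0 (Num.truncn r).+2))// leq_addr.
  - by rewrite size_takel// size_filter.
  - by apply/allP => a /mem_take; rewrite mem_filter => /andP[].
  - rewrite TU mulrCA; congr (_ * _); rewrite {1}UP -scalerAr; congr (_ *: _).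
    rewrite mulrA -big_cat/= cat_take_drop (bigID (fun a : C => cmod a <= rho))/=.
    by rewrite big_filter.
have [alpha [rpos al zb]] := hr1 r r1r M as_ M1 as0 UE cnt.
exists r, alpha; split => //.
move=> k kr.
have Tk j : (j <= k)%N -> (\poly_(i < M + n0) c i)`_j = c j.
  move=> jk; rewrite coef_poly ifT// (leq_ltn_trans jk)//.
  rewrite (@leq_trans M) ?leq_addr// leq_max; apply/orP; right.
  have : k%:R < (Num.truncn r).+1%:R :> R by exact: le_lt_trans kr (truncnS_gt _).
  by rewrite ltr_nat => /ltnW.
have B0 : 0 < expR (eta * r) / 2 by rewrite divr_gt0// expR_gt0.
have h : forall z, cmod z = r -> cmod (\poly_(i < M + n0) c i).[z] *
    expR (- complex.Re (alpha * z)) <= expR (eta * r) / 2.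
  by move=> z zr; rewrite TU hornerM hornerXn; exact: zb.
have := coef_mul_expN_le rpos B0 h k.
rewrite [2 * _]mulrC divfK// => /(le_trans _); apply.
rewrite ler_wpM2r ?exprn_ge0 ?(ltW rpos)//; apply: eq_ler; congr cmod.
by apply: eq_bigr => j _; rewrite Tk// -ltnS.
Qed.

End FewZeros.

(** * Newton interpolation *)

Section NewtonInterpolation.
Variable R : realType.
Local Notation C := R[i].

(* The Taylor coefficients of [exp (- alpha z) * \sum_n c n * z ^ n]. *)
Definition exp_twist (c : nat -> C) (alpha : C) (k : nat) : C :=
  \sum_(j < k.+1) c j * ((- alpha) ^+ (k - j) / (k - j)`!%:R).

Lemma exp_twistK (c : nat -> C) (alpha : C) n :
  \sum_(k < n.+1) exp_twist c alpha k * (alpha ^+ (n - k) / (n - k)`!%:R) = c n.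
Proof.
pose P := \poly_(i < n.+1) c i.
have E1 : ((P * exp_poly n.+1 (- alpha)) * exp_poly n.+1 alpha)`_n =
    \sum_(k < n.+1) exp_twist c alpha k * (alpha ^+ (n - k) / (n - k)`!%:R).
  rewrite coefM; apply: eq_bigr => k _; congr (_ * _).
    rewrite coefM; apply: eq_bigr => j _.
    have jn : (j < n.+1)%N by exact: leq_trans (ltn_ord j) (ltn_ord k).
    have kjn : (k - j < n.+1)%N by exact: leq_ltn_trans (leq_subr _ _) (ltn_ord k).
    by rewrite !coef_poly jn kjn.
  by rewrite coef_poly ltnS leq_subr.
rewrite -E1 -mulrA coefM big_ord_recr/= subnn coef_exp_polyM// addNr.
rewrite expr0 fact0 divr1 mulr1 coef_poly ltnSn big1 ?add0r// => j _.
rewrite coef_exp_polyM ?ltnS ?leq_subr// addNr expr0n subn_eq0 leqNgt ltn_ord.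
by rewrite mul0r mulr0.
Qed.

(** Multiplying back by [exp (alpha z)]. Applied to a coefficient that is known to be large, this
    bounds [cmod alpha] from below. *)
Lemma coef_bound_of_twist (c : nat -> C) (alpha : C) (r B : R) n :
  0 < r -> (forall k, (k <= n)%N -> cmod (exp_twist c alpha k) * r ^+ k <= B) ->
  cmod (c n) * r ^+ n <= B * expR (cmod alpha * r).
Proof.
move=> r0 hB.
have B0 : 0 <= B.
  apply: le_trans (hB 0%N (leq0n _)).
  by rewrite mulr_ge0 ?cmod_ge0// exprn_ge0// ltW.
have ar0 : 0 <= cmod alpha * r by rewrite mulr_ge0 ?cmod_ge0// ltW.
rewrite -{1}(exp_twistK c alpha n).
apply: (@le_trans _ _ (B * expsum n.+1 (cmod alpha * r))); last first.
  by rewrite ler_wpM2l// expsum_le_expR.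
have rn0 : 0 <= r ^+ n by rewrite exprn_ge0// ltW.
apply: (le_trans (ler_wpM2r rn0 (cmod_sum _ _ _))).
rewrite /expsum (reindex_inj rev_ord_inj)/= mulr_suml mulr_sumr.
apply: ler_sum => k _; rewrite cmodM subSS.
have kn : (n - k <= n)%N by exact: leq_subr.
have -> : r ^+ n = r ^+ (n - k) * r ^+ k by rewrite -exprD subnK// -ltnS.
rewrite mulrACA ler_pM ?mulr_ge0 ?cmod_ge0 ?exprn_ge0 ?(ltW r0)// ?hB//.
have kn' : (k <= n)%N by rewrite -ltnS.
rewrite (subKn kn') cmodM cmodV cmodX cmod_nat exprMn.
by apply: eq_ler; ring.
Qed.

Definition binpoly (k : nat) : {poly C} :=
  (k`!%:R)^-1 *: \prod_(i < k) ('X - (i%:R)%:P).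

Lemma size_binpoly k : (size (binpoly k) <= k.+1)%N.
Proof.
rewrite (leq_trans (size_scale_leq _ _))//.
have := size_prod_XsubC (index_enum 'I_k) (fun i : 'I_k => i%:R : C).
by rewrite -[index_enum _]enumT size_enum_ord => ->.
Qed.

Lemma horner_binpoly_nat k n : (binpoly k).[n%:R] = 'C(n, k)%:R.
Proof.
rewrite hornerZ horner_prod.
have -> : \prod_(i < k) ('X - (i%:R)%:P).[n%:R] = (n ^_ k)%:R :> C.
  elim: k => [|k IH]; first by rewrite big_ord0.
  rewrite big_ord_recr/= {}IH hornerXsubC ffactnSr natrM.
  have [kn|nk] := leqP k n; first by rewrite natrB.
  by rewrite ffact_small// !mul0r.
by rewrite -bin_ffact natrM mulrC mulfK// pnatr_eq0 -lt0n fact_gt0.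
Qed.

Lemma cmod_binpoly_le k (N : R) z : k%:R <= N -> cmod z <= N ->
  cmod (binpoly k).[z] <= (2 * N) ^+ k / k`!%:R.
Proof.
move=> kN zN; rewrite hornerZ cmodM cmodV cmod_nat mulrC ler_wpM2r ?invr_ge0//.
rewrite horner_prod cmod_prod.
suff aux j : (j <= k)%N ->
  \prod_(i < j) cmod ('X - (i%:R)%:P).[z] <= (2 * N) ^+ j by exact: aux.
elim: j => [|j IH] jk; first by rewrite big_ord0.
rewrite big_ord_recr/= exprSr ler_pM ?cmod_ge0 ?IH// 1?ltnW//.
  by apply: prodr_ge0 => i _; exact: cmod_ge0.
rewrite hornerXsubC (le_trans (cmod_triangleB _ _))// cmod_nat.
have : j%:R <= k%:R :> R by rewrite ler_nat ltnW.
lra.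
Qed.

(** Newton's forward series: [D k] is the [k]-th difference at 0 of the interpolated sequence. *)
Definition newton (N : nat) (D : nat -> C) : {poly C} :=
  \sum_(k < N.+1) D k *: binpoly k.

Lemma size_newton N D : (size (newton N D) <= N.+1)%N.
Proof.
apply: (leq_trans (size_sum _ _ _)); apply/bigmax_leqP => k _.
by rewrite (leq_trans (size_scale_leq _ _))// (leq_trans (size_binpoly _)).
Qed.

Lemma horner_newton_nat N D n : (n <= N)%N ->
  (newton N D).[n%:R] = \sum_(k < n.+1) D k * 'C(n, k)%:R.
Proof.
move=> nN; rewrite horner_sum (big_ord_widen_cond N.+1 xpredT (fun k => D k * 'C(n, k)%:R))//.
rewrite [RHS]big_mkcond/=; apply: eq_bigr => k _.
rewrite hornerZ horner_binpoly_nat; case: ifPn => //.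
by rewrite -leqNgt => nk; rewrite bin_small// mulr0.
Qed.

Lemma cmod_newton_le N D z : cmod z <= N%:R ->
  cmod (newton N D).[z] <= \sum_(k < N.+1) cmod (D k) * ((2 * N%:R) ^+ k / k`!%:R).
Proof.
move=> zN; rewrite horner_sum (le_trans (cmod_sum _ _ _))//.
apply: ler_sum => k _; rewrite hornerZ cmodM ler_wpM2l ?cmod_ge0//.
by apply: cmod_binpoly_le => //; rewrite ler_nat -ltnS.
Qed.

(** The bounds on [alpha], which varies with [N], make a fixed power of [alpha] or of its inverse at
    most polynomial in [N]. *)
Definition interpolates (om : nat -> C) (c0 eta : R) (N : nat) (alpha : C)
    (h : {poly C}) :=
  [/\ (size h <= N.+1)%N, c0 <= cmod alpha, cmod alpha <= N%:R ^+ 3,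
      forall n, (n <= N)%N -> h.[n%:R] * alpha ^+ n = om n
    & forall z, cmod z <= N%:R -> cmod h.[z] <= expR (eta * N%:R)].

(** If [g k] are the twisted coefficients, the differences of [om n / alpha ^+ n] are
    [k! * g k / alpha ^+ k]. The factors of [binpoly k] are at most [2 * N] on the disk, and
    [4 * N <= c0 * r] makes the [k]-th term at most [B / 2 ^+ k]. *)
Lemma newton_interpolates (om : nat -> C) (c0 eta r : R) (N : nat) (alpha : C) (B : R) :
  0 < r -> 0 < c0 -> c0 <= cmod alpha -> cmod alpha <= N%:R ^+ 3 ->
  4 * N%:R <= c0 * r -> N%:R <= r -> 2 * B <= expR (eta * N%:R) ->
  (forall k, k%:R <= r ->
     cmod (exp_twist (fun n => om n / n`!%:R) alpha k) * r ^+ k <= B) ->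
  exists h, interpolates om c0 eta N alpha h.
Proof.
move=> r0 c00 c0a aN Nr Nr' BN tB.
have a0 : 0 < cmod alpha by exact: lt_le_trans c0a.
have an0 : alpha != 0 by rewrite -cmod_gt0.
pose D k := k`!%:R * exp_twist (fun n => om n / n`!%:R) alpha k / alpha ^+ k.
have f0 (K : numFieldType) m : m`!%:R != 0 :> K by rewrite pnatr_eq0 -lt0n fact_gt0.
exists (newton N D); split => //.
- exact: size_newton.
- move=> n nN; rewrite horner_newton_nat//.
  have := exp_twistK (fun n => om n / n`!%:R) alpha n => /(congr1 ( *%R^~ n`!%:R)).
  rewrite divfK// => <-; rewrite !mulr_suml; apply: eq_bigr => k _.
  have kn : (k <= n)%N by rewrite -ltnS.
  have aE : alpha ^+ n = alpha ^+ (n - k) * alpha ^+ k by rewrite -exprD subnK.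
  have fE : n`!%:R = 'C(n, k)%:R * (k`!%:R * (n - k)`!%:R) :> C.
    by rewrite -!natrM bin_fact.
  rewrite /D aE fE.
  by field; rewrite expf_neq0// f0.
- move=> z zN; rewrite (le_trans (cmod_newton_le _ zN))// (le_trans _ BN)//.
  have B0 : 0 <= B.
    have := tB 0%N (ltW r0); apply: le_trans.
    by rewrite mulr_ge0 ?cmod_ge0// exprn_ge0// ltW.
  apply: (@le_trans _ _ (\sum_(k < N.+1) B * 2^-1 ^+ k)); last first.
    by rewrite -mulr_sumr mulrC ler_wpM2r// sum_halves_le2.
  apply: ler_sum => k _.
  have kr : k%:R <= r by rewrite (le_trans _ Nr')// ler_nat -ltnS.
  have := tB k kr; set g := exp_twist _ _ _ => hg.
  have rk : 0 < r ^+ k by rewrite exprn_gt0.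
  have ak : 0 < cmod alpha ^+ k by rewrite exprn_gt0.
  rewrite /D -/g !cmodM cmodV cmodX cmod_nat.
  have -> : k`!%:R * cmod g / cmod alpha ^+ k * ((2 * N%:R) ^+ k / k`!%:R) =
     (cmod g * r ^+ k) * (2 * N%:R / (cmod alpha * r)) ^+ k.
    rewrite [in RHS]exprMn exprVn (exprMn _ (cmod alpha)).
    by field; rewrite !gt_eqF//= ltr0n fact_gt0.
  rewrite ler_pM ?mulr_ge0 ?cmod_ge0 ?exprn_ge0 ?divr_ge0 ?mulr_ge0 ?cmod_ge0 ?(ltW r0)//.
  rewrite lerXn2r ?nnegrE ?divr_ge0 ?mulr_ge0 ?cmod_ge0 ?(ltW r0)//.
  rewrite ler_pdivrMr ?mulr_gt0//.
  have : c0 * r <= cmod alpha * r by rewrite ler_pM2r.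
  lra.
Qed.

Definition unimodular_density_ge (delta : R) (om : nat -> C) :=
  exists N0, forall N, (N0 <= N)%N ->
  delta * N%:R <= (\sum_(1 <= n < N.+1) (cmod (om n) == 1)%R)%N%:R.

Lemma unimodular_density_le1 (delta : R) (om : nat -> C) :
  unimodular_density_ge delta om -> delta <= 1.
Proof.
move=> [N0 /(_ N0.+1 (leqnSn _))].
rewrite -ler_pdivlMr ?ltr0n// => /le_trans; apply.
rewrite ler_pdivrMr ?ltr0n// mul1r ler_nat.
rewrite (@leq_trans (\sum_(1 <= n < N0.+2) 1)%N)//.
  by apply: leq_sum => n _; exact: leq_b1.
by rewrite sum_nat_const_nat muln1 subn1.
Qed.

Lemma sum_nat_lt_le (x : R) N : 0 <= x ->
  (\sum_(1 <= n < N.+1) (n%:R < x)%R)%N%:R <= x.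
Proof.
move=> x0; suff : (\sum_(1 <= n < N.+1) (n%:R < x)%R)%N%:R <= x /\
  (\sum_(1 <= n < N.+1) (n%:R < x)%R <= N)%N by case.
elim: N => [|N [IH1 IH2]]; first by rewrite big_geq.
rewrite big_nat_recr//=; case: (ltP N.+1%:R x) => Nx.
  have h : (\sum_(1 <= n < N.+1) (n%:R < x)%R + 1 <= N.+1)%N by rewrite addn1.
  by split => //; rewrite (le_trans _ (ltW Nx))// ler_nat.
by rewrite addn0; split => //; rewrite ltnW.
Qed.

Lemma unimodular_point (delta : R) (om : nat -> C) : 0 < delta ->
  unimodular_density_ge delta om ->
  exists r1, forall r, r1 <= r -> exists n,
  [/\ cmod (om n) = 1, delta * r / 8 <= n%:R & n%:R <= r / 4].
Proof.
move=> d0 [N0 dN]; exists (4 * N0%:R + 9) => r hr.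
have N0' : 0 <= N0%:R :> R by exact: ler0n.
have r40 : 0 <= r / 4 by lra.
pose N := Num.truncn (r / 4).
have /andP[Nr rN] := truncn_itv r40.
have N0N : (N0 <= N)%N.
  rewrite -ltnS -(ltr_nat R); apply: le_lt_trans rN; lra.
apply: contrapT => hn.
have := dN N N0N.
have le : (\sum_(1 <= n < N.+1) (cmod (om n) == 1)%R <=
    \sum_(1 <= n < N.+1) (n%:R < delta * r / 8)%R)%N.
  rewrite big_nat [leqRHS]big_nat; apply: leq_sum => n /andP[_ nN]; case: eqP => // on.
  rewrite lt0b ltNge; apply/negP => dn; apply: hn.
  by exists n; split => //; rewrite (le_trans _ Nr)// ler_nat -ltnS.
have x0 : 0 <= delta * r / 8 by rewrite divr_ge0// mulr_ge0 ?(ltW d0)//; lra.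
have := sum_nat_lt_le N x0; rewrite -(ler_nat R) in le.
have rN' : r / 4 < N%:R + 1 by rewrite natr1.
move=> h1 h2; have : delta * N%:R <= delta * (r / 8) by lra.
rewrite ler_pM2l//; lra.
Qed.

Lemma interpolates_exist (c0 eta1 : R) : 0 < c0 -> 0 < eta1 ->
  exists eta, 0 < eta /\ forall om,
  unimodular_density_ge (16 * c0) om ->
  (forall r0, exists r (alpha : C), [/\ r0 <= r, 0 < r, cmod alpha <= r ^+ 2 &
    forall k, k%:R <= r ->
    cmod (exp_twist (fun n => om n / n`!%:R) alpha k) * r ^+ k <= expR (eta * r)]) ->
  forall N0, exists N alpha h, (N0 <= N)%N /\
    interpolates om c0 eta1 N alpha h.
Proof.
move=> c00 eta10; pose eta := Num.min c0 (eta1 * c0 / 16).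
exists eta; split; first by rewrite lt_min c00 divr_gt0// mulr_gt0.
have etac0 : eta <= c0 by rewrite ge_min lexx.
have etac1 : eta <= eta1 * c0 / 16 by rewrite ge_min lexx orbT.
clearbody eta; move=> om dom hr N0.
have c160 : 0 < 16 * c0 by rewrite mulr_gt0.
have [r1 hr1] := unimodular_point c160 dom.
(* A lower bound for [N]: the third term turns [r ^+ 2] into at most [N ^+ 3], the last one absorbs
   the factor 2 of the Newton bound. *)
pose K := 1 + N0%:R + 64 / c0 ^+ 2 + 2 / eta1.
have N00 : 0 <= N0%:R :> R by exact: ler0n.
have K1 : 0 < 64 / c0 ^+ 2 by rewrite divr_gt0// exprn_gt0.
have K2 : 0 < 2 / eta1 by rewrite divr_gt0.
have [r [alpha [rr r0 ar tw]]] := hr (Num.max r1 (8 / c0 * K)).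
move: rr; rewrite ge_max => /andP[r1r].
rewrite mulrAC ler_pdivrMr// => Kr.
have [n [on nr1 nr2]] := hr1 r r1r.
have c0r0 : 0 <= c0 * r / 4 by rewrite divr_ge0// mulr_ge0// ltW.
pose N := Num.truncn (c0 * r / 4).
have /andP[Nr rN'] := truncn_itv c0r0; rewrite -/N in Nr rN'.
have rN : c0 * r / 4 < N%:R + 1 by rewrite natr1.
have KE : K = 1 + N0%:R + 64 / c0 ^+ 2 + 2 / eta1 by [].
clearbody K.
have NK : K <= N%:R by move: Kr rN KE K1 K2 N00; clear; lra.
have Ncr : c0 * r <= 8 * N%:R by move: Kr rN KE K1 K2 N00; clear; lra.
have N1 : 0 < N%:R :> R by move: NK KE K1 K2 N00; clear; lra.
have K3 : 64 / c0 ^+ 2 <= N%:R by move: NK KE K1 K2 N00; clear; lra.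
have K4 : 2 / eta1 <= N%:R by move: NK KE K1 K2 N00; clear; lra.
(* Here [n] is at least [2 * c0 * r] and at most [r / 4], so [r ^+ n / n!] is at least [4 ^+ n],
   hence at least [expR n]. It is at most [expR ((eta + |alpha|) * r)], so
   [|alpha| >= 2 * c0 - eta >= c0]. *)
have c0a : c0 <= cmod alpha.
  have f0 : 0 < n`!%:R :> R by rewrite ltr0n fact_gt0.
  have hk k : (k <= n)%N ->
      cmod (exp_twist (fun n => om n / n`!%:R) alpha k) * r ^+ k <= expR (eta * r).
    move=> kn; apply: tw; rewrite (@le_trans _ _ n%:R)// ?ler_nat//; move: nr2 r0; clear; lra.
  have := coef_bound_of_twist r0 hk.
  rewrite cmodM cmodV cmod_nat on mul1r -expRD => h.
  have fn : n`!%:R <= (n%:R : R) ^+ n.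
    rewrite -natrX ler_nat; elim: (n) => // m IH.
    rewrite factS expnS leq_mul2l /= (leq_trans IH)//.
    by case: m {IH} => // m; rewrite leq_exp2r.
  have h4 : 4 ^+ n <= expR (eta * r + cmod alpha * r).
    apply: le_trans h; rewrite mulrC ler_pdivlMr//.
    apply: (@le_trans _ _ (4 ^+ n * (r / 4) ^+ n)).
      rewrite ler_wpM2l ?exprn_ge0// (le_trans fn)// lerXn2r ?nnegrE//.
      by rewrite divr_ge0// ltW.
    by rewrite -exprMn mulrCA divff ?mulr1.
  have h5 : expR n%:R <= (4 : R) ^+ n.
    rewrite -[n%:R]mulr1 expRM_natl lerXn2r ?nnegrE ?expR_ge0//.
    have -> : (1 : R) = 2%:R * 2^-1 by rewrite divff.
    rewrite expRM_natl; have := expR_half_le2 R; have := expR_ge0 (2^-1 : R).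
    by move: (expR _) => e e0 e2; rewrite expr2; nra.
  have := le_trans h5 h4; rewrite ler_expR -mulrDl => h6.
  have : (2 * c0) * r <= (eta + cmod alpha) * r by lra.
  rewrite ler_pM2r//; move: etac0; clear; lra.
have aN : cmod alpha <= N%:R ^+ 3.
  rewrite (le_trans ar)//.
  apply: (@le_trans _ _ (64 / c0 ^+ 2 * N%:R ^+ 2)).
    rewrite mulrAC ler_pdivlMr ?exprn_gt0// -exprMn mulrC.
    have -> : 64 * N%:R ^+ 2 = (8 * N%:R) ^+ 2 :> R by rewrite exprMn; congr (_ * _); ring.
    by rewrite lerXn2r ?nnegrE ?mulr_ge0// ltW.
  by rewrite [_ ^+ 3]exprS ler_wpM2r ?exprn_ge0.
have Nr' : 4 * N%:R <= c0 * r by move: Nr; clear; lra.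
have c01 : c0 <= 1.
  by have := unimodular_density_le1 dom; move: c00; clear; lra.
have Nr2 : N%:R <= r.
  have : c0 * r <= 1 * r by rewrite ler_wpM2r// ltW.
  by move: Nr' N1; clear; lra.
have BN : 2 * expR (eta * r) <= expR (eta1 * N%:R).
  have -> : eta1 * N%:R = eta1 * N%:R / 2 + eta1 * N%:R / 2 by clear; lra.
  rewrite expRD ler_pM ?expR_ge0//.
    rewrite (le_trans _ (expR_ge1Dx _))//.
    by move: K4; rewrite ler_pdivrMr//; clear; lra.
  rewrite ler_expR.
  have : eta * r <= eta1 * c0 / 16 * r by rewrite ler_wpM2r// ltW.
  have : eta1 * (c0 * r) <= eta1 * (8 * N%:R) by rewrite ler_wpM2l// ltW.
  clear; lra.
have [h hh] := newton_interpolates r0 c00 c0a aN Nr' Nr2 BN tw.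
exists N, alpha, h; split => //.
by rewrite -(ler_nat R); move: NK KE K1 K2; clear; lra.
Qed.

End NewtonInterpolation.

(** * Periodicity of the moduli *)

Section Periodicity.
Variable R : realType.
Local Notation C := R[i].
Implicit Types (h : {poly C}) (om : nat -> C).

Definition modpoly h : {poly C} := h * map_poly conjc h.

Lemma horner_modpoly h z : (modpoly h).[z] = h.[z] * (h.[z^*])^*.
Proof. by rewrite /modpoly hornerM -{2}[z]conjcK horner_map. Qed.

Lemma modpoly_nat h n : (modpoly h).[n%:R] = (cmod h.[n%:R] ^+ 2)%:C.
Proof.
have E : (n%:R : C)^* = n%:R by exact: conjc_nat.
by rewrite horner_modpoly E cmod_sqr.
Qed.

Lemma cmod_modpoly_le h (rho B : R) :
  (forall z, cmod z <= rho -> cmod h.[z] <= B) ->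
  forall z, cmod z <= rho -> cmod (modpoly h).[z] <= B ^+ 2.
Proof.
move=> hB z zr; rewrite horner_modpoly cmodM cmod_conj expr2.
by rewrite ler_pM ?cmod_ge0 ?hB// cmod_conj.
Qed.

Lemma interpolates_modpoly om c0 eta N alpha h n : 0 < c0 ->
  interpolates om c0 eta N alpha h -> (n <= N)%N ->
  (modpoly h).[n%:R] = (cmod (om n) ^+ 2 * (cmod alpha ^- 2) ^+ n)%:C.
Proof.
move=> c00 [_ c0a _ hom _] nN; rewrite modpoly_nat -(hom n nN) cmodM cmodX.
congr (_%:C).
have a0 : cmod alpha != 0 by rewrite gt_eqF// (lt_le_trans c00).
by rewrite exprMn -!exprM mulnC -mulrA exprVn -exprM mulfV ?mulr1// expf_neq0.
Qed.

(** In a window this short every member except the last has another member at most [L] further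
    on. *)
Lemma window_pairs (x : nat -> bool) (L l a : nat) : (l <= L.+1)%N ->
  (\sum_(i < l) x (a + i) <=
   1 + \sum_(i < l) \sum_(1 <= t < L.+1) (x (a + i) && x (a + i + t)))%N.
Proof.
elim: l a => [|l IH] a lL; first by rewrite !big_ord0.
rewrite !big_ord_recl /= addn0.
have E (f : nat -> nat) : (\sum_(i < l) f (a + bump 0 i) = \sum_(i < l) f (a.+1 + i))%N.
  by apply: eq_bigr => i _; rewrite /bump add1n addSnnS.
rewrite (E (fun n => x n : nat)) (E (fun n => \sum_(1 <= t < L.+1) (x n && x (n + t)))%N).
have {}IH := IH a.+1 (ltnW lL).
case xa : (x a); last by rewrite add0n (leq_trans IH)// leq_add2l leq_addl.
have [/existsP[i xi]|/existsPn nx] := boolP [exists i : 'I_l, x (a.+1 + i)%N]; last first.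
  by rewrite [X in (_ + X <= _)%N]big1 => [|i _]; rewrite ?leq_addr// (negbTE (nx i)).
suff h : (1 <= \sum_(1 <= t < L.+1) (true && x (a + t)))%N.
  by rewrite (addnCA 1); exact: leq_add h IH.
rewrite (big_cat_nat _ (n := i.+1))//=; last first.
  by rewrite (leq_trans (ltn_ord i))// ltnW.
rewrite [X in (_ + X)%N]big_ltn; last by rewrite (leq_ltn_trans (ltn_ord i)).
by rewrite -addSnnS xi addnCA leq_addr.
Qed.

Lemma block_pairs (x : nat -> bool) (L B : nat) :
  (\sum_(0 <= n < B * L) x n <=
   B + \sum_(0 <= n < B * L) \sum_(1 <= t < L.+1) (x n && x (n + t)))%N.
Proof.
elim: B => [|B IH]; first by rewrite mul0n !big_geq.
have le : (B * L <= B.+1 * L)%N by rewrite leq_mul2r leqnSn orbT.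
rewrite !(@big_cat_nat _ _ _ (B * L) 0 (B.+1 * L))//=.
have E (f : nat -> nat) : (\sum_(B * L <= i < B.+1 * L) f i =
    \sum_(i < L) f (B * L + i))%N.
  rewrite -{1}[(B * L)%N]add0n big_addn mulSn addnK big_mkord.
  by apply: eq_bigr => i _; rewrite addnC.
rewrite (E (fun n => x n : nat)) (E (fun n => \sum_(1 <= t < L.+1) (x n && x (n + t)))%N).
rewrite -addn1 addnACA leq_add//.
exact: window_pairs.
Qed.

Definition pair_seq om (M t : nat) : seq nat :=
  [seq n <- iota 0 M | (cmod (om n) == 1)%R && (cmod (om (n + t)%N) == 1)%R].

(** Cut an initial interval into [B] windows of length [L]. Since [delta * L >= 8], it has more than
    [2 * B] unimodular indices, hence more than [B] pairs, and some shift [t] accounts for at least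
    [B / L] of them. The condition on [M] puts the pairs in the disk of radius [N / 10]. *)
Lemma pairs_exist (delta : R) : 0 < delta -> exists L (delta1 : R), [/\ (0 < L)%N, 0 < delta1 &
  forall om, unimodular_density_ge delta om -> exists N1, forall N, (N1 <= N)%N ->
  exists t M, [/\ (0 < t <= L)%N, (10 * M <= N)%N &
     delta1 * N%:R <= (size (pair_seq om M t))%:R]].
Proof.
move=> d0; pose L := (Num.truncn (8 / delta)).+1.
have L0 : 0 < L%:R :> R by rewrite ltr0n.
have dL : 8 <= delta * L%:R.
  by rewrite mulrC -ler_pdivrMr// ltW// truncnS_gt.
clearbody L.
exists L, (20 * L%:R ^+ 2)^-1; split; first by rewrite -(ltr_nat R).
  by rewrite invr_gt0 mulr_gt0// exprn_gt0.
move=> om dom; have d1 := unimodular_density_le1 dom.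
have Lpos : (0 < L)%N by rewrite -(ltr_nat R).
have [N0 dN] := dom.
exists (20 * L * N0.+2)%N => N N1N.
pose B := (N %/ (10 * L))%N.
have BN : (N < B.+1 * (10 * L))%N by rewrite ltn_ceil// muln_gt0.
have BN' : (B * (10 * L) <= N)%N by rewrite leq_divM.
have B1 : (N0.+2 <= B)%N.
  rewrite leq_divRL ?muln_gt0//; apply: leq_trans N1N; rewrite mulnC leq_mul2r.
  by rewrite leq_mul2r orbT.
clearbody B.
pose x n := (cmod (om n) == 1)%R.
have hx : delta * (B%:R * L%:R - 1) <= (\sum_(0 <= n < B * L) x n)%N%:R.
  have BL0 : (0 < B * L)%N by rewrite muln_gt0 (leq_trans _ B1).
  have N0B : (N0 <= (B * L).-1)%N.
    rewrite -ltnS prednK// (leq_trans (ltnW B1))// leq_pmulr//.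
  have := dN _ N0B; rewrite prednK// => h.
  have E1 : (B * L).-1%:R = B%:R * L%:R - 1 :> R.
    by rewrite -natrM -[in RHS](prednK BL0) -natr1 addrK.
  by rewrite -E1 (le_trans h)// ler_nat (big_ltn BL0) leq_addl.
have hb := block_pairs x L B.
rewrite exchange_big/= in hb.
have [t tL tP] : exists2 t, (0 < t <= L)%N &
   (B <= L * \sum_(0 <= n < B * L) (x n && x (n + t)))%N.
  apply: contrapT => hn.
  have lt : (\sum_(1 <= t < L.+1) \sum_(0 <= n < B * L) (x n && x (n + t)) <= B)%N.
    rewrite -(leq_pmul2l Lpos) big_distrr/=.
    rewrite (@leq_trans (\sum_(1 <= t < L.+1) B)%N)//.
      rewrite big_nat [leqRHS]big_nat; apply: leq_sum => t /andP[t0 tL].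
      rewrite leqNgt; apply/negP => /ltnW tP; apply: hn; exists t => //.
      by rewrite t0 -ltnS.
    by rewrite sum_nat_const_nat subn1.
  have : (\sum_(0 <= n < B * L) x n <= 2 * B)%N.
    by rewrite (leq_trans hb)// mul2n -addnn leq_add2l.
  rewrite -(ler_nat R) natrM; have : 2 <= B%:R :> R by rewrite ler_nat (leq_trans _ B1).
  have : delta * L%:R * B%:R >= 8 * B%:R by rewrite ler_wpM2r.
  by move: hx d1; clear; lra.
exists t, (B * L)%N; split => //; first by rewrite mulnCA.
have szE : size (pair_seq om (B * L) t) = (\sum_(0 <= n < B * L) (x n && x (n + t)))%N.
  rewrite size_filter -sum1_count big_mkcond/= /index_iota subn0.
  by apply: eq_bigr => n _; rewrite /x; case: ifP.
rewrite szE; move: tP; set P := (\sum_(_ <= _ < _) _)%N => tP.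
rewrite mulrC ler_pdivrMr ?mulr_gt0 ?exprn_gt0//.
have h1 : N%:R <= 20 * (B%:R * L%:R) :> R.
  rewrite -!natrM ler_nat; move: BN B1 Lpos; clear; nia.
rewrite (le_trans h1)// [leRHS]mulrCA ler_wpM2l//.
rewrite expr2 mulrA ler_pM2r// -natrM ler_nat mulnC//.
Qed.

Lemma horner_shift (f : {poly C}) (a z : C) : (f \Po ('X + a%:P)).[z] = f.[z + a].
Proof. by rewrite horner_comp !hornerE. Qed.

(** The Schwarz lemma with [rho = N / 10]; [4 * L <= N] keeps [z + t] within [N] on the circle of
    radius [N / 2]. The power of [cmod alpha] undoes the normalisation of [H] at [m]. *)
Lemma pair_estimate om c0 eta N alpha h t M L (K : R) :
  0 < c0 -> interpolates om c0 eta N alpha h -> (0 < t <= L)%N ->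
  (10 * M <= N)%N -> (4 * L <= N)%N -> (c0 ^- 2) ^+ t <= K ->
  forall m, (10 * m <= N)%N ->
  `|cmod (om (m + t)%N) ^+ 2 - cmod (om m) ^+ 2| <=
  (cmod alpha ^+ 2) ^+ (m + t) *
    (2 * ((1 + K) * expR (eta * N%:R) ^+ 2) / 2 ^+ size (pair_seq om M t)).
Proof.
move=> c00 hI /andP[t0 tL] MN LN tK m mN.
have [_ c0a _ _ hB] := hI.
have a0 : 0 < cmod alpha by exact: lt_le_trans c0a.
have N0 : (0 < N)%N by move: t0 tL LN; clear; lia.
set u := cmod alpha ^- 2.
have u0 : 0 < u by rewrite invr_gt0 exprn_gt0.
have uK : u ^+ t <= K.
  apply: le_trans tK; rewrite lerXn2r ?nnegrE ?invr_ge0 ?exprn_ge0 ?(ltW c00) ?(ltW a0)//.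
  rewrite lef_pV2 ?posrE ?exprn_gt0// lerXn2r ?nnegrE// ltW//.
pose p := modpoly h.
pose H := p \Po ('X + (t%:R)%:P) - (u ^+ t)%:C *: p.
have HE n : (n + t <= N)%N -> H.[n%:R] =
    ((cmod (om (n + t)%N) ^+ 2 - cmod (om n) ^+ 2) * u ^+ (n + t))%:C.
  move=> ntN; rewrite /H hornerD hornerN hornerZ horner_shift -natrD.
  rewrite /p !(interpolates_modpoly c00 hI)//; last exact: leq_trans (leq_addr _ _) ntN.
  by rewrite -rmorphM -rmorphB/=; congr (_%:C); rewrite -/u exprD; ring.
pose xs := [seq (n%:R : C) | n <- pair_seq om M t].
have uxs : uniq xs.
  rewrite map_inj_uniq ?filter_uniq ?iota_uniq//.
  by move=> i j /eqP; rewrite eqr_nat => /eqP.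
have rho0 : 0 < N%:R / 10 :> R by rewrite divr_gt0// ltr0n.
have xsP x : x \in xs -> root H x /\ cmod x <= N%:R / 10.
  move=> /mapP[n]; rewrite mem_filter mem_iota add0n => /andP[/andP[/eqP o1 /eqP o2] nM] ->.
  split.
    rewrite /root HE; last by move: nM MN tL LN; clear; lia.
    by rewrite o1 o2 subrr mul0r.
  by rewrite cmod_nat ler_pdivlMr// -natrM ler_nat; move: nM MN; clear; lia.
have HB z : cmod z = 5 * (N%:R / 10) -> cmod H.[z] <= (1 + K) * expR (eta * N%:R) ^+ 2.
  move=> zN; rewrite /H hornerD hornerN hornerZ horner_shift.
  have pB := cmod_modpoly_le hB.
  have tN : t%:R <= N%:R / 4 :> R.
    by rewrite ler_pdivlMr// -natrM ler_nat; move: tL LN; clear; lia.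
  have N0' : 0 <= N%:R :> R by [].
  rewrite (le_trans (cmod_triangleB _ _))// mulrDl mul1r lerD//.
    apply: pB; rewrite (le_trans (cmod_triangle _ _))// cmod_nat zN.
    by move: tN N0'; clear; lra.
  rewrite cmodM cmod_real ger0_norm ?exprn_ge0 ?(ltW u0)//.
  rewrite ler_pM ?cmod_ge0 ?exprn_ge0 ?(ltW u0)//.
  by apply: pB; rewrite zN; move: N0'; clear; lra.
have mle : cmod (m%:R : C) <= N%:R / 10.
  by rewrite cmod_nat ler_pdivlMr// -natrM ler_nat mulnC.
have := poly_small_of_many_zeros rho0 uxs xsP HB mle.
rewrite HE; last by move: mN tL LN; clear; lia.
rewrite cmod_real normrM size_map [`|u ^+ _|]ger0_norm ?exprn_ge0 ?(ltW u0)// => hle.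
have ua : u ^+ (m + t) * (cmod alpha ^+ 2) ^+ (m + t) = 1.
  by rewrite -exprMn mulVf ?expr1n// gt_eqF// exprn_gt0.
have -> : `|cmod (om (m + t)%N) ^+ 2 - cmod (om m) ^+ 2| =
    `|cmod (om (m + t)%N) ^+ 2 - cmod (om m) ^+ 2| * u ^+ (m + t) *
    (cmod alpha ^+ 2) ^+ (m + t) by rewrite -mulrA ua mulr1.
by rewrite [leRHS]mulrC ler_wpM2r// exprn_ge0// exprn_ge0// ltW.
Qed.

(** The shift supplied by [pairs_exist] varies with [N], so the contradiction needs one gap [e] and
    one range [mu] valid for all shifts up to [L]. *)
Lemma differences_lower_bound (f : nat -> R) L :
  (forall t, (0 < t <= L)%N -> exists m, f (m + t)%N != f m) ->
  exists (e : R) mu, 0 < e /\ forall t, (0 < t <= L)%N ->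
  exists2 m, (m <= mu)%N & e <= `|f (m + t)%N - f m|.
Proof.
elim: L => [|L IH] hL.
  by exists 1, 0%N; split => // t; rewrite leqn0; case: t.
have [|e [mu [e0 hmu]]] := IH.
  by move=> t /andP[t0 tL]; apply: hL; rewrite t0 leqW.
have [m hm] := hL L.+1 (leqnn _).
exists (Num.min e `|f (m + L.+1)%N - f m|), (maxn mu m); split.
  by rewrite lt_min e0 normr_gt0 subr_eq0.
move=> t /andP[t0]; rewrite leq_eqVlt => /orP[/eqP ->|tL].
  by exists m; [exact: leq_maxr|rewrite ge_min lexx orbT].
have [|m' m'mu hm'] := hmu t; first by rewrite t0.
by exists m'; [rewrite leq_max m'mu|rewrite ge_min hm'].
Qed.

Lemma eventually_periodic_modulus om c0 eta delta1 L : 0 < c0 -> 0 < delta1 ->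
  8 * eta <= delta1 ->
  (exists N1, forall N, (N1 <= N)%N ->
   exists t M, [/\ (0 < t <= L)%N, (10 * M <= N)%N &
     delta1 * N%:R <= (size (pair_seq om M t))%:R]) ->
  (forall N0, exists N alpha h, (N0 <= N)%N /\ interpolates om c0 eta N alpha h) ->
  exists2 t, (0 < t <= L)%N & forall m, cmod (om (m + t)%N) = cmod (om m).
Proof.
move=> c00 d10 etad [N1 hpairs] hN; apply: contrapT => hn.
have [|e [mu [e0 hmu]]] := @differences_lower_bound (fun n => cmod (om n) ^+ 2) L.
  move=> t tL; apply: contrapT => hm; apply: hn; exists t => // m.
  apply/eqP; rewrite -(@eqrXn2 _ 2) ?cmod_ge0//.
  by apply: contrapT => /negP hm'; apply: hm; exists m.
pose K := Num.max 1 (c0 ^- 2) ^+ L.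
have K0 : 0 <= K by rewrite exprn_ge0// le_max ler01.
have tK t : (t <= L)%N -> (c0 ^- 2) ^+ t <= K.
  move=> tL; rewrite (@le_trans _ _ (Num.max 1 (c0 ^- 2) ^+ t))//.
    rewrite lerXn2r ?nnegrE ?invr_ge0 ?exprn_ge0 ?(ltW c00)//.
    by rewrite le_max ler01.
    by rewrite le_max lexx orbT.
  by rewrite ler_weXn2l// le_max lexx.
clearbody K.
have d14 : 0 < delta1 / 4 by rewrite divr_gt0.
(* The exponent comes from [|alpha| <= N ^+ 3] raised to the power [2 * (m + t)]. The rate
   [delta1 / 4] is what the growth [2 * eta <= delta1 / 4] leaves of the gain [delta1 / 2] due to
   the zeros. *)
have [r0 [r00 hr0]] := expR_eventually_ge (6 * (mu + L)) (2 * (1 + K) / e * 2) d14.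
have [N [alpha [h [NN hI]]]] :=
  hN (maxn N1 (maxn (10 * mu + 4 * L + 1) (Num.truncn r0).+1)).
move: NN; rewrite !geq_max => /and3P[N1N muN rN].
have [t [M [tL MN sz]]] := hpairs N N1N.
have [m mmu em] := hmu t tL.
have /andP[t0 tL'] := tL.
have LN : (4 * L <= N)%N by move: muN; clear; lia.
have mN : (10 * m <= N)%N by move: muN mmu; clear; lia.
have := pair_estimate c00 hI tL MN LN (tK t tL') mN.
have [_ _ aN _ _] := hI.
have N1' : 1 <= N%:R :> R by rewrite ler1n; move: muN; clear; lia.
have aE : (cmod alpha ^+ 2) ^+ (m + t) <= N%:R ^+ (6 * (mu + L)).
  rewrite -exprM (@le_trans _ _ ((N%:R ^+ 3) ^+ (2 * (m + t))))//.
    by rewrite lerXn2r ?nnegrE ?cmod_ge0 ?exprn_ge0.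
  by rewrite -exprM ler_weXn2l//; move: mmu tL'; clear; lia.
have sE : expR (delta1 * N%:R / 2) <= 2 ^+ size (pair_seq om M t).
  rewrite (@le_trans _ _ (expR ((size (pair_seq om M t))%:R * 2^-1)))//.
    by rewrite ler_expR ler_wpM2r.
  by rewrite expRM_natl lerXn2r ?nnegrE ?expR_ge0// expR_half_le2.
have rN' : r0 <= N%:R.
  by rewrite (le_trans (ltW (truncnS_gt r0)))// ler_nat.
have hexp := hr0 N%:R rN'.
move=> /(le_trans em); apply/negP; rewrite -ltNge.
set s := size _ in sE *.
have E2 : expR (eta * N%:R) ^+ 2 <= expR (delta1 * N%:R / 4).
  rewrite -expRM_natl ler_expR.
  have : 8 * eta * N%:R <= delta1 * N%:R by rewrite ler_wpM2r.
  by clear; lra.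
have D : expR (eta * N%:R) ^+ 2 / 2 ^+ s <= expR (- (delta1 / 4 * N%:R)).
  rewrite ler_pdivrMr ?exprn_gt0// (le_trans E2)//.
  rewrite -ler_pdivrMl ?expR_gt0// -expRN opprK -expRD (le_trans _ sE)//.
  by rewrite ler_expR; clear; lra.
apply: (@le_lt_trans _ _ (N%:R ^+ (6 * (mu + L)) * (2 * (1 + K) * expR (- (delta1 / 4 * N%:R))))).
  rewrite ler_pM ?exprn_ge0 ?cmod_ge0//.
    by rewrite divr_ge0 ?exprn_ge0// !mulr_ge0 ?addr_ge0 ?exprn_ge0 ?expR_ge0.
  have -> : 2 * ((1 + K) * expR (eta * N%:R) ^+ 2) / 2 ^+ s =
    2 * (1 + K) * (expR (eta * N%:R) ^+ 2 / 2 ^+ s) by rewrite !mulrA.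
  by rewrite ler_wpM2l// mulr_ge0// addr_ge0.
rewrite expRN mulrA ltr_pdivrMr ?expR_gt0//.
have e2 : 0 < e / 2 by rewrite divr_gt0.
apply: (@le_lt_trans _ _ (e / 2 * expR (delta1 / 4 * N%:R))); last first.
  by rewrite ltr_pM2r ?expR_gt0//; move: e0; clear; lra.
apply: le_trans (ler_wpM2l (ltW e2) hexp).
apply: eq_ler; field; rewrite gt_eqF//.
Qed.

End Periodicity.

(** * Rigidity of the coefficients *)

Section Rigidity.
Variable R : realType.
Local Notation C := R[i].
Implicit Types (f h : {poly C}) (om : nat -> C) (eta v : R) (t Q L N : nat).

Definition fwd_diff (t : nat) f : {poly C} := f \Po ('X + (t%:R)%:P) - f.

Lemma horner_fwd_diff t f z : (fwd_diff t f).[z] = f.[z + t%:R] - f.[z].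
Proof. by rewrite /fwd_diff hornerD hornerN horner_shift. Qed.

(** Taylor expansion at [z] without its constant term: by Cauchy's estimates at radius [delta] the
    terms decay with ratio [t / delta <= 1 / 2]. *)
Lemma fwd_diff_le f (t : nat) (delta rho B : R) : 0 < delta -> 2 * t%:R <= delta ->
  (forall z, cmod z <= rho -> cmod f.[z] <= B) ->
  forall z, cmod z <= rho - delta -> cmod (fwd_diff t f).[z] <= B * (2 * t%:R / delta).
Proof.
move=> d0 td fB z zr.
pose g := f \Po ('X + z%:P).
have gB w : cmod w = delta -> cmod g.[w] <= B.
  move=> wd; rewrite horner_shift; apply: fB.
  by rewrite (le_trans (cmod_triangle _ _))// wd; move: zr; clear; lra.
have g_coef := cauchy_poly d0 gB.
have t0 : 0 <= t%:R :> R by [].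
pose q : R := t%:R / delta.
have q0 : 0 <= q by rewrite divr_ge0// ltW.
have q2 : q <= 2^-1 by rewrite ler_pdivrMr//; move: td; clear; lra.
have B0 : 0 <= B.
  by have := g_coef 0%N; apply: le_trans; rewrite mulr_ge0 ?cmod_ge0// exprn_ge0// ltW.
have -> : (fwd_diff t f).[z] = (g - (g`_0)%:P).[t%:R].
  rewrite horner_fwd_diff hornerD hornerN hornerC -horner_coef0 !horner_shift.
  by rewrite add0r [t%:R + z]addrC.
rewrite (le_trans (cmod_horner_le _ _))//.
apply: (@le_trans _ _ (\sum_(k < size (g - (g`_0)%:P))
    (if k == 0%N :> nat then 0 else B * q ^+ k))).
  apply: ler_sum => k _; rewrite coefB coefC cmod_nat.
  case: ifP => [/eqP ->|k0]; first by rewrite subrr cmod0 mul0r.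
  have -> : B * q ^+ k = B / delta ^+ k * t%:R ^+ k by rewrite /q exprMn exprVn mulrAC mulrA.
  by rewrite subr0 ler_wpM2r ?exprn_ge0// ler_pdivlMr// exprn_gt0.
have qE : q = t%:R / delta by [].
clearbody q; case: (size _) => [|n]; first by rewrite big_ord0 mulr_ge0// divr_ge0 ?mulr_ge0// ltW.
rewrite big_ord_recl/= add0r.
have -> : B * (2 * t%:R / delta) = B * q * 2 by rewrite qE; ring.
apply: (@le_trans _ _ (\sum_(i < n) B * q * 2^-1 ^+ i)).
  apply: ler_sum => i _; rewrite /bump add1n exprS mulrA ler_wpM2l ?mulr_ge0//.
  by rewrite lerXn2r ?nnegrE.
by rewrite -mulr_sumr ler_wpM2l ?mulr_ge0// sum_halves_le2.
Qed.

(** Each difference spends [2 * t * Q] of the radius and gains a factor [Q], so a number of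
    differences proportional to [rho] is affordable. *)
Lemma iter_fwd_diff_le f (t Q : nat) (rho B : R) k : (0 < t)%N -> (0 < Q)%N ->
  (forall z, cmod z <= rho -> cmod f.[z] <= B) ->
  forall z, cmod z <= rho - k%:R * (2 * t%:R * Q%:R) ->
  cmod (iter k (fwd_diff t) f).[z] <= B / Q%:R ^+ k.
Proof.
move=> t0 Q0 fB; have Q0' : 0 < Q%:R :> R by rewrite ltr0n.
have t0' : 0 < t%:R :> R by rewrite ltr0n.
elim: k => [|k IH] z zr.
  by rewrite /= expr0 divr1; apply: fB; rewrite (le_trans zr)// mul0r subr0.
have -> : B / Q%:R ^+ k.+1 = B / Q%:R ^+ k * (2 * t%:R / (2 * t%:R * Q%:R)).
  by rewrite exprSr; field; rewrite expf_neq0 ?gt_eqF.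
rewrite /=; apply: fwd_diff_le IH _ _.
- by rewrite !mulr_gt0.
- by rewrite ler_peMr ?mulr_ge0// ler1n.
- by rewrite (le_trans zr)// -[k.+1%:R]natr1; move: (2 * _ * _) => x; lra.
Qed.

Lemma iter_fwd_diff_geometric f (c t N : nat) (a v : C) :
  (forall j, (c + t * j <= N)%N -> f.[(c + t * j)%:R] = a * v ^+ j) ->
  forall k j, (c + t * (j + k) <= N)%N ->
  (iter k (fwd_diff t) f).[(c + t * j)%:R] = a * v ^+ j * (v - 1) ^+ k.
Proof.
move=> fv; elim=> [|k IH] j jN.
  by rewrite /= expr0 mulr1 fv// -(addn0 j).
rewrite /= horner_fwd_diff -natrD.
have -> : (c + t * j + t = c + t * j.+1)%N by rewrite mulnS; lia.
rewrite !IH; first by rewrite !exprS; ring.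
  by rewrite (leq_trans _ jN)// leq_add2l leq_mul2l; apply/orP; right; lia.
by rewrite (leq_trans _ jN)// leq_add2l leq_mul2l; apply/orP; right; lia.
Qed.

Lemma dist1_expr_le (u : R) t : 0 <= u -> (0 < t)%N -> `|u - 1| <= `|u ^+ t - 1|.
Proof.
move=> u0; case: t => // t _; have [u1|u1] := leP 1 u.
  rewrite !ger0_norm ?subr_ge0 ?exprn_ege1// lerD2r exprS ler_peMr// exprn_ege1//.
have u1' := ltW u1.
rewrite !ler0_norm ?subr_le0 ?exprn_ile1// lerN2 lerD2r exprS ler_piMr//.
by rewrite exprn_ile1.
Qed.

Lemma expR1_le4 : expR (1 : R) <= 4.
Proof.
have -> : (1 : R) = 2%:R * 2^-1 by rewrite divff.
rewrite expRM_natl; have := expR_half_le2 R; have := expR_ge0 (2^-1 : R).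
by move: (expR _) => e e0 e2; rewrite expr2; nra.
Qed.

(** With [u = |alpha|^-2], the [k]-th difference at [c] equals [u^c (u^t - 1)^k] and is at most
    [exp (2 eta N) / Q^k], for [k] about [N / (2 t Q)]. If [|u^t - 1| > 4 / Q], then
    [exp k <= exp (2 eta N) |alpha|^(2c)]. But [2 eta N] is at most [N / (8 t Q)], and the last
    hypothesis absorbs [|alpha|^(2c) <= N^(6c)]. *)
Lemma base_near_one om c0 eta N alpha h c t Q : 0 < c0 ->
  interpolates om c0 eta N alpha h -> (0 < t)%N -> (8 <= Q)%N ->
  (forall k, cmod (om (c + t * k)%N) = 1) ->
  16 * t%:R * Q%:R * eta <= 1 -> (2 * c + 4 * t * Q <= N)%N ->
  8 * N%:R ^+ (6 * c) <= expR (N%:R / (8 * t%:R * Q%:R)) :> R ->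
  `|cmod alpha ^+ 2 - 1| <= 8 / Q%:R :> R.
Proof.
move=> c00 hI t0 Q8 om1 etaQ Nc hN.
have [_ c0a aN _ hB] := hI.
have Q0 : (0 < Q)%N by exact: leq_trans Q8.
have t0' : 0 < t%:R :> R by rewrite ltr0n.
have Q0' : 0 < Q%:R :> R by rewrite ltr0n.
have a0 : 0 < cmod alpha by exact: lt_le_trans c0a.
set v := cmod alpha ^+ 2; have v0 : 0 < v by rewrite exprn_gt0.
pose u := v^-1; have u0 : 0 < u by rewrite invr_gt0.
have pv j : (c + t * j <= N)%N ->
    (modpoly h).[(c + t * j)%:R] = (u ^+ c)%:C * (u ^+ t)%:C ^+ j.
  move=> jN; rewrite (interpolates_modpoly c00 hI jN) om1 expr1n mul1r -/v -/u.
  by rewrite -rmorphXn/= -rmorphM/= exprD exprM.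
pose k := ((N - c) %/ (2 * t * Q))%N.
have den0 : (0 < 2 * t * Q)%N by rewrite !muln_gt0 t0.
have kN : (k * (2 * t * Q) <= N - c)%N by exact: leq_divM.
have kN' : (N - c < k.+1 * (2 * t * Q))%N by exact: ltn_ceil.
have ckN : (c + t * (0 + k) <= N)%N.
  have : (t * k <= k * (2 * t * Q))%N.
    have -> : (2 * t * Q = t * (2 * Q))%N by rewrite [RHS]mulnCA mulnA.
    by rewrite mulnC leq_mul2l leq_pmulr ?orbT// muln_gt0.
  move: kN Nc; clear; lia.
have E := iter_fwd_diff_geometric pv ckN.
rewrite muln0 addn0 expr0 mulr1 in E.
have pB := cmod_modpoly_le hB.
have czr : cmod (c%:R : C) <= N%:R - k%:R * (2 * t%:R * Q%:R).
  rewrite cmod_nat lerBrDr -!natrM -natrD ler_nat.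
  move: kN Nc; clear; lia.
have := iter_fwd_diff_le t0 Q0 pB czr.
rewrite E -rmorphB/= -rmorphXn -rmorphM/= cmod_real normrM normrX.
rewrite ger0_norm ?exprn_ge0 ?(ltW u0)// => hk.
have yQ : `|u ^+ t - 1| <= 4 / Q%:R.
  rewrite leNgt; apply/negP; rewrite ltr_pdivrMr// => hy.
  have h4 : expR (k%:R) <= expR (eta * N%:R) ^+ 2 * v ^+ c.
    apply: (@le_trans _ _ ((`|u ^+ t - 1| * Q%:R) ^+ k)).
      rewrite -[k%:R]mulr1 expRM_natl lerXn2r ?nnegrE ?expR_ge0 ?mulr_ge0//.
      by rewrite (le_trans expR1_le4)// ltW.
    rewrite exprMn -ler_pdivlMr ?exprn_gt0// mulrAC.
    rewrite -ler_pdivrMr ?exprn_gt0// -exprVn -/u mulrC -normrX; exact: hk.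
  have h5 : v ^+ c <= N%:R ^+ (6 * c).
    rewrite -exprM (@le_trans _ _ ((N%:R ^+ 3) ^+ (2 * c)))//.
      by rewrite lerXn2r ?nnegrE ?cmod_ge0 ?exprn_ge0.
    by rewrite -exprM mulnA.
  have h6 : expR k%:R * 4 <= expR (eta * N%:R) ^+ 2 * expR (N%:R / (8 * t%:R * Q%:R)) / 2.
    apply: (@le_trans _ _ (expR (eta * N%:R) ^+ 2 * (8 * N%:R ^+ (6 * c)) / 2)).
      rewrite (le_trans (ler_wpM2r _ h4))//.
      have -> : expR (eta * N%:R) ^+ 2 * (8 * N%:R ^+ (6 * c)) / 2 =
        expR (eta * N%:R) ^+ 2 * N%:R ^+ (6 * c) * 4.
        by move: (_ ^+ 2) (N%:R ^+ _) => x y; field.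
      by rewrite ler_wpM2r// ler_wpM2l// exprn_ge0// expR_ge0.
    by rewrite ler_wpM2r// ler_wpM2l// exprn_ge0// expR_ge0.
  have h7 : expR (eta * N%:R) ^+ 2 <= expR (N%:R / (8 * t%:R * Q%:R)).
    rewrite -expRM_natl ler_expR ler_pdivlMr ?mulr_gt0//.
    have -> : 2 * (eta * N%:R) * (8 * t%:R * Q%:R) = 16 * t%:R * Q%:R * eta * N%:R by ring.
    by rewrite -[leRHS]mul1r ler_wpM2r.
  have h8 : expR (k.+1%:R : R) * 2 <= expR (N%:R / (4 * t%:R * Q%:R)).
    have -> : N%:R / (4 * t%:R * Q%:R) =
      N%:R / (8 * t%:R * Q%:R) + N%:R / (8 * t%:R * Q%:R) :> R.
      by field; rewrite !gt_eqF.
    rewrite expRD -[k.+1%:R in leLHS]natr1 (expRD k%:R).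
    have e1 := expR1_le4; have ek := expR_gt0 (k%:R : R).
    have : expR k%:R * expR 1 <= expR k%:R * 4 :> R by rewrite ler_wpM2l// ltW.
    have : expR (eta * N%:R) ^+ 2 * expR (N%:R / (8 * t%:R * Q%:R)) <=
      expR (N%:R / (8 * t%:R * Q%:R)) * expR (N%:R / (8 * t%:R * Q%:R)).
      by rewrite ler_wpM2r// expR_ge0.
    by move: h6; clear; lra.
  have h9 : N%:R / (4 * t%:R * Q%:R) <= k.+1%:R :> R.
    rewrite ler_pdivrMr ?mulr_gt0// -!natrM ler_nat.
    move: kN' Nc; clear; nia.
  have := expR_gt0 (k.+1%:R : R).
  have : expR (N%:R / (4 * t%:R * Q%:R)) <= expR k.+1%:R :> R by rewrite ler_expR.
  by move: h8; clear; lra.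
have uQ : `|u - 1| <= 4 / Q%:R by exact: le_trans (dist1_expr_le (ltW u0) t0) yQ.
have u2 : 2^-1 <= u.
  have : 4 / Q%:R <= 2^-1 :> R.
    rewrite ler_pdivrMr//; have : 8 <= Q%:R :> R by rewrite ler_nat.
    by clear; lra.
  have := ler_norm (- (u - 1)); rewrite normrN.
  by move: uQ; clear; lra.
have -> : v - 1 = - ((u - 1) * v).
  by rewrite mulrBl mul1r mulVf ?gt_eqF// opprB.
rewrite normrN normrM [`|v|]gtr0_norm//.
have v2 : v <= 2 by rewrite -[v]invrK -[leRHS]invrK lef_pV2 ?posrE// invr_gt0.
have -> : 8 / Q%:R = 4 / Q%:R * 2 :> R by ring.
by rewrite ler_pM// ltW.
Qed.

(* Binomial expansion of [z |-> v ^ z], truncated at order [N]. *)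
Definition corrector (N : nat) (v : R) : {poly C} :=
  newton N (fun k => ((v - 1) ^+ k)%:C).

Lemma horner_corrector_nat N v n : (n <= N)%N -> (corrector N v).[n%:R] = (v ^+ n)%:C.
Proof.
move=> nN; rewrite horner_newton_nat//.
have -> : v ^+ n = (1 + (v - 1)) ^+ n by congr (_ ^+ n); ring.
rewrite exprDn rmorph_sum; apply: eq_bigr => k _.
by rewrite expr1n mul1r rmorphMn/= mulr_natr.
Qed.

Lemma cmod_corrector_le N v z : cmod z <= N%:R ->
  cmod (corrector N v).[z] <= expR (2 * N%:R * `|v - 1|).
Proof.
move=> zN; rewrite (le_trans (cmod_newton_le _ zN))//.
have x0 : 0 <= 2 * N%:R * `|v - 1| by rewrite !mulr_ge0.
apply: le_trans (expsum_le_expR N.+1 x0); apply: ler_sum => k _.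
by rewrite cmod_real normrX (exprMn _ (2 * N%:R)); apply: eq_ler; ring.
Qed.

(** The corrector cancels the powers of [|alpha|] at integers, so the difference vanishes at the
    first [S] terms of the progression. Its growth [expR (2 * N * |v - 1|)] must be beaten by
    [2 ^+ S]: hence the need for [v] close to 1. *)
Lemma corrected_modulus_small om c0 eta N alpha h c t S : 0 < c0 ->
  interpolates om c0 eta N alpha h -> (0 < t)%N -> (0 < N)%N ->
  (forall k, cmod (om (c + t * k)%N) = 1) -> (10 * (c + t * S) <= N)%N ->
  let v := cmod alpha ^+ 2 in
  forall w, cmod w <= N%:R / 10 ->
  cmod ((modpoly h).[w] * (corrector N v).[w] - 1) <=
  2 * (expR (eta * N%:R) ^+ 2 * expR (2 * N%:R * `|v - 1|) + 1) / 2 ^+ S.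
Proof.
move=> c00 hI t0 N0 om1 SN v w wN.
have [_ c0a aN _ hB] := hI.
have a0 : 0 < cmod alpha by exact: lt_le_trans c0a.
pose D := modpoly h * corrector N v - 1%:P.
have -> : (modpoly h).[w] * (corrector N v).[w] - 1 = D.[w].
  by rewrite /D hornerD hornerN hornerC (hornerM (modpoly h)).
pose xs := [seq ((c + t * k)%:R : C) | k <- iota 0 S].
have szS : size xs = S by rewrite size_map size_iota.
have uxs : uniq xs.
  rewrite map_inj_uniq ?iota_uniq// => i j /eqP; rewrite eqr_nat eqn_add2l eqn_pmul2l//.
  by move=> /eqP.
have rho0 : 0 < N%:R / 10 :> R by rewrite divr_gt0// ltr0n.
rewrite -szS; apply: (poly_small_of_many_zeros rho0 uxs) wN.
  move=> x /mapP[k]; rewrite mem_iota add0n => /andP[_ kS] ->.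
  have ck : (10 * (c + t * k) <= N)%N.
    by rewrite (leq_trans _ SN)// leq_mul2l leq_add2l leq_mul2l (ltnW kS) !orbT.
  have ckN : (c + t * k <= N)%N by rewrite (leq_trans _ ck)// leq_pmull.
  split; last by rewrite cmod_nat ler_pdivlMr// -natrM ler_nat mulnC.
  rewrite /root /D hornerD hornerN hornerC (hornerM (modpoly h)).
  rewrite (interpolates_modpoly c00 hI ckN) om1 expr1n mul1r horner_corrector_nat//.
  by rewrite -rmorphM/= -exprMn mulVf ?expr1n ?subrr// expf_neq0// gt_eqF.
move=> z zN.
have zN' : cmod z <= N%:R.
  by have : 0 <= N%:R :> R by []; move: zN; clear; lra.
rewrite /D hornerD hornerN hornerC (hornerM (modpoly h)).
rewrite (le_trans (cmod_triangleB _ _))// cmod1 lerD2r cmodM.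
rewrite ler_pM ?cmod_ge0//; last exact: cmod_corrector_le.
exact: (cmod_modpoly_le hB).
Qed.

Lemma corrected_modulus_vanishes om c0 eta c t L : 0 < c0 -> 0 < eta ->
  (0 < t <= L)%N -> 16 * (64 * (40 * L%:R ^+ 2)) * eta <= 1 ->
  (forall k, cmod (om (c + t * k)%N) = 1) ->
  forall e, 0 < e -> exists N1, forall N alpha h, (N1 <= N)%N ->
  interpolates om c0 eta N alpha h ->
  forall w, cmod w <= N%:R / 10 ->
  cmod ((modpoly h).[w] * (corrector N (cmod alpha ^+ 2)).[w] - 1) <= e.
Proof.
move=> c00 eta0 /andP[t0 tL] etaL om1 e e0.
(* Put [x = N / (80 t)]. This [Q] gives [2 N |v - 1| <= 16 N / Q = x / 2], and the bound on [eta]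
   gives [2 eta N <= x / 2]; the zeros number at least [4 x], so [2 ^+ S >= expR (2 * x)] and a
   factor [expR (- x)] survives. *)
pose Q := (64 * (40 * t))%N.
have t1 : 1 <= t%:R :> R by rewrite ler1n.
have t0' : 0 < t%:R :> R by rewrite ltr0n.
have etat : 16 * (64 * (40 * t%:R ^+ 2)) * eta <= 1.
  apply: le_trans etaL; rewrite ler_wpM2r ?(ltW eta0)// !ler_wpM2l//.
  by rewrite lerXn2r ?nnegrE// ler_nat.
have QE : Q%:R = 64 * (40 * t%:R) :> R by rewrite /Q !natrM.
have a1 : 0 < (8 * t%:R * Q%:R)^-1 :> R by rewrite invr_gt0 QE !mulr_gt0.
have [r1 [_ hr1]] := expR_eventually_ge (6 * c) 8 a1.
have a2 : 0 < (80 * t%:R)^-1 :> R by rewrite invr_gt0 mulr_gt0.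
have [r2 [_ hr2]] := expR_eventually_ge 0 (4 / e) a2.
exists ((2 * c + 4 * t * Q) + (20 * c + 20 * t + 1) + (Num.truncn r1).+1 + (Num.truncn r2).+1)%N.
move=> N alpha h NN hI w wN.
have [NQ Nct Nr1 Nr2] : [/\ (2 * c + 4 * t * Q <= N)%N, (20 * c + 20 * t + 1 <= N)%N,
    ((Num.truncn r1).+1 <= N)%N & ((Num.truncn r2).+1 <= N)%N].
  move: NN; move: (2 * c + 4 * t * Q)%N (20 * c + 20 * t + 1)%N.
  move: (Num.truncn r1) (Num.truncn r2) => x1 x2 x3 x4; clear => NN.
  by split; lia.
rewrite -(ler_nat R) in Nr1; rewrite -(ler_nat R) in Nr2.
have {}Nr1 : r1 <= N%:R by rewrite (le_trans (ltW (truncnS_gt r1))).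
have {}Nr2 : r2 <= N%:R by rewrite (le_trans (ltW (truncnS_gt r2))).
have near : `|cmod alpha ^+ 2 - 1| <= 8 / Q%:R.
  apply: (base_near_one c00 hI t0 _ om1).
  - by rewrite /Q; move: t0; clear; lia.
  - by apply: le_trans etat; rewrite QE; apply: eq_ler; ring.
  - exact: NQ.
  - by have := hr1 N%:R Nr1; rewrite [_^-1 * _]mulrC.
pose S := ((N %/ 10 - c) %/ t)%N.
have SN : (10 * (c + t * S) <= N)%N.
  have h1 : (t * S <= N %/ 10 - c)%N by rewrite mulnC leq_divM.
  have h2 : (N %/ 10 * 10 <= N)%N by exact: leq_divM.
  have h3 : (N < (N %/ 10).+1 * 10)%N by exact: ltn_ceil.
  by move: h1 h2 h3 Nct; clear; lia.
have SN' : N%:R / (20 * t%:R) <= S%:R :> R.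
  rewrite ler_pdivrMr ?mulr_gt0// -!natrM ler_nat.
  have h1 : (N %/ 10 - c < S.+1 * t)%N by exact: ltn_ceil.
  have h3 : (N < (N %/ 10).+1 * 10)%N by exact: ltn_ceil.
  move: h1 h3 Nct; rewrite mulSn; clear; move: (N %/ 10)%N => d; move: S => S.
  rewrite [(S * (20 * t))%N]mulnCA; move: (S * t)%N => x; lia.
have N0 : (0 < N)%N by move: Nct; clear; lia.
apply: (le_trans (corrected_modulus_small c00 hI t0 N0 om1 SN wN)).
set v := cmod alpha ^+ 2 in near *.
pose x : R := N%:R / (80 * t%:R).
have x0 : 0 <= x by rewrite divr_ge0 ?mulr_ge0.
have e1 : expR (eta * N%:R) ^+ 2 * expR (2 * N%:R * `|v - 1|) <= expR x.
  rewrite -expRM_natl -expRD ler_expR.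
  have h1 : 2 * N%:R * `|v - 1| <= x / 2.
    apply: (@le_trans _ _ (2 * N%:R * (8 / Q%:R))); first by rewrite ler_wpM2l.
    by rewrite QE /x; apply: eq_ler; field; rewrite gt_eqF.
  have h2 : 2 * (eta * N%:R) <= x / 2.
    rewrite /x -mulrA -invfM ler_pdivlMr ?mulr_gt0//.
    have h3 : 16 * (64 * (40 * t%:R ^+ 2)) * eta * N%:R <= 1 * N%:R by rewrite ler_wpM2r.
    apply: le_trans (_ : _ <= 1 * N%:R) _; last by rewrite mul1r.
    apply: le_trans h3.
    have -> : 2 * (eta * N%:R) * (80 * t%:R * 2) = 320 * t%:R * (eta * N%:R) by ring.
    rewrite -[leRHS]mulrA ler_wpM2r ?mulr_ge0 ?(ltW eta0)//.
    by rewrite expr2; move: t1; clear; nra.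
  by move: h1 h2; clear; lra.
have e2 : expR (2 * x) <= 2 ^+ S.
  rewrite (@le_trans _ _ (expR (S%:R * 2^-1)))//.
    rewrite ler_expR ler_pdivlMr//; apply: le_trans SN'.
    by rewrite /x; apply: eq_ler; field; rewrite gt_eqF.
  by rewrite expRM_natl lerXn2r ?nnegrE ?expR_ge0// expR_half_le2.
have e3 := hr2 N%:R Nr2; rewrite expr0 mulr1 [_^-1 * _]mulrC -/x ler_pdivrMr// in e3.
have e4 : 1 <= expR x by rewrite -[leLHS]expR0 ler_expR.
rewrite ler_pdivrMr ?exprn_gt0//.
apply: (@le_trans _ _ (e * expR (2 * x))); last by rewrite ler_wpM2l// ltW.
have -> : 2 * x = x + x by ring.
rewrite expRD.
have : 4 * expR x <= expR x * e * expR x by rewrite ler_wpM2r// expR_ge0.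
by move: e1 e4; rewrite [e * _]mulrA [e * _]mulrC; clear; lra.
Qed.

(** At the integer [m] the corrected product is exactly [|om m|^2], free of [alpha] and [N], so its
    distance to 1 is arbitrarily small. *)
Lemma unimodular_everywhere (om : nat -> C) (c0 eta : R) (c t L : nat) : 0 < c0 -> 0 < eta ->
  (0 < t <= L)%N -> 16 * (64 * (40 * L%:R ^+ 2)) * eta <= 1 ->
  (forall k, cmod (om (c + t * k)%N) = 1) ->
  (forall N0, exists N (alpha : C) (h : {poly C}),
    (N0 <= N)%N /\ interpolates om c0 eta N alpha h) ->
  forall m, cmod (om m) = 1.
Proof.
move=> c00 eta0 tL etaL om1 hN m.
suff : cmod (om m) ^+ 2 - 1 = 0.
  move=> /eqP; rewrite subr_eq0 => /eqP h; apply/eqP.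
  by rewrite -(@eqrXn2 _ 2) ?cmod_ge0// h expr1n.
apply/eqP; rewrite -normr_eq0 eq_le normr_ge0 andbT.
apply/ler_addgt0Pr => e e0; rewrite add0r.
have [N1 hN1] := corrected_modulus_vanishes c00 eta0 tL etaL om1 e0.
have [N [alpha [h [NN hI]]]] := hN (maxn N1 (10 * m)%N).
move: NN; rewrite geq_max => /andP[N1N mN].
have mN' : (m <= N)%N by rewrite (leq_trans _ mN)// leq_pmull.
have := hN1 N alpha h N1N hI m%:R.
rewrite cmod_nat ler_pdivlMr// -natrM ler_nat mulnC => /(_ mN).
rewrite (interpolates_modpoly c00 hI mN') horner_corrector_nat//.
have [_ c0a _ _ _] := hI.
have a0 : 0 < cmod alpha by exact: lt_le_trans c0a.
rewrite -rmorphM/= -mulrA -exprMn mulVf ?expf_neq0 ?gt_eqF// expr1n mulr1.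
by rewrite -[1]/((1 : R)%:C) -rmorphB/= cmod_real.
Qed.

(** A zero of [h] would make the corrected product 0, at distance 1 from 1, against an error of
    1/2. *)
Lemma interpolant_nonvanishing (om : nat -> C) (c0 eta : R) (c t L : nat) : 0 < c0 -> 0 < eta ->
  (0 < t <= L)%N -> 16 * (64 * (40 * L%:R ^+ 2)) * eta <= 1 ->
  (forall k, cmod (om (c + t * k)%N) = 1) ->
  exists N1, forall N alpha h, (N1 <= N)%N ->
  interpolates om c0 eta N alpha h ->
  forall w, cmod w <= N%:R / 10 -> h.[w] != 0.
Proof.
move=> c00 eta0 tL etaL om1.
have e0 : 0 < 2^-1 :> R by [].
have [N1 hN1] := corrected_modulus_vanishes c00 eta0 tL etaL om1 e0.
exists N1 => N alpha h N1N hI w wN; apply/eqP => hw.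
have := hN1 N alpha h N1N hI w wN.
rewrite horner_modpoly hw !mul0r sub0r cmodN cmod1; lra.
Qed.

Lemma cmod_prod1B_le (I : Type) (s : seq I) (e : I -> C) :
  cmod (\prod_(i <- s) (1 - e i) - 1) <= expR (\sum_(i <- s) cmod (e i)) - 1.
Proof.
elim: s => [|i s IH]; first by rewrite !big_nil expR0 !subrr cmod0.
rewrite !big_cons expRD.
have -> : (1 - e i) * \prod_(j <- s) (1 - e j) - 1 =
  (1 - e i) * (\prod_(j <- s) (1 - e j) - 1) - e i by ring.
rewrite (le_trans (cmod_triangleB _ _))// cmodM.
have h1 : cmod (1 - e i) <= 1 + cmod (e i).
  by rewrite (le_trans (cmod_triangleB _ _))// cmod1.
have h2 := expR_ge1Dx (cmod (e i)).
have h3 := cmod_ge0 (e i).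
set E := expR (\sum_(j <- s) _) in IH *.
have E1 : 0 <= E - 1 by apply: le_trans IH; exact: cmod_ge0.
apply: (@le_trans _ _ ((1 + cmod (e i)) * (E - 1) + cmod (e i))).
  by rewrite lerD2r ler_pM ?cmod_ge0.
have h4 : (1 + cmod (e i)) * E <= expR (cmod (e i)) * E.
  by rewrite ler_wpM2r// /E expR_ge0.
by move: h4; clear; lra.
Qed.

(* All the roots [a] of [h] lie outside the disk of radius [N / 10], and there are
   at most [N] of them, so the deviation of [h] from a geometric progression at the
   points [m, m + 1, m + 2] is at most the sum of [cmod a ^- 2], which is [O (1 / N)]. *)
Lemma log_linear_defect (om : nat -> C) (c0 eta : R) (N : nat) (alpha : C) h m : 0 < c0 ->
  interpolates om c0 eta N alpha h -> (20 * m.+2 <= N)%N ->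
  (forall w, cmod w <= N%:R / 10 -> h.[w] != 0) ->
  (forall n, cmod (om n) = 1) ->
  cmod (om m.+2 * om m - om m.+1 ^+ 2) <= expR (400 / N%:R) - 1 :> R.
Proof.
move=> c00 hI mN hnz om1.
have [hsz c0a _ hom _] := hI.
have N0 : 0 < N%:R :> R by rewrite ltr0n; move: mN; clear; lia.
have h0 : h`_0 != 0 by rewrite -horner_coef0 hnz// cmod0 divr_ge0.
have [s [s0 hs hE]] := poly_lpoly h0.
have hz z : h.[z] = h`_0 * linprod s z by rewrite {1}hE hornerZ horner_lpoly.
have ss : (size s <= N)%N.
  have lh0 : lead_coef h != 0 by rewrite lead_coef_eq0; apply: contraNneq h0 => ->; rewrite coef0.
  by move: hsz; rewrite hs size_scale// size_prod_XsubC ltnS.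
have sN a : a \in s -> N%:R / 10 < cmod a.
  move=> as_; rewrite ltNge; apply/negP => /hnz.
  rewrite hz /linprod (big_rem a)//= divff; last exact: s0.
  by rewrite subrr mul0r mulr0 eqxx.
pose g (k : nat) := linprod s k%:R.
have omE k : (k <= m.+2)%N -> om k = h`_0 * g k * alpha ^+ k.
  move=> km; rewrite -hom ?hz//.
  by move: km mN; clear; lia.
pose fac a (k : nat) : C := 1 - k%:R / a.
have gE k : g k = \prod_(a <- s) fac a k by [].
have mN2 : m.+1%:R <= N%:R / 20 :> R.
  by rewrite ler_pdivlMr// -natrM ler_nat; move: mN; clear; lia.
have facB a : a \in s -> 2^-1 <= cmod (fac a m.+1).
  move=> as_; have aN := sN a as_.
  have a0 : 0 < cmod a by rewrite cmod_gt0 s0.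
  have : cmod (m.+1%:R / a) <= 2^-1.
    rewrite cmodM cmodV cmod_nat ler_pdivrMr//.
    by move: mN2 aN; clear; lra.
  have := cmod_ler_sub 1 (- (m.+1%:R / a)); rewrite cmod1 cmodN /fac.
  by clear; lra.
(* The factors at [m], [m.+1], [m.+2] form an arithmetic progression of step [- a^-1], so the
   product of the outer two is the middle square minus [a^-1 ^+ 2]. *)
pose e a : C := a^-1 ^+ 2 / fac a m.+1 ^+ 2.
have facE a : a \in s -> fac a m.+2 * fac a m = fac a m.+1 ^+ 2 * (1 - e a).
  move=> as_; have f0 : fac a m.+1 != 0.
    by rewrite -cmod_gt0 (lt_le_trans _ (facB a as_)).
  have cancel (x y : C) : x != 0 -> x * (1 - y / x) = x - y by move=> x0; field.
  rewrite /e cancel ?expf_neq0// /fac.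
  rewrite -[m.+2%:R]natr1 -[m.+1%:R]natr1; ring.
have gP : g m.+2 * g m = g m.+1 ^+ 2 * \prod_(a <- s) (1 - e a).
  rewrite !gE -prodrXl -!big_split/=; apply: eq_big_seq => a as_.
  by rewrite facE.
have -> : om m.+2 * om m - om m.+1 ^+ 2 =
    om m.+1 ^+ 2 * (\prod_(a <- s) (1 - e a) - 1).
  rewrite !omE ?leqnSn//; last by rewrite ltnW.
  transitivity (h`_0 ^+ 2 * (alpha ^+ m * alpha ^+ m.+2) * (g m.+2 * g m) -
      (h`_0 * g m.+1 * alpha ^+ m.+1) ^+ 2); first by ring.
  by rewrite gP !exprS; ring.
rewrite cmodM cmodX om1 expr1n mul1r (le_trans (cmod_prod1B_le _ _))// lerD2r ler_expR.
(* [|a|^-2] is at most [100 / N ^+ 2], and dividing by the squared middle factor costs at most 4. *)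
apply: (@le_trans _ _ (\sum_(a <- s) 400 / N%:R ^+ 2)).
  rewrite big_seq [leRHS]big_seq; apply: ler_sum => a as_.
  have aN := sN a as_; have a0 : 0 < cmod a by rewrite cmod_gt0 s0.
  rewrite /e cmodM cmodV !cmodX cmodV.
  have f4 : 4^-1 <= cmod (fac a m.+1) ^+ 2.
    have := facB a as_; set x := cmod _; rewrite expr2.
    by clear; nra.
  have f5 : (cmod (fac a m.+1) ^+ 2)^-1 <= 4.
    by rewrite -[leRHS]invrK lef_pV2 ?posrE// (lt_le_trans _ f4).
  have -> : 400 / N%:R ^+ 2 = (10 / N%:R) ^+ 2 * 4 :> R.
    by field; rewrite gt_eqF.
  rewrite ler_pM ?exprn_ge0 ?invr_ge0 ?exprn_ge0 ?cmod_ge0//.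
  rewrite lerXn2r ?nnegrE ?invr_ge0 ?cmod_ge0 ?divr_ge0//.
  rewrite -[leRHS]invrK lef_pV2 ?posrE ?invr_gt0 ?divr_gt0// invf_div.
  by rewrite ltW.
rewrite big_const_seq iter_addr_0 count_predT -[_ *+ size s]mulr_natr.
rewrite ler_pdivlMr// mulrAC -mulrA [N%:R * _]mulrC.
have -> : 400 / N%:R ^+ 2 * ((size s)%:R * N%:R) = 400 * ((size s)%:R / N%:R) :> R.
  by field; rewrite gt_eqF.
have : 0 <= 400 :> R by exact: ler0n.
by move: (400 : R) => K K0; rewrite ler_piMr// ler_pdivrMr// mul1r ler_nat.
Qed.

(** The relation between three consecutive terms has the same power of [alpha] on both sides, so it
    can be tested with a different [alpha] for each [N], and the defect tends to 0. *)
Lemma unimodular_geometric (om : nat -> C) (c0 eta : R) (c t L : nat) : 0 < c0 -> 0 < eta ->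
  (0 < t <= L)%N -> 16 * (64 * (40 * L%:R ^+ 2)) * eta <= 1 ->
  (forall k, cmod (om (c + t * k)%N) = 1) ->
  (forall N0, exists N (alpha : C) (h : {poly C}),
    (N0 <= N)%N /\ interpolates om c0 eta N alpha h) ->
  forall m, om m = om 0%N * (om 1%N / om 0%N) ^+ m.
Proof.
move=> c00 eta0 tL etaL om1 hN.
have u := unimodular_everywhere c00 eta0 tL etaL om1 hN.
have nz k : om k != 0 by rewrite -cmod_gt0 u.
have [N1 hN1] := interpolant_nonvanishing c00 eta0 tL etaL om1.
have step m : om m.+2 * om m = om m.+1 ^+ 2.
  apply/eqP; rewrite -subr_eq0; apply/eqP; apply: cmod_arbitrarily_small => e e0.
  have [N [alpha [h [NN hI]]]] :=
    hN (maxn N1 (maxn (20 * m.+2) (Num.truncn (400 * (1 + e) / e)).+1)).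
  move: NN; rewrite !geq_max => /and3P[N1N mN eN].
  rewrite (le_trans (log_linear_defect c00 hI mN (hN1 N alpha h N1N hI) u))//.
  have N0 : 0 < N%:R :> R by rewrite ltr0n; move: mN; clear; lia.
  have hNe : 400 * (1 + e) / e <= N%:R.
    by rewrite (le_trans (ltW (truncnS_gt _)))// ler_nat.
  have := expR_ge1Dx (- (400 / N%:R : R)); rewrite expRN.
  have E0 := expR_gt0 (400 / N%:R : R); move: (expR _) E0 => E E0 h1.
  have h2 : 1 - 400 / N%:R >= (1 + e)^-1.
    have e1 : 0 < 1 + e by rewrite addr_gt0.
    have : 400 / N%:R <= e / (1 + e).
      rewrite ler_pdivrMr// mulrAC ler_pdivlMr// mulrC.
      by move: hNe; rewrite ler_pdivrMr// [(1 + e) * _]mulrC [e * _]mulrC.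
    have -> : e / (1 + e) = 1 - (1 + e)^-1 by field; rewrite gt_eqF.
    by clear; lra.
  have h3 : (1 + e)^-1 <= E^-1 by exact: le_trans h2 h1.
  rewrite lef_pV2 ?posrE ?addr_gt0// in h3.
  by move: h3; clear; lra.
suff H m : om m = om 0%N * (om 1%N / om 0%N) ^+ m /\
    om m.+1 = om m * (om 1%N / om 0%N) by move=> m; case: (H m).
elim: m => [|m [IH1 IH2]].
  by rewrite expr0 mulr1 mulrCA mulfV ?mulr1.
split; first by rewrite IH2 {1}IH1 exprSr [RHS]mulrA.
apply: (mulIf (nz m)); rewrite step expr2 {2}IH2.
by rewrite mulrA mulrAC.
Qed.

End Rigidity.

(** * Lower limits and coefficient bounds *)

Lemma le_limf_einf (R : realType) (I : choiceType) (T : filteredType I)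
    (U : set_system T) (u : T -> \bar R) (x : \bar R) :
  U [set t | (x <= u t)%E] -> (x <= limf_einf u U)%E.
Proof.
move=> xu; rewrite limf_einfE.
apply: (@le_trans _ _ (ereal_inf (u @` [set t | (x <= u t)%E]))).
  by apply: le_ereal_inf_tmp => _ [t xut <-].
by apply: ereal_sup_ubound; exists [set t | (x <= u t)%E].
Qed.

Lemma limf_einf_gt (R : realType) (I : choiceType) (T : filteredType I)
    (U : set_system T) {FU : Filter U} (u : T -> \bar R) (x : \bar R) :
  (x < limf_einf u U)%E -> U [set t | (x <= u t)%E].
Proof.
rewrite limf_einfE => /ereal_sup_gt[_ [V UV <-]] xV; apply: filterS UV => t Vt /=.
by rewrite (le_trans (ltW xV))//; apply: ereal_inf_lbound; exists t.
Qed.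

Section Main.
Variable R : realType.
Local Notation C := R[i].

Lemma lower_density_unimodular (om : nat -> C) (d : R) : 0 < d ->
  lower_density R [set n | cmod (om n) = 1] = d%:E -> unimodular_density_ge (d / 2) om.
Proof.
move=> d0; rewrite /lower_density => hd.
have : ((d / 2)%:E < d%:E)%E by rewrite lte_fin; lra.
rewrite -hd => /limf_einf_gt [N0 _ hN0]; exists (maxn 1 N0) => N.
rewrite geq_max => /andP[N1 NN0].
have := hN0 N NN0; rewrite /= lee_fin ler_pdivlMr ?ltr0n//.
congr (_ <= _%:R); apply: eq_bigr => n _; congr (nat_of_bool _).
by apply/idP/idP => [|/eqP ?]; [rewrite inE/= => ->; rewrite eqxx|rewrite inE].
Qed.

Lemma few_zeros_frequently (F : Cplx R -> Cplx R) (chi : R) : 0 < chi ->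
  ~ (chi%:E <= limf_einf (fun r : R => num_zeros F r * (r^-1)%:E) (pinfty_nbhs R))%E ->
  forall r0, exists r, r0 <= r /\ (num_zeros F r < (chi * r)%:E)%E.
Proof.
move=> chi0 H r0; apply: contrapT => hn; apply: H; apply: le_limf_einf.
exists (Num.max r0 0); split; first by rewrite num_real.
move=> r; rewrite gt_max => /andP[r0r r_gt0] /=.
have h : ((chi * r)%:E <= num_zeros F r)%E.
  by rewrite leNgt; apply/negP => h; apply: hn; exists r; split=> //; exact: ltW.
apply: (@le_trans _ _ ((chi * r)%:E * (r^-1)%:E)%E).
  by rewrite -EFinM lee_fin mulfK ?gt_eqF.
by rewrite lee_wpmul2r// lee_fin invr_ge0 ltW.
Qed.

(** Abel's lemma: convergence at the single point [2 * r] bounds the terms there by 2, and on the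
    disk of radius [r] they are smaller by [2 ^- i]. *)
Lemma partial_sum_near (c : nat -> C) (F : C -> C) (r : R) : power_sum c F -> 0 < r ->
  exists m0, forall m n z, (m0 <= m <= n)%N -> cmod z <= r ->
  cmod (\sum_(i < n) c i * z ^+ i - \sum_(i < m) c i * z ^+ i) <= 4.
Proof.
move=> cF r0.
have [m0 _ hm0] := cF (2 * r)%:C 1 ltr01; exists m0 => m n z /andP[m0m mn] zr.
have cb k : (m0 <= k)%N -> cmod (c k) * (2 * r) ^+ k <= 2.
  move=> m0k; have /= h1 := hm0 k m0k; have /= h2 := hm0 k.+1 (leqW m0k).
  have -> : cmod (c k) * (2 * r) ^+ k = cmod (c k * (2 * r)%:C ^+ k).
    by rewrite cmodM cmodX cmod_real ger0_norm// mulr_ge0// ltW.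
  have -> : c k * (2 * r)%:C ^+ k = (\sum_(i < k.+1) c i * (2 * r)%:C ^+ i - F (2 * r)%:C) -
      (\sum_(i < k) c i * (2 * r)%:C ^+ i - F (2 * r)%:C).
    by rewrite big_ord_recr/=; ring.
  by rewrite (le_trans (cmod_triangleB _ _))//; move: h1 h2; clear; lra.
rewrite -(subnKC mn) big_split_ord/= [X in cmod X]addrC addKr.
rewrite (le_trans (cmod_sum _ _ _))//.
apply: (@le_trans _ _ (\sum_(i < n - m) 2 * 2^-1 ^+ i)).
  apply: ler_sum => i _; rewrite cmodM cmodX.
  apply: (@le_trans _ _ (cmod (c (m + i)%N) * r ^+ (m + i))).
    by rewrite ler_wpM2l ?cmod_ge0// lerXn2r ?nnegrE ?cmod_ge0// ltW.
  have := cb (m + i)%N (leq_trans m0m (leq_addr _ _)).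
  rewrite exprMn mulrCA mulrC -ler_pdivlMr ?exprn_gt0// => /le_trans; apply.
  rewrite ler_wpM2l// -exprVn; apply: ler_wiXn2l; [lra|lra|exact: leq_addl].
rewrite -mulr_sumr; have := sum_halves_le2 R (n - m); lra.
Qed.

Lemma cauchy_estimate (c : nat -> C) (F : C -> C) (r B : R) n : power_sum c F -> 0 < r ->
  (forall z, cmod z = r -> cmod (F z) <= B) -> cmod (c n) * r ^+ n <= B + 4.
Proof.
move=> cF r0 FB; have [m0 hm0] := partial_sum_near cF r0.
pose m := maxn m0 n.+1; pose T : {poly C} := \poly_(i < m) c i.
have TE z : T.[z] = \sum_(i < m) c i * z ^+ i by rewrite horner_poly.
have TB z : cmod z = r -> cmod T.[z] <= B + 4.
  move=> zr; rewrite -[T.[z]](subrK (F z)) addrC.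
  rewrite (le_trans (cmod_triangle _ _))// lerD ?FB// TE cmodB.
  apply: (ccvg_le (ccvgB (cF z) (ccvg_cst (\sum_(i < m) c i * z ^+ i)))).
  exists m => // k /= mk; apply: hm0; last by rewrite zr.
  by rewrite mk leq_maxl.
have := cauchy_poly r0 TB n.
by rewrite coef_poly ifT// leq_maxr.
Qed.

(** Cauchy's estimate at radius [n] together with [n! <= n ^ n]. The type worsens to
    [expR (sigma + 1)], which is harmless since it still depends on [sigma] alone. Index 0 is
    treated apart because the radius must be positive. *)
Lemma exponential_type_exp_bounded (c : nat -> C) (F : Cplx R -> Cplx R) (sigma : R) :
  0 <= sigma -> power_sum c F -> exponential_type_le sigma F ->
  exists A, exp_bounded A (expR (sigma + 1)) c.
Proof.
move=> s0 cF /(_ 1 ltr01) [A hA]; set s := sigma + 1 in hA *.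
have s_ge0 : 0 <= s by rewrite addr_ge0.
exists (`|A| + 4 + cmod (c 0%N)) => -[|n].
  by rewrite expr0 fact0 divr1 mulr1 lerDr addr_ge0.
pose r : R := n.+1%:R; have r0 : 0 < r by rewrite ltr0n.
have FB z : cmod z = r -> cmod (F z) <= `|A| * expR (s * r).
  move=> zr; apply: (le_trans (hA z)).
  by rewrite -[cabs z]/(cmod z) zr ler_wpM2r ?expR_ge0// ler_norm.
have h := cauchy_estimate n.+1 cF r0 FB.
have e1 : 1 <= expR (s * r).
  by rewrite -[leLHS]expR0 ler_expR mulr_ge0// ltW.
have nf : n.+1`!%:R <= r ^+ n.+1 :> R.
  rewrite /r -natrX ler_nat fact_prod.
  have -> : (n.+1 ^ n.+1 = \prod_(1 <= i < n.+2) n.+1)%N.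
    by rewrite prod_nat_const_nat subSS subn0.
  by rewrite big_nat [leqRHS]big_nat; apply: leq_prod => i /andP[].
rewrite mulrA ler_pdivlMr ?ltr0n ?fact_gt0//.
apply: le_trans (ler_wpM2l (cmod_ge0 _) nf) _; apply: (le_trans h).
have -> : expR s ^+ n.+1 = expR (s * r) by rewrite -expRM_natl mulrC.
have := cmod_ge0 (c 0%N); move: e1; move: (expR _) (cmod _) `|A| => x y a x1 y0.
by clear -x1 y0; nra.
Qed.

End Main.

Theorem theorem3 (R : realType) (d sigma : R) (hd : 0 < d) (hsigma : 0 <= sigma) :
  exists chi : R, 0 < chi /\
    forall (omega : nat -> Cplx R) (F : Cplx R -> Cplx R),
      entire F ->
      (forall z : Cplx R,
         series (fun n : nat => omega n * (z ^+ n / n`!%:R)) @ \oo --> F z) ->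
      exponential_type_le sigma F ->
      lower_density R [set n : nat | cabs (omega n) = 1] = d%:E ->
      (chi%:E <= limf_einf (fun r : R => num_zeros F r * (r^-1)%:E) (pinfty_nbhs R))%E
      \/ exists Theta alpha : Cplx R,
           [/\ cabs alpha = 1, cabs Theta = 1 &
               forall z : Cplx R, F z = Theta * cexp (alpha * z)].
Proof.
(* A lower limit equal to [d] gives an eventual inequality only below [d]. *)
pose delta := d / 2; have delta0 : 0 < delta by rewrite divr_gt0.
have [L [delta1 [L0 delta10 hpairs]]] := pairs_exist delta0.
(* Chosen so that [16 * c0], the density asked for by [interpolates_exist], is [delta]. *)
pose c0 := d / 32; have c00 : 0 < c0 by rewrite divr_gt0.
have L0' : 0 < 16 * (64 * (40 * L%:R ^+ 2)) :> R by rewrite !mulr_gt0 ?exprn_gt0 ?ltr0n.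
(* The first bound serves the periodicity of the moduli, the second the rigidity for every period up
   to [L]. *)
pose eta1 := Num.min (delta1 / 8) (16 * (64 * (40 * L%:R ^+ 2)))^-1.
have eta10 : 0 < eta1 by rewrite lt_min invr_gt0 L0' divr_gt0.
have eta1d : 8 * eta1 <= delta1.
  have : eta1 <= delta1 / 8 by rewrite ge_min lexx.
  by clear; lra.
have eta1L : 16 * (64 * (40 * L%:R ^+ 2)) * eta1 <= 1.
  by rewrite mulrC -ler_pdivlMr// mul1r ge_min lexx orbT.
have [eta [eta0 hinterp]] := interpolates_exist c00 eta10.
have [chi [chi0 hfew]] := few_zeros_exponential (expR_ge0 (sigma + 1)) eta0.
exists chi; split=> // omega F _ Fser Ftype Fdens.
have [|few] := pselect (chi%:E <= limf_einf (fun r : R => num_zeros F r * (r^-1)%:E)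
  (pinfty_nbhs R))%E; [by left|right].
have {}few := few_zeros_frequently chi0 few.
pose c (n : nat) : R[i] := omega n / n`!%:R.
have cF : power_sum c F.
  move=> z; have /ccvgP := Fser z; apply: ccvg_eq => n.
  rewrite /series/= big_mkord; apply: eq_bigr => i _.
  by rewrite /c mulrA mulrAC.
have dens := lower_density_unimodular hd Fdens.
have [A cA] := exponential_type_exp_bounded hsigma cF Ftype.
have [a a1] : exists a, cmod (omega a) = 1.
  have [N0 /(_ N0.+1 (leqnSn _))] := dens.
  apply: contraPP => /forallNP hn; rewrite big1 => [|n _].
    by apply/negP; rewrite -ltNge mulr_gt0// ltr0n.
  by have /eqP/negbTE -> := hn n.
have cnz : exists n, c n != 0.
  exists a; rewrite mulf_neq0 ?invr_eq0 ?pnatr_eq0 -?lt0n ?fact_gt0//.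
  by rewrite -cmod_gt0 a1.
have {}few := hfew c A F cA cF cnz few.
have c0d : 16 * c0 = delta by rewrite /c0 /delta; field.
have hN := hinterp omega; rewrite c0d in hN; have {}hN := hN dens few.
have [t tL per] := eventually_periodic_modulus c00 delta10 eta1d (hpairs omega dens) hN.
(* One unimodular index and the period give a whole unimodular progression. *)
have um k : cmod (omega (a + t * k)%N) = 1.
  by elim: k => [|k IH]; rewrite ?muln0 ?addn0// mulnS addnCA addnC per.
have geom := unimodular_geometric c00 eta10 tL eta1L um hN.
have um1 := unimodular_everywhere c00 eta10 tL eta1L um hN.
exists (omega 0%N), (omega 1%N / omega 0%N); split.
- by rewrite -[cabs _]/(cmod _) cmodM cmodV !um1 divr1.
- exact: um1.
move=> z; apply: ccvg_unique (cF z) _.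
apply: ccvg_eq (ccvgM (ccvg_cst (omega 0%N)) (ccvg_expsum (omega 1%N / omega 0%N * z))) => n.
rewrite mulr_sumr; apply: eq_bigr => i _.
rewrite /c (geom i) exprMn; move: (nat_of_ord i) (omega 1%N / _) => k u.
by ring.
Qed.
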